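(* Let $n>3$ be odd. If $f:\Omega\subseteq\mathbb{R}^{n+1}\to\mathbb{R}_n$ is (the restriction of) a slice-regular function, where $\Omega=\Omega_D\cap\mathbb{R}^{n+1}$ is open in $\mathbb{R}^{n+1}$, then: (a) $(\Delta_{n+1})^{\frac{n-3}{2}}f'_s$ is harmonic on $\Omega$. (b) $\overline\partial(\Delta_{n+1})^{\frac{n-1}{2}}f=(\Delta_{n+1})^{\frac{n-1}{2}}\overline\partial f=(1-n)(\Delta_{n+1})^{\frac{n-1}{2}}f'_s=0$. (c) $(\Delta_{n+1})^{\frac{n+1}{2}}f=0$, i.e. every slice-regular function on $\mathbb{R}_n$ is polyharmonic.
   Context: $\mathbb{R}_n$ is the real Clifford algebra generated by $e_1,\dots,e_n$ with $e_ie_j+e_je_i=-2\delta_{ij}$; $x\mapsto x^c$ (Clifford conjugation) is the unique linear antiinvolution with $e_i^c=-e_i$. The paravector space $\{x_0+x_1e_1+\cdots+x_ne_n\}\subset\mathbb{R}_n$ is identified with $\mathbb{R}^{n+1}$; $\Delta_{n+1}=\sum_{i=0}^n\partial^2/\partial x_i^2$ and $\overline\partial=\frac{\partial}{\partial x_0}+\sum_{i=1}^ne_i\frac{\partial}{\partial x_i}$. Let $\mathbb{S}_{\mathbb{R}_n}=\{J\in\mathbb{R}_n: J+J^c=0,\ JJ^c=1\}$, $\mathbb{C}_J=\langle 1,J\rangle$, and let $\mathcal{Q}_{\mathbb{R}_n}=\bigcup_{J\in\mathbb{S}_{\mathbb{R}_n}}\mathbb{C}_J$ be the quadratic cone, which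 contains $\mathbb{R}^{n+1}$. For $x\in\mathcal{Q}_{\mathbb{R}_n}$, $\operatorname{Im}(x)=\frac{x-x^c}{2}$. For $D\subseteq\mathbb{C}$ conjugation-invariant, $\Omega_D=\{\alpha+J\beta: \alpha+i\beta\in D,\ J\in\mathbb{S}_{\mathbb{R}_n}\}$. A stem function on $D$ is a map $F=F_1+\imath F_2:D\to\mathbb{R}_n\otimes_{\mathbb{R}}\mathbb{C}$ ($F_1,F_2$ being $\mathbb{R}_n$-valued, $\imath^2=-1$) with $F(\overline z)=\overline{F(z)}$, where $\overline{a+\imath b}=a-\imath b$. It induces the (left) slice function $f=\mathcal{I}(F):\Omega_D\to\mathbb{R}_n$, $f(\alpha+J\beta)=F_1(\alpha+i\beta)+JF_2(\alpha+i\beta)$; $f$ is slice-regular if $F$ is holomorphic (with respect to the complex structure given by $\imath$). The same symbol denotes the restriction of $f$ to $\Omega$. The spherical derivative of $f$ is $f'_s(x)=\frac12\operatorname{Im}(x)^{-1}(f(x)-f(x^c))$ for $x\notin\mathbb{R}$; for $f$ slice-regular it extends real-analytically to the real points of $\Omega$. An $\mathbb{R}_n$-valued function is harmonic if all its real components are. *)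

(* Defs.v *)
From HB Require Import structures.
From mathcomp Require Import all_boot all_order all_algebra.
From mathcomp Require Import complex.
From mathcomp Require Import ring.
From mathcomp Require Import all_classical all_reals all_analysis.

Set Implicit Arguments.
Unset Strict Implicit.
Unset Printing Implicit Defensive.

Import Order.TTheory GRing.Theory Num.Theory numFieldNormedType.Exports.

Local Open Scope classical_set_scope.
Local Open Scope ring_scope.

(** * The real Clifford algebra R_n

An element is its family of coordinates in the basis
e_A = e_(a_1) * ... * e_(a_k), for A = {a_1 < ... < a_k} a subset of 'I_n.
The generators e_1, ..., e_n are indexed from 0, i.e., by 'I_n. *)

Definition cliff (R : realType) (n : nat) : Type := {ffun {set 'I_n} -> R}.

Section Clifford.
Variables (R : realType) (n : nat).
Implicit Types (A B C : {set 'I_n}) (x y z : cliff R n).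

HB.instance Definition _ :=
  GRing.Lmodule.copy (cliff R n) {ffun {set 'I_n} -> R^o}.

Definition symdiff A B : {set 'I_n} := (A :\: B) :|: (B :\: A).

(* Sorting the word e_A e_B takes one transposition of distinct generators for
   each pair b < a, and then one contraction e_a e_a = -1 for each a = b. *)
Definition ninv A B : nat := \sum_(a in A) \sum_(b in B) (b <= a)%N.

Definition csign A B : R := (-1) ^+ ninv A B.

(* e_A * e_B = csign A B e_(symdiff A B), extended bilinearly *)
Definition cliff_mul x y : cliff R n :=
  [ffun C => \sum_A csign A (symdiff A C) * x A * y (symdiff A C)].

Definition cliff_one : cliff R n := [ffun A => (A == finset.set0)%:R].

Lemma in_symdiff A B i : (i \in symdiff A B) = (i \in A) (+) (i \in B).
Proof. by rewrite !inE; do 2!case: (_ \in _). Qed.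

Lemma symdiffC A B : symdiff A B = symdiff B A.
Proof. by apply/setP => i; rewrite !in_symdiff addbC. Qed.

Lemma symdiffA A B C : symdiff A (symdiff B C) = symdiff (symdiff A B) C.
Proof. by apply/setP => i; rewrite !in_symdiff addbA. Qed.

Lemma symdiffK A B : symdiff A (symdiff A B) = B.
Proof. by apply/setP => i; rewrite !in_symdiff addbA addbb. Qed.

Lemma symdiff0 A : symdiff finset.set0 A = A.
Proof. by apply/setP => i; rewrite in_symdiff inE. Qed.

Lemma symdiff_bij A : bijective (symdiff A).
Proof. by exists (symdiff A); exact: symdiffK. Qed.

Lemma odd_ninv A B : odd (ninv A B) =
  \big[addb/false]_a \big[addb/false]_b [&& a \in A, b \in B & (b <= a)%N].
Proof.
rewrite /ninv big_mkcond (big_morph odd oddD (erefl _)).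
apply: eq_bigr => a _; case: ifP => aA.
  rewrite big_mkcond (big_morph odd oddD (erefl _)); apply: eq_bigr => b _.
  by case: (b \in B) => //=; case: (b <= a)%N.
by rewrite big1.
Qed.

Lemma odd_ninvDl A B C :
  odd (ninv (symdiff A B) C) = odd (ninv A C) (+) odd (ninv B C).
Proof.
rewrite !odd_ninv -big_split; apply: eq_bigr => a _ /=.
rewrite -big_split; apply: eq_bigr => b _ /=.
by rewrite in_symdiff; case: (a \in A); case: (a \in B) => //=;
   rewrite ?addbb ?addbF.
Qed.

Lemma odd_ninvDr A B C :
  odd (ninv A (symdiff B C)) = odd (ninv A B) (+) odd (ninv A C).
Proof.
rewrite !odd_ninv -big_split; apply: eq_bigr => a _ /=.
rewrite -big_split; apply: eq_bigr => b _ /=.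
by rewrite in_symdiff; case: (a \in A); case: (b \in B); case: (b \in C);
   rewrite //= ?addbb ?addbF.
Qed.

Lemma csignDl A B C : csign (symdiff A B) C = csign A C * csign B C.
Proof. by rewrite /csign -signr_odd odd_ninvDl signr_addb !signr_odd. Qed.

Lemma csignDr A B C : csign A (symdiff B C) = csign A B * csign A C.
Proof. by rewrite /csign -signr_odd odd_ninvDr signr_addb !signr_odd. Qed.

Lemma csign0l A : csign finset.set0 A = 1.
Proof. by rewrite /csign /ninv big_set0. Qed.

Lemma csign0r A : csign A finset.set0 = 1.
Proof. by rewrite /csign /ninv big1// => i _; rewrite big_set0. Qed.

Lemma csign2 A B : csign A B * csign A B = 1.
Proof. by rewrite /csign -expr2 sqrr_sign. Qed.

Lemma cliff_mulA : associative cliff_mul.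
Proof.
move=> x y z; apply/ffunP => D; rewrite !ffunE.
under [RHS]eq_bigr => C _ do rewrite ffunE mulr_sumr mulr_suml.
rewrite [RHS]exchange_big /=; apply: eq_bigr => A _; rewrite ffunE mulr_sumr.
rewrite [RHS](reindex (symdiff A)) /=; last exact/onW_bij/symdiff_bij.
apply: eq_bigr => B _; rewrite symdiffK.
have -> : symdiff (symdiff A B) D = symdiff B (symdiff A D).
  by rewrite symdiffA (symdiffC A).
rewrite !csignDl !csignDr; ring: (csign2 A B).
Qed.

Lemma cliff_mul1l : left_id cliff_one cliff_mul.
Proof.
move=> x; apply/ffunP => C; rewrite ffunE (bigD1 finset.set0) //= big1 => [|A A0].
  by rewrite ffunE eqxx csign0l symdiff0 !mul1r addr0.
by rewrite ffunE (negbTE A0) mulr0 mul0r.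
Qed.

Lemma cliff_mul1r : right_id cliff_one cliff_mul.
Proof.
move=> x; apply/ffunP => C; rewrite ffunE (bigD1 C) //= big1 => [|A AC].
  have -> : symdiff C C = finset.set0.
    by apply/setP => i; rewrite in_symdiff addbb inE.
  by rewrite ffunE eqxx csign0r mul1r mulr1 addr0.
rewrite ffunE; case: eqP => [AC0|_]; last by rewrite mulr0.
by move: AC; rewrite -(symdiffK A C) AC0 symdiffC symdiff0 eqxx.
Qed.

Lemma cliff_mulDl : left_distributive cliff_mul +%R.
Proof.
move=> x y z; apply/ffunP => C; rewrite !ffunE -big_split /=.
by apply: eq_bigr => A _; rewrite ffunE mulrDr mulrDl.
Qed.

Lemma cliff_mulDr : right_distributive cliff_mul +%R.
Proof.
move=> x y z; apply/ffunP => C; rewrite !ffunE -big_split /=.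
by apply: eq_bigr => A _; rewrite ffunE mulrDr.
Qed.

Lemma cliff_one_neq0 : cliff_one != 0.
Proof.
by apply/eqP => /ffunP/(_ finset.set0)/eqP; rewrite !ffunE eqxx oner_eq0.
Qed.

HB.instance Definition _ := GRing.Zmodule_isNzRing.Build (cliff R n)
  cliff_mulA cliff_mul1l cliff_mul1r cliff_mulDl cliff_mulDr cliff_one_neq0.

Lemma cliff_scaleAl (a : R) x y : a *: (x * y) = (a *: x) * y.
Proof.
apply/ffunP => C; rewrite !ffunE scaler_sumr; apply: eq_bigr => A _.
by rewrite ffunE /GRing.scale /= !mulrA (mulrC a).
Qed.

HB.instance Definition _ :=
  GRing.Lmodule_isLalgebra.Build R (cliff R n) cliff_scaleAl.

Lemma cliff_scaleAr (a : R) x y : a *: (x * y) = x * (a *: y).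
Proof.
apply/ffunP => C; rewrite !ffunE scaler_sumr; apply: eq_bigr => A _.
by rewrite ffunE /GRing.scale /=; ring.
Qed.

HB.instance Definition _ :=
  GRing.Lalgebra_isAlgebra.Build R (cliff R n) cliff_scaleAr.

Definition cliff_unit : pred (cliff R n) :=
  fun x => `[< exists y, y * x = 1 /\ x * y = 1 >].

Definition cliff_inv x : cliff R n :=
  xget x [set y | y * x = 1 /\ x * y = 1].

Lemma cliff_invP x : cliff_unit x -> cliff_inv x * x = 1 /\ x * cliff_inv x = 1.
Proof. by rewrite /cliff_inv => /asboolP[y yP]; case: xgetP => [z _ //|/(_ y)]. Qed.

Lemma cliff_mulVx : {in cliff_unit, left_inverse 1 cliff_inv *%R}.
Proof. by move=> x /cliff_invP[]. Qed.

Lemma cliff_mulxV : {in cliff_unit, right_inverse 1 cliff_inv *%R}.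
Proof. by move=> x /cliff_invP[]. Qed.

Lemma cliff_unitP x y : y * x = 1 /\ x * y = 1 -> cliff_unit x.
Proof. by move=> xy; apply/asboolP; exists y. Qed.

Lemma cliff_inv_out : {in [predC cliff_unit], cliff_inv =1 id}.
Proof.
move=> x; rewrite /cliff_inv inE => /asboolPn xNu.
by case: xgetP => // y _ xy; case: xNu; exists y.
Qed.

HB.instance Definition _ := GRing.NzRing_hasMulInverse.Build (cliff R n)
  cliff_mulVx cliff_mulxV cliff_unitP cliff_inv_out.

Definition cliff_gen (i : 'I_n) : cliff R n := [ffun A => (A == [set i]%SET)%:R].

(* Since e_A^c = e_(a_k)^c ... e_(a_1)^c = e_A^-1, the sign is csign A A. *)
Definition cliff_conj x : cliff R n := [ffun A => csign A A * x A].

Lemma cliff_mulE x y C : (x * y) C =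
  \sum_A csign A (symdiff A C) * x A * y (symdiff A C).
Proof. by rewrite [LHS]ffunE. Qed.

Lemma cliff_genM i j : cliff_gen i * cliff_gen j =
  csign [set i]%SET [set j]%SET *:
  [ffun A => (A == symdiff [set i]%SET [set j]%SET)%:R].
Proof.
apply/ffunP => C; rewrite cliff_mulE (bigD1 [set i]%SET) //= big1 => [|A Ai].
  rewrite !ffunE eqxx mulr1 addr0.
  have -> : (symdiff [set i]%SET C == [set j]%SET) =
            (C == symdiff [set i]%SET [set j]%SET).
    by apply/eqP/eqP => [<-|->]; rewrite symdiffK.
  by case: eqP => [->|_]; rewrite ?symdiffK // /GRing.scale /= !mulr0.
by rewrite ffunE (negbTE Ai) mulr0 mul0r.
Qed.

Lemma cliff_gen_anticomm i j : cliff_gen i * cliff_gen j +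
  cliff_gen j * cliff_gen i = (- 2 * (i == j)%:R)%:A.
Proof.
have csign1 k l : csign [set k]%SET [set l]%SET = (-1) ^+ (l <= k)%N.
  by rewrite /csign /ninv !big_set1.
rewrite !cliff_genM !csign1 (symdiffC [set j]%SET) -scalerDl.
case: ltngtP => [ji|ij|/val_inj ->]; last first.
- rewrite eqxx; apply/ffunP => C; rewrite !ffunE /GRing.scale /=.
  have -> : symdiff [set i]%SET [set i]%SET = finset.set0.
    by apply/setP => k; rewrite in_symdiff addbb inE.
  by rewrite expr1; ring.
- by rewrite -val_eqE ltn_eqF //= mulr0 !scale0r expr0 expr1 subrr scale0r.
- by rewrite -val_eqE gtn_eqF //= mulr0 !scale0r expr0 expr1 addNr scale0r.
Qed.

Lemma cliff_conj_is_linear : linear cliff_conj.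
Proof. by move=> a x y; apply/ffunP => A; rewrite !ffunE /GRing.scale /=; ring. Qed.

Lemma cliff_conjM x y : cliff_conj (x * y) = cliff_conj y * cliff_conj x.
Proof.
apply/ffunP => C; rewrite cliff_mulE ffunE cliff_mulE mulr_sumr.
rewrite (reindex (symdiff C)) /=; last exact/onW_bij/symdiff_bij.
apply: eq_bigr => A _; rewrite !ffunE.
have -> : symdiff (symdiff C A) C = A by rewrite symdiffC symdiffK.
rewrite (symdiffC A) !csignDl !csignDr.
ring: (csign2 C A) (csign2 C C) (csign2 A A) (csign2 A C).
Qed.

Lemma cliff_conjK : involutive cliff_conj.
Proof. by move=> x; apply/ffunP => A; rewrite !ffunE mulrA csign2 mul1r. Qed.

Lemma cliff_conj_gen i : cliff_conj (cliff_gen i) = - cliff_gen i.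
Proof.
apply/ffunP => A; rewrite !ffunE; case: eqP => [->|_]; last by rewrite mulr0 oppr0.
by rewrite /csign /ninv !big_set1 leqnn mulr1.
Qed.

End Clifford.

Section SliceRegular.
Variables (R : realType) (n : nat).
Implicit Types (D : set R[i]) (z : R[i]) (J x : cliff R n).
Implicit Types (F : R[i] -> cliff R n) (f : cliff R n -> cliff R n).

Definition cliff_sphere : set (cliff R n) :=
  [set J | J + cliff_conj J = 0 /\ J * cliff_conj J = 1].

Definition slice_point z J : cliff R n := (complex.Re z)%:A + complex.Im z *: J.

Definition conj_invariant D : Prop := forall z, D z -> D (conjc z).

Definition circularization D : set (cliff R n) :=
  [set x | exists2 z, D z & exists2 J, cliff_sphere J & x = slice_point z J].

(* A map F = F1 + i F2 into the tensor product of R_n and C is the pair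
   (F1, F2); on the coordinates along e_A it is the complex-valued function
   F1 A +i* F2 A. Maps on D are total functions whose values outside D are
   irrelevant: stem_holomorphic is only used when D is open. *)
Definition stem_function D F1 F2 : Prop :=
  forall z, D z -> F1 (conjc z) = F1 z /\ F2 (conjc z) = - F2 z.

Definition stem_holomorphic D F1 F2 : Prop :=
  forall z, D z -> forall A : {set 'I_n},
    derivable (fun w : R[i]^o => Complex (F1 w A) (F2 w A) : R[i]^o) z 1.

Definition slice_of D F1 F2 f : Prop :=
  forall z J, D z -> cliff_sphere J -> f (slice_point z J) = F1 z + J * F2 z.

Definition slice_regular D f : Prop :=
  exists F1 F2, [/\ stem_function D F1 F2, stem_holomorphic D F1 F2
                  & slice_of D F1 F2 f].

Definition cliff_Im x : cliff R n := 2^-1 *: (x - cliff_conj x).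

Definition cliff_real : set (cliff R n) := [set x | exists a : R, x = a%:A].

(* The coordinate x_0 has index ord0, and x_(i+1) goes with the generator i. *)
Definition paravec (x : 'rV[R]_n.+1) : cliff R n :=
  (x 0 ord0)%:A + \sum_(i < n) x 0 (lift ord0 i) *: cliff_gen R i.

Definition paravec_domain D : set 'rV[R]_n.+1 :=
  [set x | circularization D (paravec x)].

Definition spherical_quotient f x : cliff R n :=
  2^-1 *: ((cliff_Im x)^-1 * (f x - f (cliff_conj x))).

(* f'_s on R^(n+1): at the real points, its (coordinatewise) continuous
   extension, i.e., the limit along the non-real points *)
Definition spherical_derivative f (x : 'rV[R]_n.+1) : cliff R n :=
  if pselect (cliff_real (paravec x)) then
    [ffun A => lim (spherical_quotient f (paravec y) A
                    @[y --> within [set y | ~ cliff_real (paravec y)] (nbhs x)])]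
  else spherical_quotient f (paravec x).

End SliceRegular.

(** * Differential operators on R^(n+1) *)

Section Scalar.
Variables (R : realType) (m : nat).
Implicit Types (U : set 'rV[R]_m.+1) (u : 'rV[R]_m.+1 -> R).

Definition partial (i : 'I_m.+1) u : 'rV[R]_m.+1 -> R :=
  fun x => 'D_(delta_mx 0 i) u x.

Definition laplacian u : 'rV[R]_m.+1 -> R :=
  fun x => \sum_i partial i (partial i u) x.

(* u is of class C^k on the open set U *)
Fixpoint classC (k : nat) U u : Prop :=
  (forall x, U x -> {for x, continuous u}) /\
  (if k is k'.+1 then
     forall i, (forall x, U x -> derivable u x (delta_mx 0 i)) /\
               classC k' U (partial i u)
   else True).

Definition harmonic U u : Prop :=
  classC 2 U u /\ forall x, U x -> laplacian u x = 0.

End Scalar.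

Section CliffordValued.
Variables (R : realType) (n : nat).
Implicit Types (U : set 'rV[R]_n.+1) (g : 'rV[R]_n.+1 -> cliff R n).

Definition component g (A : {set 'I_n}) : 'rV[R]_n.+1 -> R := fun x => g x A.

Definition cliff_partial (i : 'I_n.+1) g : 'rV[R]_n.+1 -> cliff R n :=
  fun x => [ffun A => partial i (component g A) x].

Definition cliff_laplacian g : 'rV[R]_n.+1 -> cliff R n :=
  fun x => [ffun A => laplacian (component g A) x].

Definition dbar g : 'rV[R]_n.+1 -> cliff R n :=
  fun x => cliff_partial ord0 g x +
           \sum_(i < n) cliff_gen R i * cliff_partial (lift ord0 i) g x.

Definition cliff_classC (k : nat) U g : Prop :=
  forall A, classC k U (component g A).

Definition cliff_harmonic U g : Prop := forall A, harmonic U (component g A).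

Definition cliff_polyharmonic (k : nat) U g : Prop :=
  cliff_classC k.*2 U g /\
  forall x, U x -> iter k cliff_laplacian g x = 0.

End CliffordValued.

(* Main.v *)
Require Import Defs.
From HB Require Import structures.
From mathcomp Require Import all_boot all_order all_algebra.
From mathcomp Require Import complex.
From mathcomp Require Import ring lra.
From mathcomp Require Import all_classical all_reals all_analysis.

Set Implicit Arguments.
Unset Strict Implicit.
Unset Printing Implicit Defensive.

Import Order.TTheory GRing.Theory Num.Theory numFieldNormedType.Exports.

Local Open Scope classical_set_scope.
Local Open Scope ring_scope.

(** Write a paravector as x = x_0 + v with v = x_1 e_1 + ... + x_n e_n, and put
    r = |v|, z = x_0 + i r. If F_1, F_2 are the two parts of the stem function,
    then f(x) = k_0(x) + v h_0(x) with k_0 = F_1(z) and h_0 = F_2(z) / r, and h_0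
    is the spherical derivative of f. The operator (1/r) d/dr produces two
    sequences of functions of x,

      h_(m+1) = (1/r) dh_m/dr,      k_(m+1) = (1/r) dk_m/dr,

    for which the Cauchy-Riemann equations of F become

      d_0 h_m = - k_(m+1),          d_0 k_m = (2m+1) h_m + r^2 h_(m+1),
      d_j h_m = x_j h_(m+1),        d_j k_m = x_j k_(m+1)          (j > 0).

    This system ([axial_tower]) is closed under differentiation, so that
    continuity of all the h_m, k_m already gives smoothness ([tower_classC]),
    and a short computation yields ([laplacian_H], [laplacian_axial_map],
    [dbar_axial])

      Delta h_m           = (n - 3 - 2m) h_(m+1),
      Delta (k_m + v h_m) = (n - 1 - 2m) (k_(m+1) + v h_(m+1)),
      dbar (k_m + v h_m)  = (2m + 1 - n) h_m.

    For odd n the first factor vanishes at m = (n-3)/2, and the other two vanish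
    at m = (n-1)/2; iterating the formulas from m = 0 proves all the claims.

    The real work is the existence of the tower near each point of the domain
    ([local_axial_tower]), including the points of the real axis, where 1/r is
    singular; about F it is only known that it has a complex derivative at each
    point. Goursat's lemma ([Goursat]) gives Cauchy's formula for squares
    ([Cauchy_square]). Integrating over two squares, around a point z_0 and
    around its conjugate, represents F at both z and its conjugate, for z near
    z_0, as a bounded linear functional Lam of the Cauchy kernel
    ([Cauchy_functional]). Now

      1 / ((w - z) (w - conj z)) = 1 / q,      q = (w - x_0)^2 + r^2,

    is a rational function of x, in which r has disappeared, and the tower is

      h_m = c_m Lam (1 / q^(m+1)),   k_m = c_m Lam ((w - x_0) / q^(m+1)),

    with c_m = (-2)^m m!, up to a common factor. Differentiation under Lam, which
    only needs expansions of the kernels that are uniform in w ([kernel_diff]),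
    gives the equations of the tower ([axial_tower_Cauchy]). *)

(** * Integration over the unit interval by primitives *)

Section RealIntegral.
Variable R : realType.
Implicit Types f g F G : R -> R.

Definition continuous01 f := forall t, 0 <= t <= 1 -> {for t, continuous f}.

(** Derivatives are two-sided also at 0 and 1: primitives restrict to
    subintervals and compose with affine maps without one-sided conditions. *)
Definition primitive01 f F :=
  forall t, 0 <= t <= 1 -> is_derive (t : R) (1 : R) F (f t).

(** The increment of a primitive. Linearity, changes of variables and bounds
    become statements on derivatives, and measure theory only enters through the
    existence of primitives. The default value 0 is for functions without one. *)
Definition int01 f : R :=
  xget 0 [set y | exists2 F, primitive01 f F & y = F 1 - F 0].

Lemma primitive01_MVT f F a b : 0 <= a -> a <= b -> b <= 1 -> primitive01 f F ->
  exists2 c, 0 <= c <= 1 & F b - F a = f c * (b - a).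
Proof.
move=> a0 ab b1 fF.
have dF x : x \in `[a, b] -> is_derive (x : R) (1 : R) F (f x).
  rewrite in_itv/= => /andP[ax xb]; apply: fF; apply/andP; split; lra.
have dF' x : x \in `]a, b[ -> is_derive (x : R) (1 : R) F (f x).
  by move=> /subset_itv_oo_cc; exact: dF.
have cF : {within `[a, b], continuous F}.
  by apply: derivable_within_continuous => x /dF[].
have [c] := MVT_segment ab dF' cF.
rewrite in_itv/= => /andP[ac cb] E; exists c => //; apply/andP; split; lra.
Qed.

Lemma int01E f F : primitive01 f F -> int01 f = F 1 - F 0.
Proof.
move=> fF; rewrite /int01; case: xgetP => [y _ [G fG ->]|/(_ (F 1 - F 0))]; last first.
  by case; exists F.
have FG : primitive01 (fun _ => 0) (fun t => F t - G t).
  move=> t t01; have FF := fF t t01; have GG := fG t t01.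
  by rewrite -(subrr (f t)); apply: is_deriveB.
have [||//|c _] := primitive01_MVT (a := 0) (b := 1) _ _ _ FG; rewrite // mul0r.
by move=> E; lra.
Qed.

(** Composition with [clamp] extends a function on the unit interval to the
    line, so that the fundamental theorem of calculus also gives the derivatives
    at the end points. *)
Definition clamp (t : R) := Num.max 0 (Num.min t 1).

Lemma clamp01 t : 0 <= clamp t <= 1.
Proof.
by rewrite /clamp le_max ge_max ge_min !lexx ler01 orbT.
Qed.

Lemma clamp_id t : 0 <= t <= 1 -> clamp t = t.
Proof.
by move=> /andP[t0 t1]; rewrite /clamp (min_idPl t1) (max_idPr t0).
Qed.

Lemma clamp_continuous : continuous clamp.
Proof.
move=> t; have cmin : {for t, continuous (fun t : R => Num.min t 1)}.
  by apply: (@continuous_min _ _ id (fun=> 1)); [exact: cvg_id|exact: cvg_cst].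
exact: (@continuous_max _ _ (fun=> 0) (fun t : R => Num.min t 1) t (cvg_cst _) cmin).
Qed.

Lemma continuous01_primitive f : continuous01 f -> exists F, primitive01 f F.
Proof.
move=> cf; pose h := f \o clamp.
have ch : continuous h.
  by move=> t; apply: continuous_comp; [exact: clamp_continuous|exact/cf/clamp01].
pose F x := (\int[lebesgue_measure]_(t in `[-1%R, x]) h t).
exists F => t /andP[t0 t1].
have it : lebesgue_measure.-integrable `[(-1 : R), 2] (EFin \o h).
  apply: continuous_compact_integrable; first exact: segment_compact.
  exact: continuous_subspaceT.
have [||dF F't] := @continuous_FTC1_closed R h (-1) t 2 _ it _ (ch t); [lra|lra|].
apply: DeriveDef => //.
by rewrite -derive1E F't /h/= clamp_id// t0 t1.
Qed.

Lemma int01_linear k f g : continuous01 f -> continuous01 g ->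
  int01 (fun t => k * f t + g t) = k * int01 f + int01 g.
Proof.
move=> /continuous01_primitive[F fF] /continuous01_primitive[G gG].
rewrite (int01E fF) (int01E gG) (@int01E _ (fun t => k * F t + G t)); first by ring.
move=> t t01; have FF := fF t t01; have GG := gG t t01.
exact: is_deriveD.
Qed.

Lemma eq_int01 f g : (forall t, 0 <= t <= 1 -> f t = g t) -> int01 f = int01 g.
Proof.
move=> fg; rewrite /int01; congr xget; apply/seteqP; split=> y [F fF yE];
  exists F => // t t01; have := fF t t01; by rewrite fg.
Qed.

Lemma le_int01 f M : continuous01 f -> (forall t, 0 <= t <= 1 -> f t <= M) -> int01 f <= M.
Proof.
move=> /continuous01_primitive[F fF] fM; rewrite (int01E fF).
have [||//|c c01] := primitive01_MVT (a := 0) (b := 1) _ _ _ fF; rewrite // subr0 mulr1.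
by move=> ->; exact: fM.
Qed.

Lemma ge_int01 f M : continuous01 f -> (forall t, 0 <= t <= 1 -> M <= f t) -> M <= int01 f.
Proof.
move=> /continuous01_primitive[F fF] fM; rewrite (int01E fF).
have [||//|c c01] := primitive01_MVT (a := 0) (b := 1) _ _ _ fF; rewrite // subr0 mulr1.
by move=> ->; exact: fM.
Qed.

Lemma int01_halves f : continuous01 f ->
  int01 f = 2^-1 * int01 (fun t => f (2^-1 * t)) + 2^-1 * int01 (fun t => f (2^-1 + 2^-1 * t)).
Proof.
move=> /continuous01_primitive[F fF]; rewrite (int01E fF).
rewrite (@int01E (fun t => f (2^-1 * t)) (fun t => 2 * F (2^-1 * t))); last first.
  move=> t t01; have ? : is_derive (2^-1 * t) (1 : R) F (f (2^-1 * t)) by apply: fF; lra.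
  have H : is_derive (t : R) (1 : R) (F \o (fun t => 2^-1 * t)) (f (2^-1 * t) * (2^-1 *: 1)).
    by apply: is_derive1_comp.
  apply: is_derive_eq; rewrite /GRing.scale/=; by field.
rewrite (@int01E (fun t => f (2^-1 + 2^-1 * t)) (fun t => 2 * F (2^-1 + 2^-1 * t))); last first.
  move=> t t01; have ? : is_derive (2^-1 + 2^-1 * t) (1 : R) F (f (2^-1 + 2^-1 * t)).
    by apply: fF; lra.
  have H : is_derive (t : R) (1 : R) (F \o (fun t => 2^-1 + 2^-1 * t))
      (f (2^-1 + 2^-1 * t) * (0 + 2^-1 *: 1)).
    by apply: is_derive1_comp.
  apply: is_derive_eq; rewrite /GRing.scale/=; by field.
have -> : 2^-1 + 2^-1 * 1 = 1 :> R by field.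
by rewrite !mulr1 !mulr0 addr0; by field.
Qed.

Lemma int01_reverse f : continuous01 f -> int01 (fun t => f (1 - t)) = int01 f.
Proof.
move=> /continuous01_primitive[F fF]; rewrite (int01E fF).
rewrite (@int01E _ (fun t => - F (1 - t))); first by rewrite subrr subr0; ring.
move=> t t01; have ? : is_derive (1 - t) (1 : R) F (f (1 - t)) by apply: fF; lra.
have H : is_derive (t : R) (1 : R) (F \o (fun t => 1 - t)) (f (1 - t) * (0 - 1)).
  by apply: is_derive1_comp.
apply: is_derive_eq; ring.
Qed.

End RealIntegral.

(** * Continuity and complex differentiability in terms of the modulus *)

Section Modulus.
Import ComplexField.Normc.
Local Open Scope complex_scope.
Variable R : realType.
Implicit Types (z w : R[i]) (x : R).

Lemma normC_normc z : `|z| = (normc z)%:C. Proof. by []. Qed.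

Lemma normc_ge0 z : 0 <= normc z. Proof. by rewrite -lecR -normC_normc normr_ge0. Qed.

Lemma normc_real x : normc x%:C = `|x|.
Proof. by rewrite /= expr0n addr0 sqrtr_sqr. Qed.

Lemma normc_gt0 z : z != 0 -> 0 < normc z.
Proof. by move=> z0; rewrite -ltcR -normC_normc normr_gt0. Qed.

Lemma normc_distC z w : normc (z - w) = normc (w - z).
Proof. by rewrite -normcN opprB. Qed.

Lemma normc_Re z : `|complex.Re z| <= normc z.
Proof. by rewrite -lecR; exact: normc_ge_Re. Qed.

Lemma normc_Im z : `|complex.Im z| <= normc z.
Proof.
case: z => a b; rewrite /= -[`|b|]sqrtr_sqr ler_sqrt ?lerDr ?sqr_ge0//.
by rewrite addr_ge0 ?sqr_ge0.
Qed.

Lemma normc_ReIm z : normc z <= `|complex.Re z| + `|complex.Im z|.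
Proof.
have -> : z = (complex.Re z)%:C + 'i * (complex.Im z)%:C by exact: complexE.
apply: le_trans (le_normcD _ _) _; rewrite normcM !normc_real.
have -> : normc ('i : R[i]) = 1 by rewrite /= expr0n expr1n add0r sqrtr1.
by rewrite mul1r raddfD /= !(mul0r, mul1r, mulr0, subr0, addr0, add0r, oppr0).
Qed.

Lemma normcB_tri z w u : normc (z - w) <= normc (z - u) + normc (u - w).
Proof. by apply: le_trans (le_normcD _ _); rewrite addrA subrK. Qed.

Definition contC (g : R[i] -> R[i]) w :=
  {for w, continuous (g : R[i]^o -> R[i]^o)}.

Definition holo (g : R[i] -> R[i]) w :=
  derivable (g : R[i]^o -> R[i]^o) w (1 : R[i]^o).

Lemma contC_eps (g : R[i] -> R[i]) w : contC g w ->
  forall e, 0 < e -> exists2 d, 0 < d &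
    forall w', normc (w' - w) < d -> normc (g w' - g w) < e.
Proof.
rewrite /contC /prop_for /continuous_at => /cvgrPdist_lt gw e e0.
have /gw : 0 < e%:C by rewrite ltcR.
move=> /nbhs_normP[d /= d0 H].
have dE : d = (complex.Re d)%:C by rewrite RRe_real// gtr0_real.
exists (complex.Re d); first by rewrite -ltcR -dE.
move=> w' w'd; rewrite -ltcR -normC_normc distrC; apply: H.
by rewrite /= distrC normC_normc dE ltcR.
Qed.

(** First-order expansion with a real modulus; [D] is the derivative. *)
Lemma holo_eps (g : R[i]^o -> R[i]^o) w : holo g w ->
  exists D, forall e, 0 < e -> exists2 d, 0 < d &
    forall w', normc (w' - w) < d ->
      normc (g w' - g w - D * (w' - w)) <= e * normc (w' - w).
Proof.
move=> dg; exists ('D_1 g w) => e e0.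
have /cvgrPdist_lt H :
  (fun h : R[i]^o => h^-1 *: (g (h *: (1 : R[i]^o) + w) - g w)) @ (0 : R[i]^o)^' --> 'D_1 g w.
  exact: dg.
have /H : 0 < e%:C by rewrite ltcR.
move=> /nbhs_normP[d /= d0 {}H].
have dE : d = (complex.Re d)%:C by rewrite RRe_real// gtr0_real.
exists (complex.Re d); first by rewrite -ltcR -dE.
move=> w' w'd; have [->|w'w] := eqVneq w' w.
  by rewrite !subrr mulr0 subrr normc0 mulr0.
have hn0 : w' - w != 0 by rewrite subr_eq0.
have := H (w' - w); rewrite /= sub0r normrN normC_normc dE ltcR => /(_ w'd hn0).
have -> : (w' - w) *: (1 : R[i]^o) + w = w' by rewrite /GRing.scale/= mulr1 subrK.
rewrite /GRing.scale/= normC_normc ltcR => /ltW; set u := _ - _ => ue.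
have -> : g w' - g w - 'D_1 g w * (w' - w) = - u * (w' - w).
  by rewrite /u opprB mulrBl mulrAC mulVf ?mul1r//.
by rewrite normcM normcN ler_wpM2r ?normc_ge0.
Qed.

Lemma contC_cst (p w : R[i]) : contC (fun=> p) w.
Proof. exact: (@cst_continuous R[i]^o R[i]^o). Qed.

Lemma contC_id w : contC id w.
Proof. exact: cvg_id. Qed.

Lemma contCD g h w : contC g w -> contC h w -> contC (fun z => g z + h z) w.
Proof. exact: (@continuousD R[i] R[i]^o R[i]^o). Qed.

Lemma contCB g h w : contC g w -> contC h w -> contC (fun z => g z - h z) w.
Proof. exact: (@continuousB R[i] R[i]^o R[i]^o). Qed.

Lemma contCM g h w : contC g w -> contC h w -> contC (fun z => g z * h z) w.
Proof. exact: (@continuousM R[i] R[i]^o). Qed.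

Lemma contCV g w : g w != 0 -> contC g w -> contC (fun z => (g z)^-1) w.
Proof. exact: (@continuousV R[i] R[i]^o). Qed.

Lemma holo_contC g w : holo g w -> contC g w.
Proof. by move=> /derivable1_diffP; exact: differentiable_continuous. Qed.

Lemma holo_cst (p w : R[i]) : holo (fun=> p) w.
Proof. exact: derivable_cst. Qed.

Lemma holo_id w : holo id w.
Proof. exact: derivable_id. Qed.

Lemma holoB g h w : holo g w -> holo h w -> holo (fun z => g z - h z) w.
Proof. exact: (@derivableB R[i] R[i]^o R[i]^o). Qed.

Lemma holoM g h w : holo g w -> holo h w -> holo (fun z => g z * h z) w.
Proof. exact: (@derivableM R[i] R[i]^o). Qed.

Lemma holoV g w : g w != 0 -> holo g w -> holo (fun z => (g z)^-1) w.
Proof. exact: (@derivableV R[i] R[i]^o). Qed.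

End Modulus.

(** * Complex integrals along segments *)

Section SegmentIntegral.
Import ComplexField.Normc.
Local Open Scope complex_scope.
Variable R : realType.

Lemma real_complexM (x y : R) : (x * y)%:C = x%:C * y%:C. Proof. exact: rmorphM. Qed.
Lemma real_complexD (x y : R) : (x + y)%:C = x%:C + y%:C. Proof. exact: rmorphD. Qed.
Lemma real_complexB (x y : R) : (x - y)%:C = x%:C - y%:C. Proof. exact: rmorphB. Qed.

Implicit Types (z w a b c : R[i]) (t : R) (phi psi : R -> R[i]) (g h : R[i] -> R[i]).
Implicit Type K : set R[i].

Definition continuous01C phi := forall t, 0 <= t <= 1 -> forall e, 0 < e ->
  exists2 d, 0 < d & forall s, `|s - t| < d -> normc (phi s - phi t) < e.

Lemma continuous01_Re phi : continuous01C phi -> continuous01 (fun t => complex.Re (phi t)).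
Proof.
move=> cphi t t01; apply/cvgrPdist_lt => e e0.
have [d d0 H] := cphi t t01 e e0; near=> s.
rewrite -raddfB /=; apply: le_lt_trans (normc_Re _) _.
rewrite normc_distC; apply: H; rewrite distrC; near: s.
by apply: cvgr_dist_lt => //; exact: cvg_id.
Unshelve. all: by end_near. Qed.

Lemma continuous01_Im phi : continuous01C phi -> continuous01 (fun t => complex.Im (phi t)).
Proof.
move=> cphi t t01; apply/cvgrPdist_lt => e e0.
have [d d0 H] := cphi t t01 e e0; near=> s.
rewrite -raddfB /=; apply: le_lt_trans (normc_Im _) _.
rewrite normc_distC; apply: H; rewrite distrC; near: s.
by apply: cvgr_dist_lt => //; exact: cvg_id.
Unshelve. all: by end_near. Qed.

Definition int01C phi : R[i] :=
  Complex (int01 (fun t => complex.Re (phi t))) (int01 (fun t => complex.Im (phi t))).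

Lemma continuous01_linear k (f g : R -> R) : continuous01 f -> continuous01 g ->
  continuous01 (fun t => k * f t + g t).
Proof.
move=> cf cg t t01; apply: cvgD; last exact: cg.
by apply: cvgMl_tmp; exact: cf.
Qed.

Lemma ReM (z w : R[i]) : complex.Re (z * w) =
  complex.Re z * complex.Re w - complex.Im z * complex.Im w.
Proof. by case: z w => [? ?] []. Qed.

Lemma ImM (z w : R[i]) : complex.Im (z * w) =
  complex.Re z * complex.Im w + complex.Im z * complex.Re w.
Proof. by case: z w => [? ?] []. Qed.

Lemma ReZ x (z : R[i]) : complex.Re (x%:C * z) = x * complex.Re z.
Proof. by rewrite ReM /= mul0r subr0. Qed.

Lemma ReD (z w : R[i]) : complex.Re (z + w) = complex.Re z + complex.Re w.
Proof. by case: z w => [? ?] []. Qed.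

Lemma ImD (z w : R[i]) : complex.Im (z + w) = complex.Im z + complex.Im w.
Proof. by case: z w => [? ?] []. Qed.

Lemma int01C_linear c phi psi : continuous01C phi -> continuous01C psi ->
  int01C (fun t => c * phi t + psi t) = c * int01C phi + int01C psi.
Proof.
move=> cphi cpsi; have cR := continuous01_Re cphi; have cI := continuous01_Im cphi.
have dR := continuous01_Re cpsi; have dI := continuous01_Im cpsi.
rewrite /int01C; apply/eqP; rewrite eq_complex ReD ImD ReM ImM /=; apply/andP; split; apply/eqP.
  rewrite (@eq_int01 _ _ (fun t => complex.Re c * complex.Re (phi t) +
     (- complex.Im c * complex.Im (phi t) + complex.Re (psi t)))); last first.
    by move=> t _; rewrite ReD ReM; ring.
  by rewrite !int01_linear//; [ring|exact: continuous01_linear].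
rewrite (@eq_int01 _ _ (fun t => complex.Re c * complex.Im (phi t) +
   (complex.Im c * complex.Re (phi t) + complex.Im (psi t)))); last first.
  by move=> t _; rewrite ImD ImM; ring.
by rewrite !int01_linear//; [ring|exact: continuous01_linear].
Qed.

Lemma eq_int01C phi psi : (forall t, 0 <= t <= 1 -> phi t = psi t) -> int01C phi = int01C psi.
Proof. by move=> E; rewrite /int01C; congr Complex; apply: eq_int01 => t /E ->. Qed.

Lemma int01CZ c phi : continuous01C phi -> int01C (fun t => c * phi t) = c * int01C phi.
Proof.
move=> cphi; have c0 : continuous01C (fun=> 0).
  by move=> t _ e e0; exists 1 => // u _; rewrite subrr normc0.
rewrite (@eq_int01C _ (fun t => c * phi t + 0)); last by move=> t _; rewrite addr0.
rewrite (int01C_linear _ cphi c0) -[RHS]addr0; congr (_ + _).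
rewrite /int01C /= (@int01E _ (fun=> 0) (fun=> 0)) ?subrr// => t _.
exact: is_derive_cst.
Qed.

Lemma int01C_bound phi M : continuous01C phi ->
  (forall t, 0 <= t <= 1 -> normc (phi t) <= M) -> normc (int01C phi) <= 2 * M.
Proof.
move=> cphi phiM; apply: le_trans (normc_ReIm _) _ => /=.
have cR := continuous01_Re cphi; have cI := continuous01_Im cphi.
have -> : 2 * M = M + M by ring.
have reM t : 0 <= t <= 1 -> - M <= complex.Re (phi t) <= M.
  by move=> /phiM H; rewrite -ler_norml; apply: le_trans (normc_Re _) H.
have imM t : 0 <= t <= 1 -> - M <= complex.Im (phi t) <= M.
  by move=> /phiM H; rewrite -ler_norml; apply: le_trans (normc_Im _) H.
apply: lerD; rewrite ler_norml; apply/andP; split;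
 [apply: ge_int01 => //|apply: le_int01 => //|apply: ge_int01 => //|apply: le_int01 => //];
 by move=> t t01; have /andP[] := reM t t01; have /andP[] := imM t t01.
Qed.

Lemma int01C_halves phi : continuous01C phi ->
  int01C phi =
    2^-1 * int01C (fun t => phi (2^-1 * t)) + 2^-1 * int01C (fun t => phi (2^-1 + 2^-1 * t)).
Proof.
move=> cphi; have cR := continuous01_Re cphi; have cI := continuous01_Im cphi.
have -> : 2^-1 = (2^-1 : R)%:C :> R[i] by rewrite fmorphV rmorph_nat.
rewrite /int01C; apply/eqP; rewrite eq_complex ReD ImD !ReM !ImM /= !mul0r !subr0 !addr0.
by rewrite (int01_halves cR) (int01_halves cI) !eqxx.
Qed.

Lemma int01C_reverse phi : continuous01C phi -> int01C (fun t => phi (1 - t)) = int01C phi.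
Proof.
move=> cphi; have cR := continuous01_Re cphi; have cI := continuous01_Im cphi.
by rewrite /int01C (int01_reverse cR) (int01_reverse cI).
Qed.

Definition seg_point a b t : R[i] := a + t%:C * (b - a).

Definition seg_integral a b g : R[i] := (b - a) * int01C (fun t => g (seg_point a b t)).

Definition continuous_on K g := forall w, K w -> contC g w.

Definition convexC K := forall a b t, K a -> K b -> 0 <= t <= 1 -> K (seg_point a b t).

Lemma seg_point_continuous K a b g : convexC K -> K a -> K b -> continuous_on K g ->
  continuous01C (fun t => g (seg_point a b t)).
Proof.
move=> cK Ka Kb cg t t01 e e0.
have [d d0 H] := contC_eps (cg _ (cK a b t Ka Kb t01)) e0.
have nba : 0 < normc (b - a) + 1 by rewrite ltr_wpDl ?normc_ge0.
exists (d / (normc (b - a) + 1)); first exact: divr_gt0.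
move=> s st; apply: H.
have -> : seg_point a b s - seg_point a b t = (s - t)%:C * (b - a).
  by rewrite /seg_point real_complexB; ring.
rewrite normcM normc_real; apply: (@le_lt_trans _ _ (`|s - t| * (normc (b - a) + 1))).
  by rewrite ler_wpM2l// lerDl.
by rewrite -ltr_pdivlMr.
Qed.

Lemma seg_integral_linear K a b c g h : convexC K -> K a -> K b ->
  continuous_on K g -> continuous_on K h ->
  seg_integral a b (fun w => c * g w + h w) = c * seg_integral a b g + seg_integral a b h.
Proof.
move=> cK Ka Kb cg ch; have Cg := seg_point_continuous cK Ka Kb cg.
have Ch := seg_point_continuous cK Ka Kb ch.
by rewrite /seg_integral (int01C_linear _ Cg Ch); ring.
Qed.

Lemma seg_integral_rev K a b g : convexC K -> K a -> K b -> continuous_on K g ->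
  seg_integral b a g = - seg_integral a b g.
Proof.
move=> cK Ka Kb cg; have Cg := seg_point_continuous cK Ka Kb cg.
rewrite /seg_integral -(int01C_reverse Cg) -mulNr opprB; congr (_ * _); apply: eq_int01C => t _.
by congr g; rewrite /seg_point real_complexB; ring.
Qed.

Lemma seg_integral_mid K a b g : convexC K -> K a -> K b -> continuous_on K g ->
  seg_integral a b g = seg_integral a ((a + b) / 2) g + seg_integral ((a + b) / 2) b g.
Proof.
move=> cK Ka Kb cg; have Cg := seg_point_continuous cK Ka Kb cg.
have E2 : (2^-1 : R)%:C = 2^-1 :> R[i] by rewrite fmorphV rmorph_nat.
rewrite /seg_integral (int01C_halves Cg) mulrDr !mulrA; congr (_ + _).
  congr (_ * _); first by field.
  apply: eq_int01C => t _; congr g; rewrite /seg_point real_complexM E2; by field.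
congr (_ * _); first by field.
apply: eq_int01C => t _; congr g; rewrite /seg_point real_complexD real_complexM E2; by field.
Qed.

Lemma seg_integral_bound K a b g M : convexC K -> K a -> K b -> continuous_on K g ->
  (forall t, 0 <= t <= 1 -> normc (g (seg_point a b t)) <= M) ->
  normc (seg_integral a b g) <= 2 * M * normc (b - a).
Proof.
move=> cK Ka Kb cg gM; have Cg := seg_point_continuous cK Ka Kb cg.
by rewrite /seg_integral normcM mulrC ler_wpM2r ?normc_ge0//; exact: int01C_bound.
Qed.

Lemma eq_seg_integral a b g h :
  (forall t, 0 <= t <= 1 -> g (seg_point a b t) = h (seg_point a b t)) ->
  seg_integral a b g = seg_integral a b h.
Proof. by move=> E; rewrite /seg_integral; congr (_ * _); exact: eq_int01C. Qed.

(** An affine function has an explicit primitive, so that its integral along a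
    closed polygon vanishes; this is the part of Goursat's lemma that is not an
    estimate. *)
Lemma seg_integral_affine a b p q :
  seg_integral a b (fun w => p + q * w) = p * (b - a) + q * (b ^+ 2 - a ^+ 2) / 2.
Proof.
rewrite /seg_integral.
have -> : int01C (fun t => p + q * seg_point a b t) = p + q * a + q * (b - a) / 2.
  have E2 : (2^-1 : R)%:C = 2^-1 :> R[i] by rewrite fmorphV rmorph_nat.
  have P (k l : R) : int01 (fun t => k + t * l) = k + l / 2.
    rewrite (@int01E _ _ (fun t => t * k + (t * t) * (l / 2))); last first.
      move=> t _; apply: is_derive_eq; rewrite /GRing.scale/=; by field.
    by field.
  rewrite /int01C; apply/eqP; rewrite eq_complex; apply/andP; split; apply/eqP => /=.
    rewrite -[RHS]/(complex.Re (_ + _)) -E2.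
    rewrite (@eq_int01 _ _ (fun t => complex.Re (p + q * a) + t * complex.Re (q * (b - a)))).
      by rewrite P !ReD !ReM/=; ring.
    by move=> t _; rewrite /seg_point !(ReD, ReM, ImD, ImM)/=; ring.
  rewrite -E2.
  rewrite (@eq_int01 _ _ (fun t => complex.Im (p + q * a) + t * complex.Im (q * (b - a)))).
    by rewrite P !ImD !ImM/=; ring.
  by move=> t _; rewrite /seg_point !(ReD, ReM, ImD, ImM)/=; ring.
by field.
Qed.

End SegmentIntegral.

(** * Goursat's lemma for triangles *)

Section Goursat.
Import ComplexField.Normc.
Local Open Scope complex_scope.
Variable R : realType.
Implicit Types (z w a b c : R[i]) (t : R) (g h : R[i] -> R[i]).
Implicit Type K : set R[i].

(** The form in which the limit of the nested triangles is shown to lie in K. *)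
Definition closedC K := forall w,
  (forall e, 0 < e -> exists2 k, K k & normc (k - w) < e) -> K w.

Definition triangle_integral a b c g : R[i] :=
  seg_integral a b g + seg_integral b c g + seg_integral c a g.

Definition perimeter a b c : R := normc (b - a) + normc (c - b) + normc (a - c).

Lemma normc_half z : normc (z / 2) = normc z / 2.
Proof. by rewrite normcM normcV -[2 : R[i]](rmorph_nat (real_complex R)) normc_real ger0_norm. Qed.

Lemma convexC_mid K a b : convexC K -> K a -> K b -> K ((a + b) / 2).
Proof.
move=> cK Ka Kb; have -> : (a + b) / 2 = seg_point a b 2^-1.
  have E2 : (2^-1 : R)%:C = 2^-1 :> R[i] by rewrite fmorphV rmorph_nat.
  by rewrite /seg_point E2; field.
by apply: cK => //; apply/andP; split; lra.
Qed.

(** The integrals over the four half-size triangles add up to the whole, the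
    inner sides being run through twice in opposite directions; hence one of
    them carries at least a quarter of it. *)
Lemma triangle_bisection K g a b c : convexC K -> continuous_on K g ->
  K a -> K b -> K c -> exists a' b' c', [/\ K a', K b' & K c'] /\
  [/\ perimeter a' b' c' = perimeter a b c / 2, normc (a' - a) <= perimeter a b c
    & normc (triangle_integral a b c g) <= 4 * normc (triangle_integral a' b' c' g)].
Proof.
move=> cK cg Ka Kb Kc.
pose p := (a + b) / 2; pose q := (b + c) / 2; pose r := (c + a) / 2.
have [Kp Kq Kr] : [/\ K p, K q & K r] by split; exact: convexC_mid.
have triE : triangle_integral a b c g = triangle_integral a p r g +
    triangle_integral p b q g + triangle_integral r q c g + triangle_integral p q r g.
  have M := seg_integral_mid cK _ _ cg; have V := seg_integral_rev cK _ _ cg.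
  rewrite /triangle_integral (M a b)// (M b c)// (M c a)// -/p -/q -/r.
  by rewrite (V r p)// (V p q)// (V r q)//; ring.
have na : normc (b - a) >= 0 by exact: normc_ge0.
have nb : normc (c - b) >= 0 by exact: normc_ge0.
have nc : normc (a - c) >= 0 by exact: normc_ge0.
have H (x y u v : R[i]) : x - y = (u - v) / 2 -> normc (x - y) = normc (u - v) / 2.
  by move=> ->; exact: normc_half.
have := le_normcD (triangle_integral a p r g + triangle_integral p b q g +
  triangle_integral r q c g) (triangle_integral p q r g).
have := le_normcD (triangle_integral a p r g + triangle_integral p b q g)
  (triangle_integral r q c g).
have := le_normcD (triangle_integral a p r g) (triangle_integral p b q g); rewrite -triE.
have [l0|l0] := leP (normc (triangle_integral a b c g)) (4 * normc (triangle_integral a p r g)).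
  move=> _ _ _; exists a, p, r; split=> //; split=> //; rewrite /perimeter.
    rewrite (H p a b a) ?(H r p c b) ?(H a r a c) /p /q /r; first (by field); by field.
  by rewrite subrr normc0 !addr_ge0.
have [l1|l1] := leP (normc (triangle_integral a b c g)) (4 * normc (triangle_integral p b q g)).
  move=> _ _ _; exists p, b, q; split=> //; split=> //; rewrite /perimeter.
    rewrite (H b p b a) ?(H q b c b) ?(H p q a c) /p /q /r; first (by field); by field.
  rewrite (H p a b a); last by rewrite /p; field.
  by lra.
have [l2|l2] := leP (normc (triangle_integral a b c g)) (4 * normc (triangle_integral r q c g)).
  move=> _ _ _; exists r, q, c; split=> //; split=> //; rewrite /perimeter.
    rewrite (H q r b a) ?(H c q c b) ?(H r c a c) /p /q /r; first (by field); by field.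
  rewrite normc_distC (H a r a c); last by rewrite /r; field.
  by lra.
move=> h0 h1 h2; exists p, q, r; split=> //; split; rewrite ?/perimeter.
- rewrite (H q p c a) ?(H r q a b) ?(H p r b c) /p /q /r; try by field.
  by rewrite (normc_distC c a) (normc_distC a b) (normc_distC b c); field.
- rewrite (H p a b a); last by rewrite /p; field.
  by lra.
- by lra.
Qed.

(** The intervals with centre [x n] and radius 2 L / 2^n are nested. *)
Lemma geometric_cvgR (x : nat -> R) L :
  (forall n, `|x n.+1 - x n| <= L / 2 ^+ n) ->
  exists l, forall n, `|x n - l| <= 2 * (L / 2 ^+ n).
Proof.
move=> xL; pose p n := x n - 2 * (L / 2 ^+ n); pose q n := x n + 2 * (L / 2 ^+ n).
have half n : L / 2 ^+ n.+1 = (L / 2 ^+ n) / 2.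
  by rewrite exprS; field; rewrite expf_neq0.
have pS n : p n <= p n.+1.
  by have := xL n; rewrite ler_norml /p half => /andP[]; lra.
have qS n : q n.+1 <= q n.
  by have := xL n; rewrite ler_norml /q half => /andP[]; lra.
have pq n : p n <= q n.
  have := le_trans (normr_ge0 _) (xL n); rewrite /p /q; lra.
have ph := homo_leq (@lexx _ _) (@le_trans _ _) pS.
have /nonincreasing_seqP qh := qS.
have pm m n : p m <= q n.
  apply: le_trans (ph _ _ (leq_maxl m n)) _; apply: le_trans (pq _) _.
  by apply: qh; exact: leq_maxr.
exists (sup (range p)) => n; rewrite distrC ler_norml; apply/andP; split.
  suff : p n <= sup (range p) by rewrite /p; lra.
  by apply: ub_le_sup; [exists (q 0%N) => _ [m _ <-]|exists n].
suff : sup (range p) <= q n by rewrite /q; lra.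
by apply: ge_sup; [exists (p 0%N), 0%N|move=> _ [m _ <-]].
Qed.

Lemma geometric_cvgC (x : nat -> R[i]) L :
  (forall n, normc (x n.+1 - x n) <= L / 2 ^+ n) ->
  exists l, forall n, normc (x n - l) <= 4 * (L / 2 ^+ n).
Proof.
move=> xL.
have [|l1 H1] := @geometric_cvgR (fun n => complex.Re (x n)) L.
  by move=> n; rewrite -raddfB; apply: le_trans (normc_Re _) _.
have [|l2 H2] := @geometric_cvgR (fun n => complex.Im (x n)) L.
  by move=> n; rewrite -raddfB; apply: le_trans (normc_Im _) _.
exists (Complex l1 l2) => n; apply: le_trans (normc_ReIm _) _.
have := H1 n; have := H2 n; rewrite !raddfB /=; lra.
Qed.

Lemma seg_point_dist a b t w : 0 <= t <= 1 ->
  normc (seg_point a b t - w) <= normc (a - w) + normc (b - a).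
Proof.
move=> /andP[t0 t1]; have -> : seg_point a b t - w = (a - w) + t%:C * (b - a).
  by rewrite /seg_point; ring.
apply: le_trans (le_normcD _ _) _; rewrite lerD2l normcM normc_real ger0_norm//.
by rewrite ler_piMl ?normc_ge0.
Qed.

(** Bisecting n times leaves a triangle with perimeter L / 2^n carrying at least
    4^-n of the integral. Near the common limit point of these triangles, g is
    affine up to e times the distance, and the affine part integrates to 0, so
    that the integral over the small triangle is at most 10 e (L / 2^n)^2. The
    two powers of 2^n cancel against 4^n, and e is arbitrary. *)
Theorem Goursat K g a b c : convexC K -> closedC K ->
  (forall w, K w -> holo g w) ->
  K a -> K b -> K c -> triangle_integral a b c g = 0.
Proof.
move=> cK clK dg Ka Kb Kc.
have cg : continuous_on K g by move=> w /dg; exact: holo_contC.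
pose T := (R[i] * R[i] * R[i])%type.
pose inK (x : T) := [/\ K x.1.1, K x.1.2 & K x.2].
pose per (x : T) := perimeter x.1.1 x.1.2 x.2.
pose tr (x : T) := triangle_integral x.1.1 x.1.2 x.2 g.
have /choice[step stepP] : forall x : T, exists y : T, inK x -> inK y /\
    [/\ per y = per x / 2, normc (y.1.1 - x.1.1) <= per x
      & normc (tr x) <= 4 * normc (tr y)].
  move=> x; have [[xa xb xc]|xK] := pselect (inK x); last by exists x.
  have [a' [b' [c' [? ?]]]] := triangle_bisection cK cg xa xb xc.
  by exists (a', b', c') => _.
pose u n := iter n step (a, b, c).
have uK n : inK (u n) by elim: n => [//|n /stepP[]].
pose L := perimeter a b c.
have perE n : per (u n) = L / 2 ^+ n.
  elim: n => [|n IH]; first by rewrite expr0 divr1.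
  by have [_ [-> _ _]] := stepP _ (uK n); rewrite IH exprS; field; rewrite expf_neq0.
have trE n : normc (tr (u 0%N)) <= 4 ^+ n * normc (tr (u n)).
  elim: n => [|n IH]; first by rewrite expr0 mul1r.
  apply: le_trans IH _; rewrite exprSr -mulrA ler_wpM2l ?exprn_ge0//.
  by have [_ []] := stepP _ (uK n).
have L0 : 0 <= L by rewrite !addr_ge0 ?normc_ge0.
have [|w wP] := @geometric_cvgC (fun n => (u n).1.1) L.
  by move=> n; rewrite -perE; have [_ []] := stepP _ (uK n).
(* Points of the n-th triangle are within 5 L / 2^n of the limit: 4 for the
   first vertex, and 1 for the perimeter. *)
have small e : 0 < e -> exists n, 5 * (L / 2 ^+ n) < e.
  move=> e0; have [n nP] : exists n : nat, 5 * L / e < n%:R.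
    by exists (Num.bound (5 * L / e)); apply: archi_boundP; rewrite divr_ge0 ?mulr_ge0// ltW.
  exists n; rewrite mulrA ltr_pdivrMr ?exprn_gt0// [e * _]mulrC -ltr_pdivrMr//.
  apply: lt_le_trans nP _; rewrite -natrX ler_nat; exact/ltnW/ltn_expl.
have Kw : K w.
  apply: clK => e /small[n ne]; exists (u n).1.1; first by have [] := uK n.
  apply: le_lt_trans (wP n) _; apply: le_lt_trans ne.
  by rewrite ler_wpM2r ?divr_ge0 ?exprn_ge0// ler_nat.
have [D DP] := holo_eps (dg w Kw).
have main e : 0 < e -> normc (triangle_integral a b c g) <= 10 * e * L ^+ 2.
  move=> e0; have [d d0 dP] := DP e e0; have [n nd] := small d d0.
  apply: le_trans (trE n) _.
  have [] := uK n; have := wP n; have := perE n.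
  rewrite /per /tr /perimeter; case: (u n) => -[x y] z /= perxyz wx Kx Ky Kz.
  pose r w' := g w' - g w - D * (w' - w).
  pose s := L / 2 ^+ n; rewrite -/s in nd wx perxyz.
  have caff (p q : R[i]) : continuous_on K (fun w' => p + q * w').
    move=> v _; apply: contCD; first exact: contC_cst.
    by apply: contCM; [exact: contC_cst|exact: contC_id].
  have cr : continuous_on K r.
    move=> v Kv; apply: contCB; first by apply: contCB; [exact: cg|exact: contC_cst].
    apply: contCM; first exact: contC_cst.
    by apply: contCB; [exact: contC_id|exact: contC_cst].
  have gE w' : g w' = 1 * r w' + ((g w - D * w) + D * w') by rewrite /r; ring.
  have -> : triangle_integral x y z g = triangle_integral x y z r.
    have E p q : K p -> K q -> seg_integral p q g = seg_integral p q r +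
        ((g w - D * w) * (q - p) + D * (q ^+ 2 - p ^+ 2) / 2).
      move=> Kp Kq; rewrite -seg_integral_affine -[seg_integral p q r]mul1r.
      rewrite -(@seg_integral_linear _ K p q 1 r _ cK Kp Kq cr (caff _ _)).
      by apply: eq_seg_integral => t _; exact: gE.
    by rewrite /triangle_integral !E//; field.
  have [nx ny nz] : [/\ 0 <= normc (y - x), 0 <= normc (z - y) & 0 <= normc (x - z)].
    by split; exact: normc_ge0.
  have s0 : 0 <= s by rewrite divr_ge0 ?exprn_ge0.
  have side p q : K p -> K q -> normc (p - w) + normc (q - p) <= 5 * s ->
      normc (seg_integral p q r) <= 2 * (e * (5 * s)) * normc (q - p).
    move=> Kp Kq pq; apply: (seg_integral_bound cK) => // t t01.
    have ls := le_trans (seg_point_dist p q w t01) pq.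
    apply: le_trans (dP _ _) _; first exact: le_lt_trans ls nd.
    by rewrite ler_pM2l.
  have wy := normcB_tri y w x; have wz := normcB_tri z w y.
  have h1 := side _ _ Kx Ky; have h2 := side _ _ Ky Kz; have h3 := side _ _ Kz Kx.
  have : normc (triangle_integral x y z r) <= 10 * e * s ^+ 2.
    apply: le_trans (le_normcD _ _) _.
    apply: le_trans (lerD (le_normcD _ _) (lexx _)) _.
    have {}h1 := h1 _; have {}h2 := h2 _; have {}h3 := h3 _.
    have -> : 10 * e * s ^+ 2 = 2 * (e * (5 * s)) * normc (y - x) +
      2 * (e * (5 * s)) * normc (z - y) + 2 * (e * (5 * s)) * normc (x - z).
      by rewrite -!mulrDr perxyz; ring.
    apply: lerD; [apply: lerD|]; [apply: h1|apply: h2|apply: h3]; lra.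
  have -> : 10 * e * L ^+ 2 = 4 ^+ n * (10 * e * s ^+ 2).
    have -> : 4 = 2 ^+ 2 :> R by rewrite -natrX.
    by rewrite -exprM mulnC exprM /s; field; rewrite expf_neq0.
  by move=> ?; rewrite ler_wpM2l ?exprn_ge0.
apply: eq0_normc; apply/eqP; rewrite eq_le normc_ge0 andbT.
apply/ler_addgt0Pl => e e0; rewrite addr0.
have k0 : 0 < 10 * L ^+ 2 + 1 by rewrite ltr_wpDl ?mulr_ge0 ?exprn_ge0.
apply: le_trans (main (e / (10 * L ^+ 2 + 1)) _) _; first exact: divr_gt0.
have -> : 10 * (e / (10 * L ^+ 2 + 1)) * L ^+ 2 = e * (10 * L ^+ 2 / (10 * L ^+ 2 + 1)).
  by field; rewrite gt_eqF.
by rewrite ler_piMr ?ltW// ltr_pdivrMr// mul1r ltrDl.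
Qed.

End Goursat.

(** * Cauchy's formula for squares *)

Section Cauchy.
Import ComplexField.Normc.
Local Open Scope complex_scope.
Variable R : realType.
Implicit Types (p z w : R[i]) (r s t : R) (g h : R[i] -> R[i]).
Implicit Type K : set R[i].

(** Consecutive corners differ by a quarter turn around [p], so that [corner p r j]
    and [corner p r j.+1] are the ends of a side. *)
Definition corner p r (j : nat) : R[i] := p + r%:C * ('i ^+ j * (1 - 'i)).

Definition square_integral p r g : R[i] :=
  \sum_(j < 4) seg_integral (corner p r j) (corner p r j.+1) g.

Definition disc p r : set R[i] := [set w | normc (w - p) <= r].

(** Multiplication by (-i)^j turns the outer normal of the side [j] of a square
    into 1. The side [j] of a small square around [z] and the same side of a
    large one span a trapezoid inside this set, which is convex and avoids [z]. *)
Definition half_disc p r z s (j : nat) : set R[i] :=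
  [set w | normc (w - p) <= r /\ s <= complex.Re ((- 'i) ^+ j * (w - z))].

Lemma cornerS p r j : corner p r j.+1 = p + r%:C * ('i ^+ j * (1 + 'i)).
Proof.
rewrite /corner exprSr -mulrA; congr (_ + _ * (_ * _)).
by rewrite mulrBr mulr1 -expr2 sqr_i opprK addrC.
Qed.

Lemma corner4 p r : corner p r 4 = corner p r 0.
Proof. by rewrite /corner (exprM _ 2 2) sqr_i sqrrN expr1n expr0. Qed.

Lemma normc_i : normc ('i : R[i]) = 1.
Proof. by rewrite /= expr0n expr1n add0r sqrtr1. Qed.

Lemma normcX z n : normc (z ^+ n) = normc z ^+ n.
Proof.
elim: n => [|n IH]; first by rewrite !expr0 normc1.
by rewrite !exprS normcM IH.
Qed.

Lemma rot_unrot j z : (- 'i) ^+ j * ('i ^+ j * z) = z :> R[i].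
Proof. by rewrite mulrA -exprMn mulNr -expr2 sqr_i opprK expr1n mul1r. Qed.

Lemma corner_dist p r j : 0 <= r -> normc (corner p r j - p) <= 2 * r.
Proof.
move=> r0; rewrite /corner addrC addKr !normcM normc_real normcX normc_i expr1n mul1r.
rewrite ger0_norm// mulrC ler_wpM2r//.
have := le_normcD (1 : R[i]) (- 'i); rewrite normcN normc_i normc1; lra.
Qed.

Lemma disc_convex p r : convexC (disc p r).
Proof.
move=> a b t; rewrite /disc /= => ha hb /andP[t0 t1].
have -> : seg_point a b t - p = (1 - t)%:C * (a - p) + t%:C * (b - p).
  by rewrite /seg_point real_complexB; ring.
apply: le_trans (le_normcD _ _) _; rewrite !normcM !normc_real.
rewrite !ger0_norm ?subr_ge0//.
have -> : r = (1 - t) * r + t * r by ring.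
by apply: lerD; rewrite ler_wpM2l ?subr_ge0.
Qed.

Lemma disc_closed p r : closedC (disc p r).
Proof.
move=> w H; rewrite /disc /=; apply/ler_addgt0Pr => e e0.
have [k] := H e e0; rewrite /disc /= => kp kw.
have := normcB_tri w p k; rewrite (normc_distC w k); lra.
Qed.

Lemma half_disc_convex p r z s j : convexC (half_disc p r z s j).
Proof.
move=> a b t [ha sa] [hb sb] t01; split; first exact: (disc_convex ha hb).
move: t01 => /andP[t0 t1].
have -> : (- 'i) ^+ j * (seg_point a b t - z) =
    (1 - t)%:C * ((- 'i) ^+ j * (a - z)) + t%:C * ((- 'i) ^+ j * (b - z)).
  by rewrite /seg_point real_complexB; ring.
rewrite ReD !ReZ.
have -> : s = (1 - t) * s + t * s by ring.
by apply: lerD; rewrite ler_wpM2l ?subr_ge0.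
Qed.

Lemma half_disc_closed p r z s j : closedC (half_disc p r z s j).
Proof.
move=> w H; split.
  by apply: disc_closed => e /H[k [kp _] kw]; exists k.
apply/ler_addgt0Pr => e e0; have [k [_ ks] kw] := H e e0.
have -> : (- 'i) ^+ j * (w - z) = (- 'i) ^+ j * (k - z) - (- 'i) ^+ j * (k - w) by ring.
rewrite raddfB /=; have := normc_Re ((- 'i) ^+ j * (k - w)).
rewrite normcM normcX normcN normc_i expr1n mul1r ler_norml => /andP[]; lra.
Qed.

Lemma half_disc_neq p r z s j w : 0 < s -> half_disc p r z s j w -> w != z.
Proof.
move=> s0 [_]; apply: contraTneq => ->.
by rewrite subrr mulr0 /= -ltNge.
Qed.

Lemma half_disc_dist p r z s j w : half_disc p r z s j w -> s <= normc (w - z).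
Proof.
move=> [_ /le_trans]; apply; apply: le_trans (ler_norm _) _.
apply: le_trans (normc_Re _) _.
by rewrite normcM normcX normcN normc_i expr1n mul1r.
Qed.

Lemma corner_outer p r z s j : 0 < s -> normc (z - p) + s <= r ->
  half_disc p (2 * r) z s j (corner p r j) /\ half_disc p (2 * r) z s j (corner p r j.+1).
Proof.
move=> s0 zsr; have nz := normc_ge0 (z - p).
have r0 : 0 <= r by lra.
have E (k : R[i]) : complex.Re k = 1 ->
    s <= complex.Re ((- 'i) ^+ j * (p + r%:C * ('i ^+ j * k) - z)).
  move=> k1; have -> : (- 'i) ^+ j * (p + r%:C * ('i ^+ j * k) - z) =
      r%:C * k - (- 'i) ^+ j * (z - p).
    by rewrite -[in RHS](rot_unrot j k); ring.
  rewrite raddfB /= ReZ k1 mulr1.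
  have := normc_Re ((- 'i) ^+ j * (z - p)).
  rewrite normcM normcX normcN normc_i expr1n mul1r ler_norml => /andP[]; lra.
split; split; try exact: corner_dist.
  by apply: E; rewrite /= subr0.
by rewrite cornerS; apply: E; rewrite /= addr0.
Qed.

Lemma corner_inner p r z s j : 0 < s -> normc (z - p) + s <= r ->
  half_disc p (2 * r) z s j (corner z s j) /\ half_disc p (2 * r) z s j (corner z s j.+1).
Proof.
move=> s0 zsr; have nz := normc_ge0 (z - p).
have D k : normc (corner z s k - p) <= 2 * r.
  have := normcB_tri (corner z s k) p z; have := corner_dist z k (ltW s0); lra.
have E (k : R[i]) : complex.Re k = 1 ->
    s <= complex.Re ((- 'i) ^+ j * (z + s%:C * ('i ^+ j * k) - z)).
  move=> k1; have -> : (- 'i) ^+ j * (z + s%:C * ('i ^+ j * k) - z) = s%:C * k.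
    by rewrite -[in RHS](rot_unrot j k); ring.
  by rewrite ReZ k1 mulr1.
split; split; try exact: D.
  by apply: E; rewrite /= subr0.
by rewrite cornerS; apply: E; rewrite /= addr0.
Qed.

Lemma cyclic_sum4 (f : nat -> R[i]) : f 4 = f 0%N -> \sum_(j < 4) (f j.+1 - f j) = 0.
Proof.
move=> f4; rewrite -(big_mkord xpredT (fun j => f j.+1 - f j)).
by rewrite telescope_sumr// f4 subrr.
Qed.

(** The region between the two squares splits into four trapezoids, and each
    of them into two triangles lying in a [half_disc], where g is holomorphic.
    The four segments that join the corners cancel in the sum. *)
Lemma square_deform p r z s g : 0 < s -> normc (z - p) + s <= r ->
  (forall w, normc (w - p) <= 2 * r -> w != z -> holo g w) ->
  square_integral p r g = square_integral z s g.
Proof.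
move=> s0 zsr dg; pose X j := seg_integral (corner z s j) (corner p r j) g.
have -> : square_integral p r g = \sum_(j < 4) (seg_integral (corner z s j) (corner z s j.+1) g +
    (X j.+1 - X j)).
  apply: eq_bigr => j _; pose K := half_disc p (2 * r) z s j.
  have cK : convexC K by exact: half_disc_convex.
  have clK : closedC K by exact: half_disc_closed.
  have hK w : K w -> holo g w.
    by move=> Kw; apply: dg; [case: Kw|exact: half_disc_neq Kw].
  have kg : continuous_on K g by move=> w /hK; exact: holo_contC.
  have [Kb Kc] := corner_outer j s0 zsr; have [Kb' Kc'] := corner_inner j s0 zsr.
  have := Goursat cK clK hK Kb' Kb Kc; have := Goursat cK clK hK Kb' Kc Kc'.
  rewrite /triangle_integral /X (seg_integral_rev cK Kb' Kc kg)
    (seg_integral_rev cK Kc' Kc kg) (seg_integral_rev cK Kb' Kc' kg).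
  set A := seg_integral _ _ _; set B := seg_integral _ _ _.
  set C := seg_integral _ _ _; set E := seg_integral _ _ _.
  set G := seg_integral _ _ _ => H1 H2.
  have -> : G = (E + G - A) + (A - B - C) + (C + B - E) by ring.
  by rewrite H1 H2; ring.
by rewrite big_split /= cyclic_sum4 ?addr0// /X !corner4.
Qed.

(** The triangles with apex p over the four sides have integral 0, and their
    radial sides cancel. *)
Lemma square_holo p r g : 0 <= r -> (forall w, normc (w - p) <= 2 * r -> holo g w) ->
  square_integral p r g = 0.
Proof.
move=> r0 hg; pose X j := seg_integral p (corner p r j) g.
rewrite /square_integral (eq_bigr (fun j : 'I_4 => X j.+1 - X j)); last first.
  move=> j _; pose K := disc p (2 * r).
  have cK : convexC K by exact: disc_convex.
  have clK : closedC K by exact: disc_closed.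
  have kg : continuous_on K g by move=> w /hg; exact: holo_contC.
  have Kc k : K (corner p r k) by exact: corner_dist.
  have Kp : K p by rewrite /K /disc /= subrr normc0 mulr_ge0.
  have := Goursat cK clK hg Kp (Kc j) (Kc j.+1).
  rewrite /triangle_integral /X (seg_integral_rev cK Kp (Kc j.+1) kg).
  set A := seg_integral _ _ _; set B := seg_integral _ _ _; set C := seg_integral _ _ _ => H.
  have -> : B = (A + B - C) + (C - A) by ring.
  by rewrite H add0r.
by rewrite cyclic_sum4 // /X !corner4.
Qed.

(** The number 2 pi i, as the integral of 1 / w over the square with centre 0
    and half side 1; its four sides contribute equally. *)
Definition winding : R[i] :=
  4 * (2 * 'i * int01C (fun t => (seg_point (corner 0 1 0) (corner 0 1 1) t)^-1)).

Lemma contC_inv_sub z w : w != z -> contC (fun w => (w - z)^-1) w.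
Proof.
move=> wz; apply: contCV; first by rewrite subr_eq0.
by apply: contCB; [exact: contC_id|exact: contC_cst].
Qed.

Lemma holo_inv_sub z w : w != z -> holo (fun w => (w - z)^-1) w.
Proof.
move=> wz; apply: holoV; first by rewrite subr_eq0.
by apply: holoB; [exact: holo_id|exact: holo_cst].
Qed.

(** On the side that is studied, 1 / w = 1 / (1 + i u) with |u| <= 1 has real
    part at least 1/2. *)
Lemma winding_neq0 : winding != 0.
Proof.
have i0 : 'i != 0 :> R[i] by rewrite -normr_eq0 normC_normc normc_i oner_eq0.
rewrite /winding mulf_neq0 ?pnatr_eq0// mulf_neq0 ?mulf_neq0 ?pnatr_eq0//.
set phi := fun t => _; suff : 2^-1 <= complex.Re (int01C phi).
  by apply: contraTneq => ->; rewrite /= -ltNge invr_gt0.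
have zp : normc (0 - 0 : R[i]) + 1 <= 1 by rewrite subrr normc0 add0r.
have [Ka Kb] := corner_inner 0 ltr01 zp.
have cphi : continuous01C phi.
  apply: (seg_point_continuous (K := half_disc 0 (2 * 1) 0 1 0) (g := fun w => w^-1)) => //.
    exact: half_disc_convex.
  move=> w Kw; apply: contCV; first exact: half_disc_neq Kw.
  exact: contC_id.
apply: ge_int01; first exact: continuous01_Re.
move=> t /andP[t0 t1].
have E : seg_point (corner 0 1 0) (corner 0 1 1) t = Complex 1 (2 * t - 1).
  rewrite /seg_point /corner !add0r expr0 !mul1r expr1; apply/eqP; rewrite eq_complex /=.
  by apply/andP; split; apply/eqP; ring.
rewrite /phi E /= expr1n -[X in X <= _]mul1r ler_pdivlMr; last first.
  by rewrite ltr_pwDl// sqr_ge0.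
by rewrite mul1r ler_pdivrMl//; nra.
Qed.

(** The integrand is homogeneous of degree -1: neither the size of the square
    nor the choice of a side changes the integral. *)
Lemma square_inv z s : 0 < s -> square_integral z s (fun w => (w - z)^-1) = winding.
Proof.
move=> s0; rewrite /square_integral /winding.
rewrite (eq_bigr (fun=> 2 * 'i * int01C (fun t => (seg_point (corner 0 1 0) (corner 0 1 1) t)^-1))).
  by rewrite sumr_const card_ord [RHS]mulr_natl.
move=> j _; have sn0 : s%:C != 0 :> R[i] by rewrite fmorph_eq0 gt_eqF.
have in0 : 'i ^+ j != 0 :> R[i].
  by rewrite expf_neq0// -normr_eq0 normC_normc normc_i oner_eq0.
have seg0 t : seg_point (corner 0 1 0) (corner 0 1 1) t = 1 - 'i + t%:C * (2 * 'i).
  by rewrite /seg_point cornerS /corner expr0; ring.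
have segj t : seg_point (corner z s j) (corner z s j.+1) t - z =
    (s%:C * 'i ^+ j) * (1 - 'i + t%:C * (2 * 'i)).
  by rewrite /seg_point cornerS /corner; ring.
rewrite /seg_integral (@eq_int01C _ _ (fun t => (s%:C * 'i ^+ j)^-1 *
    (seg_point (corner 0 1 0) (corner 0 1 1) t)^-1)); last first.
  by move=> t _; rewrite segj seg0 invfM.
have zp : normc (0 - 0 : R[i]) + 1 <= 1 by rewrite subrr normc0 add0r.
have [Ka Kb] := corner_inner 0 ltr01 zp.
rewrite int01CZ; first by rewrite cornerS /corner; field; rewrite in0 sn0.
apply: (seg_point_continuous (K := half_disc 0 (2 * 1) 0 1 0) (g := fun w => w^-1)) => //.
  exact: half_disc_convex.
move=> w Kw; apply: contCV; first exact: half_disc_neq Kw.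
exact: contC_id.
Qed.

(** By [square_deform] the contour may be replaced by a square around z of
    arbitrarily small size s. There, replacing g w by g z changes the integral by
    at most 16 M s, since the difference quotient of g is bounded by M near z. *)
Theorem Cauchy_square p r z g : normc (z - p) < r ->
  (forall w, normc (w - p) <= 2 * r -> holo g w) ->
  square_integral p r (fun w => g w * (w - z)^-1) = winding * g z.
Proof.
move=> zr hg.
have hz : holo g z.
  by apply: hg; have := normc_ge0 (z - p); lra.
have [D DP] := holo_eps hz; have [d d0 dP] := DP 1 ltr01.
pose M := normc D + 1.
have M0 : 0 < M by rewrite ltr_wpDl ?normc_ge0.
have main s : 0 < s -> normc (z - p) + s <= r -> 2 * s < d ->
    normc (square_integral p r (fun w => g w * (w - z)^-1) - winding * g z) <= 16 * M * s.
  move=> s0 zsr sd; rewrite (square_deform s0 zsr); last first.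
    by move=> w wp wz; apply: holoM; [exact: hg|exact: holo_inv_sub].
  rewrite -(square_inv z s0) /square_integral mulr_suml -sumrB.
  apply: le_trans (_ : \sum_(j < 4) 4 * M * s <= _); last first.
    by rewrite sumr_const card_ord -[X in X <= _]mulr_natl; lra.
  rewrite (_ : normc _ = complex.Re `|\sum_(j < 4) (seg_integral (corner z s j) (corner z s j.+1)
    (fun w => g w * (w - z)^-1) -
    seg_integral (corner z s j) (corner z s j.+1) (fun w => (w - z)^-1) * g z)|)//.
  rewrite -lecR RRe_real ?normr_real// rmorph_sum /=.
  apply: le_trans (ler_norm_sum _ _ _) _; apply: ler_sum => j _.
  rewrite normC_normc lecR.
  pose K := half_disc z (2 * s) z s j.
  have cK : convexC K by exact: half_disc_convex.
  have zz : normc (z - z) + s <= s by rewrite subrr normc0 add0r.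
  have [Ka Kb] := corner_inner j s0 zz; rewrite -/K in Ka Kb.
  have Kz w : K w -> w != z by exact: half_disc_neq.
  have Kp w : K w -> normc (w - p) <= 2 * r.
    by move=> [wz _]; have := normcB_tri w p z; have := normc_ge0 (z - p); lra.
  have c1 : continuous_on K (fun w => (w - z)^-1) by move=> w /Kz; exact: contC_inv_sub.
  have cg : continuous_on K g by move=> w /Kp /hg; exact: holo_contC.
  have c2 : continuous_on K (fun w => (g w - g z) * (w - z)^-1).
    move=> w Kw; apply: contCM; last exact: c1.
    by apply: contCB; [exact: cg|exact: contC_cst].
  rewrite (@eq_seg_integral _ _ _ _ (fun w => g z * (w - z)^-1 +
    (g w - g z) * (w - z)^-1)); last first.
    by move=> t _; ring.
  rewrite (seg_integral_linear _ cK Ka Kb c1 c2) [g z * _]mulrC addrC addKr.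
  have -> : 4 * M * s = 2 * M * (2 * s) by ring.
  apply: le_trans (seg_integral_bound (M := M) cK Ka Kb c2 _) _.
    move=> t t01; have Kt := cK _ _ _ Ka Kb t01; move: (seg_point _ _ _) Kt => w Kw.
    have nw : 0 < normc (w - z) by apply: normc_gt0; rewrite subr_eq0 Kz.
    rewrite normcM normcV ler_pdivrMr//.
    have wd : normc (w - z) < d by case: Kw => wz _; exact: le_lt_trans wz sd.
    have := dP w wd; have := le_normcD (g w - g z - D * (w - z)) (D * (w - z)).
    by rewrite subrK normcM /M; lra.
  rewrite ler_wpM2l ?mulr_ge0 ?(ltW M0)//.
  have -> : corner z s j.+1 - corner z s j = (2 * s)%:C * ('i ^+ j * 'i).
    by rewrite cornerS /corner real_complexM; ring.
  rewrite !normcM normc_real normcX normc_i expr1n !mulr1 ger0_norm//.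
  by rewrite mulr_ge0 ?ltW.
apply/eqP; rewrite -subr_eq0; apply/eqP; apply: eq0_normc; apply/eqP.
rewrite eq_le normc_ge0 andbT; apply/ler_addgt0Pl => e e0; rewrite addr0.
(* A square inside the contour, inside the disc where the difference quotient
   is bounded, and small enough for the error e. *)
pose s := Num.min (r - normc (z - p)) (Num.min (d / 3) (e / (16 * M))).
have s0 : 0 < s by rewrite !lt_min subr_gt0 zr !divr_gt0// mulr_gt0.
have s1 : s <= r - normc (z - p) by rewrite ge_min lexx.
have s2 : s <= d / 3 by rewrite !ge_min lexx orbT.
have s3 : s <= e / (16 * M) by rewrite !ge_min lexx !orbT.
apply: le_trans (main s s0 _ _) _; [lra|lra|].
by rewrite -ler_pdivlMl ?mulr_gt0// mulrC.
Qed.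

End Cauchy.

(** * Cauchy kernels and bounded functionals *)

Section Functional.
Import ComplexField.Normc.
Local Open Scope complex_scope.
Variable R : realType.
Implicit Types (p z w : R[i]) (r s t : R) (phi psi G : R[i] -> R[i]).
Implicit Types (K W D : set R[i]) (Lam : (R[i] -> R[i]) -> R[i]).

(** A linear functional on the functions that are continuous on W, bounded for
    the supremum over W. *)
Definition bounded_functional W Lam :=
  (forall c phi psi, continuous_on W phi -> continuous_on W psi ->
     Lam (fun w => c * phi w + psi w) = c * Lam phi + Lam psi) /\
  exists2 M, 0 <= M & forall phi e, continuous_on W phi ->
     (forall w, W w -> normc (phi w) <= e) -> normc (Lam phi) <= M * e.

Lemma bounded_functionalD W Lam1 Lam2 :
  bounded_functional W Lam1 -> bounded_functional W Lam2 ->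
  bounded_functional W (fun phi => Lam1 phi + Lam2 phi).
Proof.
move=> [l1 [M1 M10 b1]] [l2 [M2 M20 b2]]; split.
  by move=> c phi psi cphi cpsi; rewrite l1// l2//; ring.
exists (M1 + M2) => [|phi e cphi phie]; first exact: addr_ge0.
by apply: le_trans (le_normcD _ _) _; rewrite mulrDl lerD ?b1 ?b2.
Qed.

Lemma continuous01C_bounded (f : R -> R[i]) : continuous01C f ->
  exists2 M, 0 <= M & forall t, 0 <= t <= 1 -> normc (f t) <= M.
Proof.
move=> cf; have B (g : R -> R) : continuous01 g ->
    exists M, forall t, 0 <= t <= 1 -> `|g t| <= M.
  move=> cg; have [|c _ cP] := @EVT_max R (fun t => `|g t|) 0 1 ler01.
    apply: continuous_in_subspaceT => t; rewrite inE /= in_itv /= => t01.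
    by apply: cvg_norm; exact: cg.
  by exists `|g c| => t t01; apply: cP; rewrite in_itv.
have [M1 P1] := B _ (continuous01_Re cf); have [M2 P2] := B _ (continuous01_Im cf).
exists (M1 + M2) => [|t t01].
  have t01 : 0 <= (0 : R) <= 1 by rewrite lexx ler01.
  by apply: addr_ge0; [exact: le_trans (P1 _ t01)|exact: le_trans (P2 _ t01)].
by apply: le_trans (normc_ReIm _) _; apply: lerD; [exact: P1|exact: P2].
Qed.

(** The contour lies in the annulus, and G is bounded on it by compactness. *)
Lemma square_functional W G p r : 0 < r ->
  (forall w, r <= normc (w - p) <= 2 * r -> W w) ->
  (forall w, r <= normc (w - p) <= 2 * r -> contC G w) ->
  bounded_functional W (fun phi => square_integral p r (fun w => G w * phi w)).
Proof.
move=> r0 hW hG.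
have pp : normc (p - p) + r <= r by rewrite subrr normc0 add0r.
pose K j := half_disc p (2 * r) p r j.
have Ka j : K j (corner p r j) by have [] := corner_inner j r0 pp.
have Kb j : K j (corner p r j.+1) by have [] := corner_inner j r0 pp.
have KA j w : K j w -> r <= normc (w - p) <= 2 * r.
  by move=> Kw; rewrite (half_disc_dist Kw) /=; case: Kw.
have cK j : convexC (K j) by exact: half_disc_convex.
have cG j : continuous_on (K j) G by move=> w /KA; exact: hG.
have cW j phi : continuous_on W phi -> continuous_on (K j) phi.
  by move=> cphi w /KA/hW; exact: cphi.
have cGW j phi : continuous_on W phi -> continuous_on (K j) (fun w => G w * phi w).
  by move=> /(cW j) cphi w Kw; apply: contCM; [exact: cG Kw|exact: cphi].
split.
  move=> c phi psi cphi cpsi; rewrite /square_integral mulr_sumr -big_split /=.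
  apply: eq_bigr => j _.
  rewrite -(seg_integral_linear _ (cK j) (Ka j) (Kb j) (cGW j _ cphi) (cGW j _ cpsi)).
  by apply: eq_seg_integral => t _; ring.
have /choice[M MP] : forall j : 'I_4, exists M, 0 <= M /\
    forall t, 0 <= t <= 1 -> normc (G (seg_point (corner p r j) (corner p r j.+1) t)) <= M.
  move=> j; have [M M0 MP] := continuous01C_bounded
    (seg_point_continuous (cK j) (Ka j) (Kb j) (cG j)).
  by exists M.
exists (\sum_(j < 4) 2 * M j * normc (corner p r j.+1 - corner p r j)).
  by apply: sumr_ge0 => j _; rewrite !mulr_ge0 ?normc_ge0//; case: (MP j).
move=> phi e cphi phie.
have tri4 (F : 'I_4 -> R[i]) : normc (\sum_j F j) <= \sum_j normc (F j).
  by apply: (big_ind2 (fun a b => normc a <= b)) => [|a b c d ab cd|//];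
    rewrite ?normc0// (le_trans (le_normcD _ _))// lerD.
apply: le_trans (tri4 _) _; rewrite mulr_suml; apply: ler_sum => j _.
rewrite mulrAC -(mulrA 2).
apply: (seg_integral_bound (cK j)) => //; first exact: cGW.
move=> t t01; rewrite normcM; have [Mj0 Mj] := MP j.
have Kt := cK j _ _ t (Ka j) (Kb j) t01.
by apply: ler_pM; rewrite ?normc_ge0 ?Mj//; apply: phie; apply: hW; exact: KA Kt.
Qed.

Lemma normc_conj z : normc (conjc z) = normc z.
Proof. by case: z => a b /=; rewrite sqrrN. Qed.

Lemma normc_subJ z : normc (z - conjc z) = 2 * `|complex.Im z|.
Proof.
rewrite subcJ !normcM normc_i mulr1 normc_real.
by rewrite -[2 : R[i]](rmorph_nat (real_complex R)) normc_real ger0_norm.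
Qed.

(** The functional integrates G phi over the squares of half side r around z0 and
    its conjugate. If z0 is real, these squares coincide and both z and its
    conjugate lie inside; otherwise the squares are taken far from each other,
    so that each point lies inside one of them and far outside the other. In both
    cases the representation formula comes with the same factor for z and for
    its conjugate. *)
Theorem Cauchy_functional D z0 rho : 0 < rho -> conj_invariant D ->
  (forall w, normc (w - z0) < rho -> D w) ->
  exists r B c, [/\ 0 < r, c != 0 &
    forall G, (forall w, D w -> holo G w) ->
    exists2 Lam,
      bounded_functional [set w | [/\ r <= normc (w - z0), r <= normc (w - conjc z0)
                                    & normc w <= B]] Lam
    & forall z, normc (z - z0) < r / 2 ->
        Lam (fun w => (w - z)^-1) = c * G z /\
        Lam (fun w => (w - conjc z)^-1) = c * G (conjc z)].
Proof.
move=> rho0 DJ Drho.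
have DrhoJ w : normc (w - conjc z0) < rho -> D w.
  move=> H; rewrite -[w]conjcK; apply: DJ; apply: Drho.
  by rewrite -normc_conj rmorphB /= conjcK.
have nJ z : normc (conjc z - conjc z0) = normc (z - z0).
  by rewrite -rmorphB normc_conj.
pose B := normc z0 + rho.
have hB p r w : normc p = normc z0 -> 2 * r < rho -> normc (w - p) <= 2 * r -> normc w <= B.
  by move=> pz rr wp; have := le_normcD (w - p) p; rewrite subrK pz /B; lra.
(* rho / 3, because the contour and its interior lie within 2 r of the centre *)
have [zR|zR] := eqVneq (complex.Im z0) 0.
  have z0J : conjc z0 = z0 by case: z0 zR {DrhoJ nJ B hB Drho} => a b /= ->; rewrite oppr0.
  exists (rho / 3), B, (winding R); split=> [||G hG]; [lra|exact: winding_neq0|].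
  rewrite z0J; have hG2 w : normc (w - z0) <= 2 * (rho / 3) -> holo G w.
    by move=> wz; apply: hG; apply: Drho; lra.
  exists (fun phi => square_integral z0 (rho / 3) (fun w => G w * phi w)).
    apply: square_functional; first by lra.
      move=> w /andP[w1 w2]; split=> //.
      by apply: (hB z0 (rho / 3)) => //; lra.
    by move=> w /andP[_ /hG2]; exact: holo_contC.
  move=> z zz; split; apply: Cauchy_square => //; first by lra.
  by rewrite -z0J nJ; lra.
(* The second bound puts the centres at distance at least 4 r: then each disc
   of radius r / 2 stays away from the opposite contour. *)
pose r := Num.min (rho / 3) (`|complex.Im z0| / 2).
have r0 : 0 < r by rewrite lt_min !divr_gt0// normr_gt0.
have r1 : r <= rho / 3 by rewrite ge_min lexx.
have r2 : 4 * r <= normc (z0 - conjc z0).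
  have : r <= `|complex.Im z0| / 2 by rewrite ge_min lexx orbT.
  by rewrite normc_subJ; lra.
exists r, B, (winding R); split=> [//||G hG]; first exact: winding_neq0.
have hG2 w : normc (w - z0) <= 2 * r -> holo G w.
  by move=> wz; apply: hG; apply: Drho; lra.
have hG2J w : normc (w - conjc z0) <= 2 * r -> holo G w.
  by move=> wz; apply: hG; apply: DrhoJ; lra.
exists (fun phi => square_integral z0 r (fun w => G w * phi w) +
                   square_integral (conjc z0) r (fun w => G w * phi w)).
  apply: bounded_functionalD; apply: square_functional => //.
  - move=> w /andP[w1 w2]; split=> //; last by apply: (hB z0 r) => //; lra.
    have := normcB_tri z0 (conjc z0) w; rewrite (normc_distC z0 w); lra.
  - by move=> w /andP[_ /hG2]; exact: holo_contC.
  - move=> w /andP[w1 w2]; split=> //; last first.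
      by apply: (hB (conjc z0) r) => //; [exact: normc_conj|lra].
    have := normcB_tri z0 (conjc z0) w; rewrite (normc_distC z0 w); lra.
  - by move=> w /andP[_ /hG2J]; exact: holo_contC.
move=> z zz; split.
- have -> : square_integral (conjc z0) r (fun w => G w * (w - z)^-1) = 0.
    apply: square_holo; first exact: ltW.
    move=> w wz; apply: holoM; first exact: hG2J.
    apply: holo_inv_sub; apply: contraTneq zz => <-.
    by have := normcB_tri z0 (conjc z0) w; rewrite (normc_distC z0 w) -leNgt; lra.
  rewrite addr0; apply: Cauchy_square => //; lra.
- have -> : square_integral z0 r (fun w => G w * (w - conjc z)^-1) = 0.
    apply: square_holo; first exact: ltW.
    move=> w wz; apply: holoM; first exact: hG2.
    apply: holo_inv_sub; apply: contraTneq zz => wE; rewrite -nJ -wE.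
    by have := normcB_tri z0 (conjc z0) w; rewrite (normc_distC z0 w) -leNgt; lra.
  rewrite add0r; apply: Cauchy_square => //; rewrite nJ; lra.
Qed.

End Functional.

(** * Differentiation of a bounded functional of a kernel *)

Section Kernels.
Import ComplexField.Normc.
Local Open Scope complex_scope.
Variables (R : realType) (n : nat).
Notation V := 'rV[R]_n.+1.
Implicit Types (x v : V) (w : R[i]) (k l : V -> R[i] -> R[i]).
Implicit Types (W : set R[i]) (Lam : (R[i] -> R[i]) -> R[i]).

Lemma coord_le_norm (v : V) j : `|v 0 j| <= `|v|.
Proof.
rewrite [leRHS]/Num.Def.normr /= mx_normrE.
exact: (le_bigmax _ (fun ij => `|v ij.1 ij.2|) (0, j)).
Qed.

(** For fixed w, [k' v w] is the differential at x, in the direction v, of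
    y |-> k y w. The quadratic remainder is uniform in w, which allows the
    passage through a bounded functional. *)
Definition kernel_diff W x k k' := exists C d, [/\ 0 <= C, 0 < d & forall v, `|v| < d ->
  [/\ continuous_on W (k (x + v)), continuous_on W (k' v) &
      forall w, W w -> [/\ normc (k (x + v) w) <= C, normc (k' v w) <= C * `|v| &
        normc (k (x + v) w - k x w - k' v w) <= C * `|v| ^+ 2]]].

Lemma eq_kernel_diff W x k k' l' : (forall v w, k' v w = l' v w) ->
  kernel_diff W x k k' -> kernel_diff W x k l'.
Proof. by move=> E; have -> : k' = l' by apply/funext => v; apply/funext => w. Qed.

(** With displacements of norm at most 1, the higher order terms of products and
    inverses are dominated by the quadratic ones. *)
Lemma kernel_diff1 W x k k' : kernel_diff W x k k' ->
  exists C d, [/\ 0 <= C, 0 < d, d <= 1 & forall v, `|v| < d ->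
  [/\ continuous_on W (k (x + v)), continuous_on W (k' v) &
      forall w, W w -> [/\ normc (k x w) <= C, normc (k (x + v) w) <= C,
        normc (k' v w) <= C * `|v| &
        normc (k (x + v) w - k x w - k' v w) <= C * `|v| ^+ 2]]].
Proof.
move=> [C [d [C0 d0 H]]]; exists C, (Num.min d 1); split => //.
- by rewrite lt_min d0 ltr01.
- by rewrite ge_min lexx orbT.
move=> v; rewrite lt_min => /andP[vd _]; have [c1 c2 kv] := H v vd.
split=> // w Ww; have [h1 h2 h3] := kv w Ww; split=> //.
have [_ _ /(_ w Ww)] := H 0 ltac:(by rewrite normr0).
by rewrite addr0 => -[].
Qed.

Lemma kernel_diffD W x k k' l l' : kernel_diff W x k k' -> kernel_diff W x l l' ->
  kernel_diff W x (fun y w => k y w + l y w) (fun v w => k' v w + l' v w).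
Proof.
move=> [C1 [d1 [C10 d10 H1]]] [C2 [d2 [C20 d20 H2]]].
exists (C1 + C2), (Num.min d1 d2); split; first exact: addr_ge0.
  by rewrite lt_min d10.
move=> v; rewrite lt_min => /andP[/H1[c1 c1' h1] /H2[c2 c2' h2]]; split.
- by move=> w Ww; apply: contCD; [exact: c1|exact: c2].
- by move=> w Ww; apply: contCD; [exact: c1'|exact: c2'].
move=> w Ww; have [a1 b1 e1] := h1 w Ww; have [a2 b2 e2] := h2 w Ww; split.
- by apply: le_trans (le_normcD _ _) _; exact: lerD.
- by apply: le_trans (le_normcD _ _) _; rewrite mulrDl; exact: lerD.
have -> : k (x + v) w + l (x + v) w - (k x w + l x w) - (k' v w + l' v w) =
  (k (x + v) w - k x w - k' v w) + (l (x + v) w - l x w - l' v w) by ring.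
by apply: le_trans (le_normcD _ _) _; rewrite mulrDl; exact: lerD.
Qed.

Lemma kernel_diffM W x k k' l l' : kernel_diff W x k k' -> kernel_diff W x l l' ->
  kernel_diff W x (fun y w => k y w * l y w) (fun v w => k' v w * l x w + k x w * l' v w).
Proof.
move=> /kernel_diff1[C1 [d1 [C10 d10 d11 H1]]] /kernel_diff1[C2 [d2 [C20 d20 d21 H2]]].
have cx : continuous_on W (k x) /\ continuous_on W (l x).
  have [|ck _ _] := H1 0; first by rewrite normr0.
  have [|cl _ _] := H2 0; first by rewrite normr0.
  by rewrite !addr0 in ck cl.
exists (4 * (C1 * C2)), (Num.min d1 d2); split.
- by rewrite !mulr_ge0.
- by rewrite lt_min d10.
move=> v; rewrite lt_min => /andP[vd1 vd2].
have [c1 c1' h1] := H1 v vd1; have [c2 c2' h2] := H2 v vd2.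
have [ck cl] := cx; split.
- by move=> w Ww; apply: contCM; [exact: c1|exact: c2].
- move=> w Ww; apply: contCD; apply: contCM;
  [exact: c1'|exact: cl|exact: ck|exact: c2'].
have v1 : `|v| <= 1 by rewrite (le_trans (ltW vd1)).
have v0 : 0 <= `|v| by [].
have CC : 0 <= C1 * C2 by exact: mulr_ge0.
move=> w Ww; have [a0 a1 b1 e1] := h1 w Ww; have [a0' a2 b2 e2] := h2 w Ww; split.
- rewrite normcM; apply: (@le_trans _ _ (C1 * C2)); last by lra.
  by apply: ler_pM; rewrite ?normc_ge0.
- apply: le_trans (le_normcD _ _) _; rewrite !normcM.
  have p1 : normc (k' v w) * normc (l x w) <= (C1 * `|v|) * C2.
    by apply: ler_pM; rewrite ?normc_ge0.
  have p2 : normc (k x w) * normc (l' v w) <= C1 * (C2 * `|v|).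
    by apply: ler_pM; rewrite ?normc_ge0.
  have : 0 <= (C1 * C2) * `|v| by exact: mulr_ge0.
  by move: p1 p2; rewrite (mulrAC C1) (mulrA C1); lra.
set u := `|v|; set e := k (x + v) w - k x w - k' v w; set f := l (x + v) w - l x w - l' v w.
have -> : k (x + v) w * l (x + v) w - k x w * l x w - (k' v w * l x w + k x w * l' v w) =
  e * l (x + v) w + k x w * f + k' v w * (f + l' v w) by rewrite /e /f; ring.
have -> : 4 * (C1 * C2) * u ^+ 2 = (C1 * u ^+ 2) * C2 + C1 * (C2 * u ^+ 2) +
   (C1 * u) * (2 * (C2 * u)) by ring.
apply: le_trans (le_normcD _ _) _; apply: lerD.
  apply: le_trans (le_normcD _ _) _; rewrite !normcM.
  by apply: lerD; apply: ler_pM; rewrite ?normc_ge0.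
rewrite normcM; apply: ler_pM; rewrite ?normc_ge0//.
apply: le_trans (le_normcD _ _) _.
have : C2 * u ^+ 2 <= C2 * u by rewrite ler_wpM2l// expr2 ler_piMl.
rewrite -/f -/u in e2; rewrite -/u in b2; lra.
Qed.

Lemma kernel_diffV W x k k' eta : 0 < eta ->
  (exists2 d, 0 < d & forall v, `|v| < d -> forall w, W w -> eta <= normc (k (x + v) w)) ->
  kernel_diff W x k k' ->
  kernel_diff W x (fun y w => (k y w)^-1) (fun v w => - k' v w * (k x w)^-1 ^+ 2).
Proof.
move=> eta0 [d2 d20 H2] /kernel_diff1[C [d [C0 d0 d1 H]]].
have kx w : W w -> eta <= normc (k x w).
  by move=> Ww; have := H2 0 _ w Ww; rewrite normr0 addr0; apply.
have ckx : continuous_on W (k x).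
  by have [|ck _ _] := H 0; [rewrite normr0|rewrite addr0 in ck].
have nz z : eta <= normc z -> z != 0 :> R[i].
  by apply: contraTneq => ->; rewrite normc0 -ltNge.
exists (eta^-1 + C / eta ^+ 2 + 3 * C ^+ 2 / eta ^+ 3), (Num.min d d2); split.
- by rewrite !addr_ge0 ?divr_ge0 ?mulr_ge0 ?exprn_ge0 ?invr_ge0 ?(ltW eta0).
- by rewrite lt_min d0.
move=> v; rewrite lt_min => /andP[vd vd2]; have [c1 c1' h1] := H v vd.
have k2 := H2 v vd2; split.
- by move=> w Ww; apply: contCV; [exact/nz/k2|exact: c1].
- move=> w Ww; have cV : contC (fun w => (k x w)^-1) w by apply: contCV; [exact/nz/kx|exact: ckx].
  have -> : (fun w => - k' v w * (k x w)^-1 ^+ 2) =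
      (fun w => (0 - k' v w) * ((k x w)^-1 * (k x w)^-1)).
    by apply/funext => u; rewrite sub0r expr2.
  apply: contCM; last exact: contCM.
  by apply: contCB; [exact: contC_cst|exact: c1'].
have v1 : `|v| <= 1 by rewrite (le_trans (ltW vd)).
have v0 : 0 <= `|v| by [].
have i1 : 0 <= eta^-1 by rewrite invr_ge0 ltW.
have i2 : 0 <= C / eta ^+ 2 by rewrite divr_ge0 ?exprn_ge0 ?(ltW eta0).
have i3 : 0 <= 3 * C ^+ 2 / eta ^+ 3 by rewrite divr_ge0 ?mulr_ge0 ?exprn_ge0 ?(ltW eta0).
have vv : 0 <= `|v| ^+ 2 by exact: exprn_ge0.
move=> w Ww; have [a0 a1 b1 e1] := h1 w Ww.
have Vx : normc (k x w)^-1 <= eta^-1.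
  by rewrite normcV lef_pV2 ?posrE ?kx// (lt_le_trans eta0) ?kx.
have Vv : normc (k (x + v) w)^-1 <= eta^-1.
  by rewrite normcV lef_pV2 ?posrE ?k2// (lt_le_trans eta0) ?k2.
split.
- by lra.
- rewrite normcM normcN normcX.
  have p : normc (k' v w) * normc (k x w)^-1 ^+ 2 <= (C * `|v|) * eta^-1 ^+ 2.
    apply: ler_pM; rewrite ?normc_ge0 ?exprn_ge0 ?normc_ge0//.
    by rewrite lerXn2r ?nnegrE ?normc_ge0.
  apply: le_trans p _; rewrite mulrAC -exprVn ler_wpM2r// -?exprVn.
  by rewrite exprVn; lra.
set u := `|v|; set e := k (x + v) w - k x w - k' v w.
have -> : (k (x + v) w)^-1 - (k x w)^-1 - - k' v w * (k x w)^-1 ^+ 2 =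
   (k' v w * (e + k' v w) - k x w * e) * ((k (x + v) w)^-1 * (k x w)^-1 ^+ 2).
  by rewrite /e; field; rewrite (nz _ (kx _ Ww)) (nz _ (k2 _ Ww)).
apply: (@le_trans _ _ ((3 * C ^+ 2 * u ^+ 2) * (eta^-1 * eta^-1 ^+ 2))); last first.
  have -> : 3 * C ^+ 2 * u ^+ 2 * (eta^-1 * eta^-1 ^+ 2) = 3 * C ^+ 2 / eta ^+ 3 * u ^+ 2.
    by rewrite -exprS exprVn; ring.
  by rewrite ler_wpM2r//; lra.
rewrite normcM; apply: ler_pM; rewrite ?normc_ge0//; last first.
  rewrite normcM normcX; apply: ler_pM; rewrite ?exprn_ge0 ?normc_ge0//.
  by rewrite lerXn2r ?nnegrE ?normc_ge0.
have -> : 3 * C ^+ 2 * u ^+ 2 = (C * u) * (2 * (C * u)) + C * (C * u ^+ 2) by ring.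
apply: le_trans (le_normcD _ _) _; rewrite normcN !normcM; apply: lerD; last first.
  by apply: ler_pM; rewrite ?normc_ge0.
apply: ler_pM; rewrite ?normc_ge0//.
apply: le_trans (le_normcD _ _) _.
have : C * u ^+ 2 <= C * u by rewrite ler_wpM2l// expr2 ler_piMl.
rewrite -/e -/u in e1; rewrite -/u in b1; lra.
Qed.

Definition point_diff (f : V -> R) x (l : V -> R) := exists C d, [/\ 0 <= C, 0 < d &
  forall v, `|v| < d -> `|l v| <= C * `|v| /\ `|f (x + v) - f x - l v| <= C * `|v| ^+ 2].

Lemma point_diff_continuous f x (l : V -> R) : point_diff f x l -> {for x, continuous f}.
Proof.
move=> [C [d [C0 d0 H]]].
apply/(@cvgrPdist_le R R^o V (nbhs x) (nbhs_filter x) f (f x)) => e e0.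
pose d' := Num.min 1 (Num.min d (e / (2 * C + 1))).
have C1 : 0 < 2 * C + 1 by rewrite ltr_wpDl ?mulr_ge0.
have d'0 : 0 < d' by rewrite !lt_min ltr01 d0 divr_gt0.
apply/(@nbhs_normP R V x); exists d' => //= y; rewrite /= distrC => yx.
move: yx; rewrite !lt_min => /and3P[y1 yd ye].
pose v := y - x; rewrite -/v in y1 yd ye.
have [h1 h2] := H v yd; have yE : y = x + v by rewrite /v addrC subrK.
rewrite distrC yE; have -> : f (x + v) - f x = (f (x + v) - f x - l v) + l v by ring.
apply: le_trans (ler_normD _ _) _.
have v0 : 0 <= `|v| by [].
have : C * `|v| ^+ 2 <= C * `|v| by rewrite ler_wpM2l// expr2 ler_piMl// ltW.
move: ye; rewrite ltr_pdivlMr//; lra.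
Qed.

Lemma point_diff_derive f x (l : V -> R) j a : point_diff f x l ->
  (forall h : R, l (h *: delta_mx 0 j) = h * a) ->
  is_derive x (delta_mx 0 j : V) f a.
Proof.
move=> [C [d [C0 d0 H]]] la; have nd : `|delta_mx 0 j : V| <= 1.
  rewrite [leLHS]/Num.Def.normr /= mx_normrE; apply: bigmax_le => // -[i i'] _ /=.
  by rewrite mxE; case: (_ && _); rewrite ?normr1 ?normr0.
have cv : h^-1 *: (f (h *: (delta_mx 0 j : V) + x) - f x) @[h --> (0 : R)^'] --> (a : R).
  apply/cvgrPdist_le => e e0; pose d' := Num.min d (e / (C + 1)).
  have C1 : 0 < C + 1 by rewrite ltr_wpDl.
  have d'0 : 0 < d' by rewrite !lt_min d0 divr_gt0.
  apply/nbhs_normP; exists d' => //= h; rewrite /= sub0r normrN lt_min => /andP[hd he] hn0.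
  have vn : `|h *: delta_mx 0 j : V| <= `|h|.
    by rewrite normrZ -[leRHS]mulr1 ler_wpM2l.
  have [_] := H _ (le_lt_trans vn hd); rewrite la => hh.
  have h0 : 0 < `|h| by rewrite normr_gt0.
  rewrite distrC; set D := f _ - f x.
  have -> : h^-1 *: D - a = h^-1 * (D - h * a).
    by rewrite /GRing.scale /= [RHS]mulrBr mulKf.
  rewrite normrM normfV ler_pdivrMl//.
  rewrite [x + _]addrC -/D in hh.
  apply: le_trans hh _; apply: (@le_trans _ _ (C * `|h| ^+ 2)).
    by rewrite ler_wpM2l// lerXn2r ?nnegrE.
  rewrite expr2 mulrCA ler_wpM2l//; move: he; rewrite ltr_pdivlMr//; lra.
apply: DeriveDef; first by apply/cvg_ex; exists a.
by apply/cvg_lim.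
Qed.

Lemma functionalZ W Lam c phi : bounded_functional W Lam -> continuous_on W phi ->
  Lam (fun w => c * phi w) = c * Lam phi.
Proof.
move=> [lin _] cphi; have L0 : Lam (fun=> 0) = 0.
  have c0 : continuous_on W (fun=> 0 : R[i]) by move=> w _; exact: contC_cst.
  have : Lam (fun=> 0) = 1 * Lam (fun=> 0) + Lam (fun=> 0).
    rewrite -lin//; congr Lam; apply/funext => w; by rewrite mulr0 addr0.
  by rewrite mul1r => /eqP; rewrite -subr_eq0 opprD addrA subrr sub0r oppr_eq0 => /eqP.
have -> : (fun w => c * phi w) = (fun w => c * phi w + 0).
  by apply/funext => w; rewrite addr0.
have c0 : continuous_on W (fun=> 0 : R[i]) by move=> w _; exact: contC_cst.
by rewrite (lin _ _ _ cphi c0) L0 addr0.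
Qed.

Lemma functional_diff W Lam x k k' b (L : V -> R) : bounded_functional W Lam ->
  kernel_diff W x k k' -> (forall v, continuous_on W (k' v) -> complex.Re (b * Lam (k' v)) = L v) ->
  point_diff (fun y => complex.Re (b * Lam (k y))) x L.
Proof.
move=> [lin [M M0 bnd]] [C [d [C0 d0 H]]] LE.
exists (normc b * (M * C)), d; split=> [|//|v vd].
  by rewrite !mulr_ge0 ?normc_ge0.
have [|cx _ _] := H 0; first by rewrite normr0.
rewrite addr0 in cx; have [c1 c2 h] := H v vd; rewrite -LE//; split.
  apply: le_trans (normc_Re _) _; rewrite normcM -mulrA ler_wpM2l ?normc_ge0//.
  by rewrite -mulrA; apply: bnd => // w /h[].
rewrite -!raddfB -!mulrBr.
have cB phi psi : continuous_on W phi -> continuous_on W psi ->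
   continuous_on W (fun w => phi w - psi w).
  by move=> a1 a2 w Ww; apply: contCB; [exact: a1|exact: a2].
have linB phi psi : continuous_on W phi -> continuous_on W psi ->
    Lam phi - Lam psi = Lam (fun w => phi w - psi w).
  move=> a1 a2; rewrite (_ : (fun w => _ - _) = (fun w => -1 * psi w + phi w)).
    by rewrite (lin _ _ _ a2 a1) mulN1r addrC.
  by apply/funext => w; rewrite mulN1r addrC.
have c3 := cB _ _ c1 cx; have c4 := cB _ _ c3 c2.
rewrite (linB _ _ c1 cx) (linB _ _ c3 c2).
apply: le_trans (normc_Re _) _; rewrite normcM -!mulrA ler_wpM2l ?normc_ge0//.
by apply: (bnd _ _ c4) => w /h[].
Qed.

End Kernels.

(** * Axial towers from powers of the Cauchy kernel *)

Section Tower.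
Import ComplexField.Normc.
Local Open Scope complex_scope.
Variables (R : realType) (n : nat).
Notation V := 'rV[R]_n.+1.
Notation e_ j := (delta_mx 0 j : V).
Implicit Types (x v : V) (w : R[i]) (U : set V) (H K : nat -> V -> R).
Implicit Types (W D : set R[i]) (Lam : (R[i] -> R[i]) -> R[i]).

Definition vecdot x v : R := \sum_(j < n) x 0 (lift ord0 j) * v 0 (lift ord0 j).

Definition sqradius x : R := vecdot x x.

(** The Cauchy-Riemann equations of a stem function and all their consequences
    under (1/r) d/dr, with r^2 the squared norm [sqradius] of the vector part. No
    division by r is left, so that the equations make sense at real points. *)
Definition axial_tower U H K := forall k x, U x ->
  [/\ {for x, continuous (H k)}, {for x, continuous (K k)},
      is_derive x (e_ ord0) (H k) (- K k.+1 x),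
      is_derive x (e_ ord0) (K k) (k.*2.+1%:R * H k x + sqradius x * H k.+1 x) &
      forall j : 'I_n,
        is_derive x (e_ (lift ord0 j)) (H k) (x 0 (lift ord0 j) * H k.+1 x) /\
        is_derive x (e_ (lift ord0 j)) (K k) (x 0 (lift ord0 j) * K k.+1 x)].

Definition axis x w : R[i] := w - (x 0 ord0)%:C.

(** The product of w - z and w - conj z, for z = x_0 + i r, as a polynomial in
    x; see [quad_factor]. *)
Definition quad x w : R[i] := axis x w ^+ 2 + (sqradius x)%:C.

(** The differential of [quad] at x in the direction v. *)
Definition dquad x v w : R[i] := (- 2 * v 0 ord0)%:C * axis x w + (2 * vecdot x v)%:C.

Section Kernel.
Variables (W : set R[i]) (B : R).
Hypothesis WB : forall w, W w -> normc w <= B.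

Lemma axis_diff x : kernel_diff W x axis (fun v _ => (- v 0 ord0)%:C).
Proof.
have [W0|/set0P[w0 Ww0]] := eqVneq W set0.
  by exists 0, 1; split=> // v _; rewrite W0; split.
have B0 : 0 <= B by exact: le_trans (normc_ge0 _) (WB Ww0).
exists (B + `|x| + 1), 1; split=> //; first by rewrite !addr_ge0.
move=> v v1; split.
- by move=> w _; apply: contCB; [exact: contC_id|exact: contC_cst].
- by move=> w _; exact: contC_cst.
move=> w Ww; split.
- have := le_normcD w (- ((x + v) 0 ord0)%:C); rewrite normcN normc_real /axis.
  have := WB Ww; have := ler_normD (x 0 ord0) (v 0 ord0); rewrite mxE.
  have := coord_le_norm x ord0; have := coord_le_norm v ord0; lra.
- rewrite normc_real normrN; have := coord_le_norm v ord0.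
  by move=> /le_trans; apply; rewrite ler_peMl// lerDr addr_ge0.
have -> : axis (x + v) w - axis x w - (- v 0 ord0)%:C = 0.
  by rewrite /axis mxE real_complexD -[- v 0 ord0]sub0r real_complexB; ring.
by rewrite normc0 mulr_ge0 ?exprn_ge0// !addr_ge0.
Qed.

Lemma vecdot_bound x v : `|vecdot x v| <= n%:R * `|x| * `|v|.
Proof.
apply: le_trans (ler_norm_sum _ _ _) _.
rewrite -mulrA -[n in n%:R]card_ord -sumr_const mulr_suml; apply: ler_sum => j _.
by rewrite normrM mul1r; apply: ler_pM => //; exact: coord_le_norm.
Qed.

Lemma sqradiusD x v : sqradius (x + v) = sqradius x + 2 * vecdot x v + sqradius v.
Proof.
rewrite /sqradius /vecdot mulr_sumr -!big_split /=; apply: eq_bigr => j _.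
by rewrite mxE; ring.
Qed.

Lemma sqradius_diff x :
  kernel_diff W x (fun y _ => (sqradius y)%:C) (fun v _ => (2 * vecdot x v)%:C).
Proof.
pose N : R := n%:R * `|x|.
have N0 : 0 <= N by exact: mulr_ge0.
exists (N * `|x| + 2 * N + n%:R), 1; split=> //.
  by rewrite !addr_ge0// mulr_ge0.
move=> v /ltW v1; have v0 : 0 <= `|v| by [].
have Nx : 0 <= N * `|x| by exact: mulr_ge0.
have hv := vecdot_bound x v; rewrite -/N in hv.
have hx := vecdot_bound x x; rewrite -/N -/(sqradius x) in hx.
have hs : `|sqradius v| <= n%:R * `|v| ^+ 2.
  by rewrite expr2 mulrA; exact: vecdot_bound.
have n0 : (0 : R) <= n%:R by [].
split; [by move=> w _; exact: contC_cst|by move=> w _; exact: contC_cst|].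
move=> w _; split.
- rewrite normc_real sqradiusD.
  have := ler_normD (sqradius x + 2 * vecdot x v) (sqradius v).
  have := ler_normD (sqradius x) (2 * vecdot x v); rewrite normrM (ger0_norm (ler0n _ 2)).
  have : N * `|v| <= N by rewrite ler_piMr.
  have : n%:R * `|v| ^+ 2 <= n%:R by rewrite ler_piMr// expr_le1.
  lra.
- rewrite normc_real normrM (ger0_norm (ler0n _ 2)).
  have : 0 <= N * `|x| * `|v| by exact: mulr_ge0.
  have : 0 <= n%:R * `|v| by exact: mulr_ge0.
  by rewrite !mulrDl; lra.
rewrite -!real_complexB normc_real sqradiusD.
have -> : sqradius x + 2 * vecdot x v + sqradius v - sqradius x - 2 * vecdot x v =
  sqradius v by ring.
apply: le_trans hs _; rewrite ler_wpM2r ?exprn_ge0//; lra.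
Qed.

Lemma quad_diff x : kernel_diff W x quad (dquad x).
Proof.
have := kernel_diffD (kernel_diffM (axis_diff x) (axis_diff x)) (sqradius_diff x).
rewrite (_ : (fun y w => axis y w * axis y w + _) = quad); last first.
  by apply/funext => y; apply/funext => w; rewrite /quad expr2.
apply: eq_kernel_diff => v w; rewrite /dquad -[- v 0 ord0]mulN1r !real_complexM.
have -> : (- 2 : R)%:C = - 2%:R :> R[i] by rewrite rmorphN rmorph_nat.
have -> : (- 1 : R)%:C = - 1 :> R[i] by rewrite rmorphN rmorph1.
by ring.
Qed.

Variables (U : set V) (eta : R).
Hypotheses (oU : open U) (eta0 : 0 < eta).
Hypothesis Ueta : forall x w, U x -> W w -> eta <= normc (quad x w).

Lemma quadV_diff x : U x -> kernel_diff W x (fun y w => (quad y w)^-1)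
  (fun v w => - dquad x v w * (quad x w)^-1 ^+ 2).
Proof.
move=> Ux; apply: (kernel_diffV eta0) (quad_diff x).
have /(@nbhs_normP R V x)[d /= d0 dU] : nbhs x U by exact: open_nbhs_nbhs.
exists d => // v vd w Ww; apply: Ueta => //; apply: dU.
by rewrite /= opprD addrA subrr sub0r normrN.
Qed.

Lemma quadVX_diff x m : U x -> kernel_diff W x (fun y w => (quad y w)^-1 ^+ m.+1)
  (fun v w => - m.+1%:R * (quad x w)^-1 ^+ m.+2 * dquad x v w).
Proof.
move=> Ux; elim: m => [|m IH].
  by have := quadV_diff Ux; apply: eq_kernel_diff => v w; rewrite mulN1r; ring.
have := kernel_diffM (quadV_diff Ux) IH.
rewrite (_ : (fun y w => _ * _) = (fun y w => (quad y w)^-1 ^+ m.+2)); last first.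
  by apply/funext => y; apply/funext => w; rewrite [RHS]exprS.
by apply: eq_kernel_diff => v w; rewrite -[m.+2%:R]natr1 !exprS; ring.
Qed.

(** The square of the axis produced by the product rule is eliminated by
    (w - x_0)^2 = q - r^2; this turns the differential into the right-hand sides
    of the equations for the functions k_m of a tower. *)
Lemma axis_quadVX_diff x m : U x ->
  kernel_diff W x (fun y w => axis y w * (quad y w)^-1 ^+ m.+1)
  (fun v w => (m.*2.+1%:R * v 0 ord0)%:C * (quad x w)^-1 ^+ m.+1 +
    (- m.+1%:R * 2)%:C * (((v 0 ord0 * sqradius x)%:C * (quad x w)^-1 ^+ m.+2) +
     (vecdot x v)%:C * (axis x w * (quad x w)^-1 ^+ m.+2))).
Proof.
move=> Ux; have := kernel_diffM (axis_diff x) (quadVX_diff m Ux).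
apply: eq_kernel_diff => v w.
have E : axis x w ^+ 2 * (quad x w)^-1 ^+ m.+2 =
    (quad x w)^-1 ^+ m.+1 - (sqradius x)%:C * (quad x w)^-1 ^+ m.+2.
  rewrite -[axis x w ^+ 2](addrK (sqradius x)%:C) -/(quad x w) mulrBl; congr (_ - _).
  (* At the zeros of q both sides vanish, as the inverse of 0 is 0: the identity
     holds for all w, so that no continuity argument is restricted to W. *)
  have [->|q0] := eqVneq (quad x w) 0; first by rewrite invr0 !expr0n mulr0.
  by rewrite [_ ^+ m.+2]exprS mulrA mulfV// mul1r.
rewrite /dquad -mul2n !real_complexM -[- v 0 ord0]mulN1r !real_complexM.
have -> : (- 2 : R)%:C = - 2%:R :> R[i] by rewrite rmorphN rmorph_nat.
have -> : (- 1 : R)%:C = - 1 :> R[i] by rewrite rmorphN rmorph1.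
have -> : (- m.+1%:R : R)%:C = - m.+1%:R :> R[i] by rewrite rmorphN rmorph_nat.
have -> : (2 : R)%:C = 2%:R :> R[i] by rewrite rmorph_nat.
have -> : ((2 * m).+1%:R : R)%:C = 2 * m%:R + 1 :> R[i].
  by rewrite rmorph_nat -natr1 natrM.
rewrite -[m.+1%:R]natr1.
set y := _ ^+ m.+1 in E *; set y2 := _ ^+ m.+2 in E *.
set a := axis x w in E *.
transitivity (- (v 0 ord0)%:C * y - (m%:R + 1) * (- 2 * (v 0 ord0)%:C * (a ^+ 2 * y2) +
   2 * (vecdot x v)%:C * (a * y2))); first by ring.
by rewrite E; ring.
Qed.

(** The factor (-2)^k k! collected by applying (1/r) d/dr to 1 / q. *)
Definition tower_coef (k : nat) : R := \prod_(j < k) (- j.+1%:R * 2).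

Lemma tower_coefS k : tower_coef k.+1 = (- k.+1%:R * 2) * tower_coef k.
Proof. by rewrite /tower_coef big_ord_recr /= mulrC. Qed.

Variables (Lam : (R[i] -> R[i]) -> R[i]) (b : R[i]).
Hypothesis LamP : bounded_functional W Lam.

(** The real part makes the functions real-valued; the equations of a tower have
    real coefficients and pass to real parts. *)
Definition towerH k x : R :=
  complex.Re ((tower_coef k)%:C * b * Lam (fun w => (quad x w)^-1 ^+ k.+1)).
Definition towerK k x : R :=
  complex.Re ((tower_coef k)%:C * b * Lam (fun w => axis x w * (quad x w)^-1 ^+ k.+1)).

Lemma kernel_diff_cont x k k' : kernel_diff W x k k' -> continuous_on W (k x).
Proof.
move=> [C [d [_ d0 H]]]; have [|c _ _] := H 0; first by rewrite normr0.
by rewrite addr0 in c.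
Qed.

Lemma towerH_diff k x : U x -> point_diff (towerH k) x
  (fun v => - v 0 ord0 * towerK k.+1 x + vecdot x v * towerH k.+1 x).
Proof.
move=> Ux; apply: (functional_diff LamP (quadVX_diff k Ux)) => v _.
have c1 := kernel_diff_cont (quadVX_diff k.+1 Ux).
have c2 := kernel_diff_cont (axis_quadVX_diff k.+1 Ux).
rewrite (_ : (fun w => _) = (fun w => (- k.+1%:R * 2 * - v 0 ord0)%:C *
     (axis x w * (quad x w)^-1 ^+ k.+2) +
     ((- k.+1%:R * 2 * vecdot x v)%:C * (quad x w)^-1 ^+ k.+2))); last first.
  apply/funext => w; rewrite /dquad -[- v 0 ord0]mulN1r !real_complexM.
  have -> : (- 2 : R)%:C = - 2%:R :> R[i] by rewrite rmorphN rmorph_nat.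
  have -> : (- 1 : R)%:C = - 1 :> R[i] by rewrite rmorphN rmorph1.
  have -> : (- k.+1%:R : R)%:C = - k.+1%:R :> R[i] by rewrite rmorphN rmorph_nat.
  have -> : (2 : R)%:C = 2%:R :> R[i] by rewrite rmorph_nat.
  by ring.
have c3 : continuous_on W (fun w => (- k.+1%:R * 2 * vecdot x v)%:C * (quad x w)^-1 ^+ k.+2).
  by move=> w Ww; apply: contCM; [exact: contC_cst|exact: c1].
rewrite (LamP.1 _ _ _ c2 c3) (functionalZ _ LamP c1) /towerK /towerH tower_coefS.
rewrite -!ReZ -ReD; congr (complex.Re _); rewrite !real_complexM; ring.
Qed.

Lemma towerK_diff k x : U x -> point_diff (towerK k) x
  (fun v => v 0 ord0 * (k.*2.+1%:R * towerH k x + sqradius x * towerH k.+1 x)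
            + vecdot x v * towerK k.+1 x).
Proof.
move=> Ux; apply: (functional_diff LamP (axis_quadVX_diff k Ux)) => v _.
have c0 := kernel_diff_cont (quadVX_diff k Ux).
have c1 := kernel_diff_cont (quadVX_diff k.+1 Ux).
have c2 := kernel_diff_cont (axis_quadVX_diff k.+1 Ux).
have cZ (a : R[i]) phi : continuous_on W phi -> continuous_on W (fun w => a * phi w).
  by move=> cphi w Ww; apply: contCM; [exact: contC_cst|exact: cphi].
have c3 := cZ (vecdot x v)%:C _ c2.
have c4 : continuous_on W (fun w => (v 0 ord0 * sqradius x)%:C * (quad x w)^-1 ^+ k.+2 +
    (vecdot x v)%:C * (axis x w * (quad x w)^-1 ^+ k.+2)).
  by move=> w Ww; apply: contCD; [exact: cZ|exact: c3].
rewrite (LamP.1 _ _ _ c0 (cZ _ _ c4)) (functionalZ _ LamP c4) (LamP.1 _ _ _ c1 c3).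
rewrite (functionalZ _ LamP c2) /towerK /towerH tower_coefS.
by rewrite -!ReZ -!ReD -!ReZ -ReD; congr (complex.Re _); rewrite !real_complexM; ring.
Qed.

Lemma delta0_ord0 (h : R) : (h *: e_ ord0) 0 ord0 = h.
Proof. by rewrite !mxE !eqxx mulr1. Qed.

Lemma delta0_lift (h : R) j : (h *: e_ ord0) 0 (lift ord0 j) = 0.
Proof. by rewrite !mxE eq_sym (negbTE (neq_lift _ _)) mulr0. Qed.

Lemma vecdot_delta0 (h : R) x : vecdot x (h *: e_ ord0) = 0.
Proof. by rewrite /vecdot big1// => j _; rewrite delta0_lift mulr0. Qed.

Lemma vecdot_delta (h : R) x j : vecdot x (h *: e_ (lift ord0 j)) = h * x 0 (lift ord0 j).
Proof.
rewrite /vecdot (bigD1 j)//= big1 ?addr0 => [|i ij]; first by rewrite !mxE !eqxx mulr1 mulrC.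
by rewrite !mxE eqxx (inj_eq lift_inj) (negbTE ij) !mulr0.
Qed.

Lemma delta_ord0 (h : R) j : (h *: e_ (lift ord0 j)) 0 ord0 = 0.
Proof. by rewrite !mxE (negbTE (neq_lift _ _)) mulr0. Qed.

Lemma axial_tower_Cauchy : axial_tower U towerH towerK.
Proof.
move=> k x Ux; have dH := towerH_diff k Ux; have dK := towerK_diff k Ux; split.
- exact: point_diff_continuous dH.
- exact: point_diff_continuous dK.
- by apply: (point_diff_derive dH) => h; rewrite delta0_ord0 vecdot_delta0; ring.
- by apply: (point_diff_derive dK) => h; rewrite delta0_ord0 vecdot_delta0; ring.
move=> j; split.
- by apply: (point_diff_derive dH) => h; rewrite delta_ord0 vecdot_delta; ring.
- by apply: (point_diff_derive dK) => h; rewrite delta_ord0 vecdot_delta; ring.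
Qed.

End Kernel.
End Tower.

(** * The axial tower of a stem function *)

Section LocalTower.
Import ComplexField.Normc.
Local Open Scope complex_scope.
Variables (R : realType) (n : nat).
Notation V := 'rV[R]_n.+1.
Implicit Types (x v : V) (w z : R[i]) (U : set V).
Implicit Types (W D : set R[i]).

(** The point z of the closed upper half-plane such that x = Re z + J Im z for a
    unit vector J. *)
Definition axial_point x : R[i] := Complex (x 0 ord0) (Num.sqrt (sqradius x)).

Lemma sqradius_ge0 x : 0 <= sqradius x.
Proof. by apply: sumr_ge0 => j _; rewrite -expr2 sqr_ge0. Qed.

Lemma continuous_sumr (I : Type) (r : seq I) (f : I -> V -> R) x :
  (forall i, {for x, continuous (f i)}) ->
  {for x, continuous (fun y => \sum_(i <- r) f i y)}.
Proof.
move=> cf; elim: r => [|i r IH].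
  have -> : (fun y => \sum_(i <- [::]) f i y) = (fun=> 0).
    by apply/funext => y; rewrite big_nil.
  exact: cst_continuous.
have -> : (fun y => \sum_(j <- i :: r) f j y) = (fun y => f i y + \sum_(j <- r) f j y).
  by apply/funext => y; rewrite big_cons.
exact: (@continuousD _ _ _ (f i)).
Qed.

Lemma sqradius_continuous : continuous (@sqradius R n).
Proof.
move=> x; apply: continuous_sumr => j.
by apply: (@continuousM _ _ (fun y : V => y 0 (lift ord0 j))); exact: coord_continuous.
Qed.

Lemma axial_dist_continuous z : continuous (fun x : V => normc (axial_point x - z)).
Proof.
move=> x; case: z => a b; rewrite /axial_point /=.
apply: (@continuous_comp _ _ _ (fun y : V => (y 0 ord0 - a) ^+ 2 +
    (Num.sqrt (sqradius y) - b) ^+ 2) Num.sqrt);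
  last exact: sqrt_continuous.
have cs : {for x, continuous (fun y : V => Num.sqrt (sqradius y))}.
  apply: (@continuous_comp _ _ _ (@sqradius R n) Num.sqrt).
    exact: sqradius_continuous.
  exact: sqrt_continuous.
have c0 : {for x, continuous (fun y : V => y 0 ord0)} by exact: coord_continuous.
have cB (f : V -> R) c : {for x, continuous f} -> {for x, continuous (fun y => (f y - c) ^+ 2)}.
  move=> cf; have cfc : {for x, continuous (fun y => f y - c)}.
    by apply: (@continuousB _ _ _ f (fun=> c)) => //; exact: cst_continuous.
  exact: (@continuousM _ _ (fun y => f y - c) (fun y => f y - c)).
exact: (@continuousD R R^o V (fun y => (y 0 ord0 - a) ^+ 2) _ x (cB _ a c0) (cB _ b cs)).
Qed.

Lemma quad_factor x w : quad x w = (w - axial_point x) * (w - conjc (axial_point x)).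
Proof.
rewrite /quad /axis /axial_point; have := sqr_sqrtr (sqradius_ge0 x).
move: (Num.sqrt _) => r <-; case: w => a b; apply/eqP; rewrite eq_complex /=.
by apply/andP; split; apply/eqP; ring.
Qed.

(** Boundedness with respect to the supremum over W makes the functional blind
    to the values outside W. *)
Lemma eq_functional W Lam (phi psi : R[i] -> R[i]) : bounded_functional W Lam ->
  continuous_on W phi -> continuous_on W psi -> (forall w, W w -> phi w = psi w) ->
  Lam phi = Lam psi.
Proof.
move=> [lin [M M0 bnd]] cphi cpsi E.
apply/eqP; rewrite -subr_eq0; apply/eqP; apply: eq0_normc; apply/eqP.
rewrite eq_le normc_ge0 andbT -[X in _ <= X](mulr0 M).
have -> : Lam phi - Lam psi = Lam (fun w => -1 * psi w + phi w).
  by rewrite (lin _ _ _ cpsi cphi) mulN1r addrC.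
apply: bnd => [w Ww|w Ww]; last by rewrite E// mulN1r addNr normc0.
apply: contCD; last exact: cphi.
by apply: contCM; [exact: contC_cst|exact: cpsi].
Qed.

(** The half sum and the half difference of the kernels 1 / (w - z) and
    1 / (w - conj z) are (w - x_0) / q and i r / q, and the half sum and the half
    difference of the values of F are F_1 and i F_2. *)
Theorem local_axial_tower D (x0 : V) rho : 0 < rho -> conj_invariant D ->
  (forall w, normc (w - axial_point x0) < rho -> D w) ->
  exists U, [/\ open U, U x0, forall x, U x -> D (axial_point x) &
    forall F1 F2 : R[i] -> R,
      (forall z, D z -> F1 (conjc z) = F1 z /\ F2 (conjc z) = - F2 z) ->
      (forall z, D z -> holo (fun w => Complex (F1 w) (F2 w)) z) ->
      exists H K, axial_tower U H K /\ forall x, U x ->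
        K 0%N x = F1 (axial_point x) /\
        Num.sqrt (sqradius x) * H 0%N x = F2 (axial_point x)].
Proof.
move=> rho0 DJ Drho.
have [r [B [c [r0 c0 repr]]]] := Cauchy_functional rho0 DJ Drho.
move: repr; set W := [set w | _] => repr.
(* bounded by rho as well, so that z stays in D, where F is a stem function *)
pose d := Num.min rho (r / 2).
pose U : set V := [set x | normc (axial_point x - axial_point x0) < d].
have U1 x : U x -> normc (axial_point x - axial_point x0) < rho.
  by rewrite /U /= lt_min => /andP[].
have U2 x : U x -> normc (axial_point x - axial_point x0) < r / 2.
  by rewrite /U /= lt_min => /andP[].
have UD x : U x -> D (axial_point x) by move=> /U1; exact: Drho.
have oU : open U.
  apply: (@open_comp _ _ (fun x : V => normc (axial_point x - axial_point x0)) [set t | t < d]).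
    by move=> x _; exact: axial_dist_continuous.
  exact: open_lt.
exists U; split => //.
  suff : normc (axial_point x0 - axial_point x0) < d by [].
  by rewrite subrr normc0 lt_min rho0 divr_gt0.
move=> F1 F2 stem hF; pose G w := Complex (F1 w) (F2 w).
have [Lam LamP LamE] := repr G hF.
have eta0 : 0 < (r / 2) ^+ 2 by rewrite exprn_gt0// divr_gt0.
have far x w : U x -> W w -> r / 2 <= normc (w - axial_point x) /\
    r / 2 <= normc (w - conjc (axial_point x)).
  move=> /U2 Ux [w1 w2 _]; have nJ : normc (conjc (axial_point x) - conjc (axial_point x0)) =
     normc (axial_point x - axial_point x0) by rewrite -rmorphB normc_conj.
  have := normcB_tri w (axial_point x0) (axial_point x).
  by have := normcB_tri w (conjc (axial_point x0)) (conjc (axial_point x)); rewrite nJ; lra.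
have Ueta x w : U x -> W w -> (r / 2) ^+ 2 <= normc (quad x w).
  move=> Ux Ww; have [h1 h2] := far x w Ux Ww.
  by rewrite quad_factor normcM expr2; apply: ler_pM => //; rewrite divr_ge0// ltW.
have WB w : W w -> normc w <= B by case.
exists (towerH Lam c^-1), (towerK Lam c^-1); split.
  exact: (axial_tower_Cauchy WB oU eta0 Ueta).
move=> x Ux; set z := axial_point x.
have [E1 E2] := LamE z (U2 x Ux).
have nz w : W w -> w - z != 0 /\ w - conjc z != 0.
  move=> Ww; have [h1 h2] := far x w Ux Ww; have r20 : 0 < r / 2 by rewrite divr_gt0.
  by split; [apply: contraTneq h1|apply: contraTneq h2] => ->; rewrite normc0 -ltNge.
have c1 : continuous_on W (fun w => (w - z)^-1).
  by move=> w /nz[wz _]; apply: contC_inv_sub; rewrite -subr_eq0.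
have c2 : continuous_on W (fun w => (w - conjc z)^-1).
  by move=> w /nz[_ wz]; apply: contC_inv_sub; rewrite -subr_eq0.
have cq := kernel_diff_cont (quadVX_diff WB oU eta0 Ueta 0 Ux).
have caq := kernel_diff_cont (axis_quadVX_diff WB oU eta0 Ueta 0 Ux).
have [S1 S2] := stem z (UD x Ux).
have zE : z = (x 0 ord0)%:C + 'i * (Num.sqrt (sqradius x))%:C by rewrite [LHS]complexE.
have zJ : conjc z = (x 0 ord0)%:C - 'i * (Num.sqrt (sqradius x))%:C.
  rewrite /z /axial_point; apply/eqP; rewrite eq_complex /=.
  by apply/andP; split; apply/eqP; ring.
have i0 : 'i != 0 :> R[i] by rewrite -normr_eq0 normC_normc normc_i oner_eq0.
have GE y : G y = (F1 y)%:C + 'i * (F2 y)%:C by rewrite [LHS]complexE.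
have cE w : continuous_on W (fun v : R[i] => w * (v - conjc z)^-1).
  by move=> v Wv; apply: contCM; [exact: contC_cst|exact: c2].
split.
  rewrite /towerK /tower_coef big_ord0.
  have LE : 2 * Lam (fun w => axis x w * (quad x w)^-1 ^+ 1) = c * G z + c * G (conjc z).
    rewrite -E1 -E2 -(functionalZ _ LamP caq) -[Lam (fun w => (w - z)^-1)]mul1r.
    rewrite -(LamP.1 _ _ _ c1 c2); apply: (eq_functional LamP).
    - by move=> w Ww; apply: contCM; [exact: contC_cst|exact: caq].
    - move=> w Ww; apply: contCD; last exact: c2.
      by apply: contCM; [exact: contC_cst|exact: c1].
    move=> w /nz[n1 n2]; rewrite expr1 quad_factor -/z.
    have -> : axis x w = ((w - z) + (w - conjc z)) / 2.
      by rewrite /axis zJ zE; field.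
    by field; rewrite n1 n2.
  have -> : Lam (fun w => axis x w * (quad x w)^-1 ^+ 1) = c * (F1 z)%:C.
    apply: (@mulfI _ 2); rewrite ?pnatr_eq0// LE !GE S1 S2.
    by rewrite -[- F2 z]sub0r real_complexB; ring.
  by rewrite -mulrA mulKf// ReZ mul1r.
rewrite /towerH /tower_coef big_ord0.
have LE : (2 * 'i * (Num.sqrt (sqradius x))%:C) * Lam (fun w => (quad x w)^-1 ^+ 1) =
    c * G z - c * G (conjc z).
  rewrite -E1 -E2 -(functionalZ _ LamP cq) addrC -mulN1r -(LamP.1 _ _ _ c2 c1).
  apply: (eq_functional LamP).
  - by move=> w Ww; apply: contCM; [exact: contC_cst|exact: cq].
  - by move=> w Ww; apply: contCD; [exact: cE|exact: c1].
  move=> w /nz[n1 n2]; rewrite expr1 quad_factor -/z.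
  have -> : 2 * 'i * (Num.sqrt (sqradius x))%:C = (w - conjc z) - (w - z).
    by rewrite zJ zE; ring.
  by field; rewrite n1 n2.
rewrite -mulrA ReZ mul1r -ReZ.
have -> : (Num.sqrt (sqradius x))%:C * (c^-1 * Lam (fun w => (quad x w)^-1 ^+ 1)) =
    (F2 z)%:C; last by [].
apply: (@mulfI _ (2 * 'i * c)); first by rewrite !mulf_neq0// pnatr_eq0.
transitivity ((2 * 'i * (Num.sqrt (sqradius x))%:C) * Lam (fun w => (quad x w)^-1 ^+ 1)).
  by field.
rewrite LE !GE S1 S2 -[- F2 z]sub0r real_complexB; ring.
Qed.

End LocalTower.

(** * Functions of class C^k and their Laplacians *)

Section ClassC.
Variables (R : realType) (m : nat).
Notation V := 'rV[R]_m.+1.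
Notation e_ j := (delta_mx 0 j : V).
Implicit Types (x : V) (u v f g : V -> R) (U : set V) (c : R).

Lemma open_near U x (P : V -> Prop) : open U -> U x -> (forall y, U y -> P y) ->
  \forall y \near x, P y.
Proof. by move=> oU Ux UP; apply: filterS UP _; exact: open_nbhs_nbhs. Qed.

Lemma continuous_eq_on U u v : open U -> (forall x, U x -> u x = v x) ->
  forall x, U x -> {for x, continuous u} -> {for x, continuous v}.
Proof.
move=> oU uv x Ux; rewrite /prop_for /continuous_at -(uv x Ux).
have E : \forall y \near x, u y = v y by exact: (open_near oU Ux).
exact: (cvg_trans (near_eq_cvg E)).
Qed.

Lemma partial_eq_on U u v i : open U -> (forall x, U x -> u x = v x) ->
  forall x, U x -> partial i u x = partial i v x.
Proof. by move=> oU uv x Ux; apply: near_eq_derive; exact: (open_near oU Ux). Qed.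

Lemma classC_eq k U u v : open U -> (forall x, U x -> u x = v x) ->
  classC k U u -> classC k U v.
Proof.
move=> oU; elim: k u v => [|k IH] u v uv [cu du].
  by split=> // x Ux; exact: (continuous_eq_on oU uv) (cu x Ux).
split=> [x Ux|i]; first exact: (continuous_eq_on oU uv) (cu x Ux).
have [du1 du2] := du i; split=> [x Ux|].
  by apply: near_eq_derivable (du1 x Ux); exact: (open_near oU Ux).
by apply: IH du2 => x Ux; exact: partial_eq_on oU uv x Ux.
Qed.

(** Towers are built locally, while the conclusions are about the whole
    domain. *)
Lemma classC_local k U u :
  (forall x, U x -> exists V, [/\ open V, V x & classC k V u]) -> classC k U u.
Proof.
elim: k u => [|k IH] u H.
  by split=> // x /H[W [_ Wx [cu _]]]; exact: cu.
split=> [x /H[W [_ Wx [cu _]]]|i]; first exact: cu.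
split=> [x /H[W [_ Wx [_ /(_ i)[du _]]]]|]; first exact: du.
by apply: IH => x /H[W [oW Wx [_ /(_ i)[_ du]]]]; exists W.
Qed.

Lemma classCS k U u : classC k.+1 U u -> classC k U u.
Proof.
elim: k u => [|k IH] u [cu du]; split=> // i.
by have [du1 du2] := du i; split=> //; exact: IH.
Qed.

Lemma classC_derive k U u i x : classC k.+1 U u -> U x ->
  is_derive x (e_ i) u (partial i u x).
Proof. by move=> [_ /(_ i)[du _]] Ux; exact/derivableP/du. Qed.

Lemma classC_partial k U u i : classC k.+1 U u -> classC k U (partial i u).
Proof. by move=> [_ /(_ i)[]]. Qed.

(** Regularity from any family of derivatives on U; outside U these may differ
    from the partial derivatives. *)
Lemma classC_succ k U u (u' : 'I_m.+1 -> V -> R) : open U ->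
  (forall x, U x -> {for x, continuous u}) ->
  (forall i x, U x -> is_derive x (e_ i) u (u' i x)) ->
  (forall i, classC k U (u' i)) -> classC k.+1 U u.
Proof.
move=> oU cu du cu'; split=> // i; split=> [x Ux|].
  by have [] := du i x Ux.
apply: (classC_eq oU) (cu' i) => x Ux.
by have [_ <-] := du i x Ux.
Qed.

Lemma classC_cst k U c : classC k U (fun=> c).
Proof.
elim: k c => [|k IH] c; split=> //; first by move=> x _; exact: cst_continuous.
  by move=> x _; exact: cst_continuous.
move=> i; split=> [x _|]; first exact: derivable_cst.
have -> : partial i (fun=> c) = (fun=> 0); last exact: IH.
by apply/funext => x; rewrite /partial derive_cst.
Qed.

Lemma is_derive_coord x i j : is_derive x (e_ i) (fun y : V => y 0 j) (i == j)%:R.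
Proof.
have H : point_diff (fun y : V => y 0 j) x (fun v : V => v 0 j).
  exists 1, 1; split=> // v _; rewrite !mul1r; split; first exact: coord_le_norm.
  rewrite mxE (_ : x 0 j + v 0 j - x 0 j - v 0 j = 0); last by ring.
  by rewrite normr0 exprn_ge0.
by apply: (point_diff_derive H) => h; rewrite !mxE eqxx eq_sym.
Qed.

Lemma classC_coord k U j : open U -> classC k U (fun y : V => y 0 j).
Proof.
move=> oU; have cc x : U x -> {for x, continuous (fun y : V => y 0 j)}.
  by move=> _; exact: coord_continuous.
case: k => [//|k].
apply: (classC_succ oU cc) (fun i x _ => is_derive_coord x i j) _ => i.
exact: classC_cst.
Qed.

Lemma is_derive_add x i f g (a b : R) : is_derive x (e_ i) f a -> is_derive x (e_ i) g b ->
  is_derive x (e_ i) (fun y => f y + g y) (a + b).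
Proof. by move=> ? ?; exact: is_deriveD. Qed.

Lemma is_derive_mul x i f g (a b : R) : is_derive x (e_ i) f a -> is_derive x (e_ i) g b ->
  is_derive x (e_ i) (fun y => f y * g y) (f x * b + g x * a).
Proof. by move=> ? ?; exact: is_deriveM. Qed.

Lemma is_derive_scale x i c f (a : R) : is_derive x (e_ i) f a ->
  is_derive x (e_ i) (fun y => c * f y) (c * a).
Proof. by move=> ?; exact: is_deriveZ. Qed.

Lemma is_derive_sumr (I : Type) (r : seq I) (f : I -> V -> R) x i (a : I -> R) :
  (forall j, is_derive x (e_ i) (f j) (a j)) ->
  is_derive x (e_ i) (fun y => \sum_(j <- r) f j y) (\sum_(j <- r) a j).
Proof.
move=> df; elim: r => [|j r IH].
  have -> : (fun y => \sum_(j <- [::]) f j y) = (fun=> 0).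
    by apply/funext => y; rewrite big_nil.
  by rewrite big_nil; exact: is_derive_cst.
have -> : (fun y => \sum_(l <- j :: r) f l y) = (fun y => f j y + \sum_(l <- r) f l y).
  by apply/funext => y; rewrite big_cons.
by rewrite big_cons; exact: is_derive_add.
Qed.

Lemma classC_add k U u v : open U -> classC k U u -> classC k U v ->
  classC k U (fun x => u x + v x).
Proof.
move=> oU; elim: k u v => [|k IH] u v Cu Cv.
  split=> // x Ux; apply: (@continuousD R R^o); [exact: Cu.1|exact: Cv.1].
apply: (classC_succ (u' := fun i x => partial i u x + partial i v x) oU).
- move=> x Ux; apply: (@continuousD R R^o); [exact: Cu.1|exact: Cv.1].
- move=> i x Ux.
  exact: (is_derive_add (classC_derive i Cu Ux) (classC_derive i Cv Ux)).
- by move=> i; apply: IH; exact: classC_partial.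
Qed.

Lemma classC_mul k U u v : open U -> classC k U u -> classC k U v ->
  classC k U (fun x => u x * v x).
Proof.
move=> oU; elim: k u v => [|k IH] u v Cu Cv.
  split=> // x Ux; apply: (@continuousM R V); [exact: Cu.1|exact: Cv.1].
apply: (classC_succ (u' := fun i x => u x * partial i v x + v x * partial i u x) oU).
- move=> x Ux; apply: (@continuousM R V); [exact: Cu.1|exact: Cv.1].
- move=> i x Ux.
  exact: (is_derive_mul (classC_derive i Cu Ux) (classC_derive i Cv Ux)).
- move=> i; have Cu' := classC_partial i Cu; have Cv' := classC_partial i Cv.
  exact: (classC_add oU (IH _ _ (classCS Cu) Cv') (IH _ _ (classCS Cv) Cu')).
Qed.

Lemma classC_scale k U c u : open U -> classC k U u -> classC k U (fun x => c * u x).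
Proof. by move=> oU Cu; apply: classC_mul => //; exact: classC_cst. Qed.

Lemma classC_sumr k U (I : Type) (r : seq I) (f : I -> V -> R) : open U ->
  (forall j, classC k U (f j)) -> classC k U (fun x => \sum_(j <- r) f j x).
Proof.
move=> oU Cf; elim: r => [|j r IH].
  have -> : (fun y => \sum_(j <- [::]) f j y) = (fun=> 0).
    by apply/funext => y; rewrite big_nil.
  exact: classC_cst.
have -> : (fun y => \sum_(l <- j :: r) f l y) = (fun y => f j y + \sum_(l <- r) f l y).
  by apply/funext => y; rewrite big_cons.
exact: classC_add.
Qed.

Lemma laplacian_eq_on U u v : open U -> (forall x, U x -> u x = v x) ->
  forall x, U x -> laplacian u x = laplacian v x.
Proof.
move=> oU uv x Ux; apply: eq_bigr => i _.
by apply: (partial_eq_on _ oU) Ux => y Uy; exact: (partial_eq_on _ oU uv).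
Qed.

Lemma laplacianE U u (u1 u2 : 'I_m.+1 -> V -> R) x (a : R) : open U -> U x ->
  \sum_i u2 i x = a ->
  (forall i y, U y -> is_derive y (e_ i) u (u1 i y)) ->
  (forall i y, U y -> is_derive y (e_ i) (u1 i) (u2 i y)) ->
  laplacian u x = a.
Proof.
move=> oU Ux <- d1 d2; apply: eq_bigr => i _; rewrite -(@derive_val _ _ _ _ _ _ _ (d2 i x Ux)).
by apply: (partial_eq_on _ oU) Ux => y Uy; rewrite -(@derive_val _ _ _ _ _ _ _ (d1 i y Uy)).
Qed.

Lemma laplacianD U u v x : open U -> classC 2 U u -> classC 2 U v -> U x ->
  laplacian (fun y => u y + v y) x = laplacian u x + laplacian v x.
Proof.
move=> oU Cu Cv Ux; apply: (laplacianE (u1 := fun i y => partial i u y + partial i v y)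
  (u2 := fun i y => partial i (partial i u) y + partial i (partial i v) y) oU Ux).
- by rewrite /laplacian -big_split.
- move=> i y Uy.
  exact: (is_derive_add (classC_derive i Cu Uy) (classC_derive i Cv Uy)).
- move=> i y Uy; have Cu' := classC_partial i Cu; have Cv' := classC_partial i Cv.
  exact: (is_derive_add (classC_derive i Cu' Uy) (classC_derive i Cv' Uy)).
Qed.

Lemma laplacianZ U c u x : open U -> classC 2 U u -> U x ->
  laplacian (fun y => c * u y) x = c * laplacian u x.
Proof.
move=> oU Cu Ux; apply: (laplacianE (u1 := fun i y => c * partial i u y)
  (u2 := fun i y => c * partial i (partial i u) y) oU Ux).
- by rewrite /laplacian mulr_sumr.
- by move=> i y Uy; exact: (is_derive_scale c (classC_derive i Cu Uy)).
- move=> i y Uy; have Cu' := classC_partial i Cu.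
  exact: (is_derive_scale c (classC_derive i Cu' Uy)).
Qed.

Lemma laplacian_sumr U (I : Type) (r : seq I) (f : I -> V -> R) x : open U ->
  (forall j, classC 2 U (f j)) -> U x ->
  laplacian (fun y => \sum_(j <- r) f j y) x = \sum_(j <- r) laplacian (f j) x.
Proof.
move=> oU Cf Ux; elim: r => [|j r IH].
  have -> : (fun y => \sum_(j <- [::]) f j y) = (fun=> 0).
    by apply/funext => y; rewrite big_nil.
  rewrite big_nil; apply: (laplacianE (u1 := fun _ _ => 0) (u2 := fun _ _ => 0) oU Ux).
  by rewrite big1.
have -> : (fun y => \sum_(l <- j :: r) f l y) = (fun y => f j y + \sum_(l <- r) f l y).
  by apply/funext => y; rewrite big_cons.
by rewrite big_cons (laplacianD oU)// ?IH//; exact: classC_sumr.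
Qed.

End ClassC.

(** * Smoothness and Laplacians of axial towers *)

Section TowerCalculus.
Variables (R : realType) (n : nat).
Notation V := 'rV[R]_n.+1.
Notation e_ j := (delta_mx 0 j : V).
Notation x_ x j := (x 0 (lift ord0 j)).
Implicit Types (x : V) (U : set V) (H K : nat -> V -> R) (j : 'I_n).

Lemma is_derive_sqradius x i : is_derive x (e_ i) (@sqradius R n)
  (\sum_(j < n) (x_ x j * (i == lift ord0 j)%:R + x_ x j * (i == lift ord0 j)%:R)).
Proof.
by apply: is_derive_sumr => j; apply: is_derive_mul; exact: is_derive_coord.
Qed.

Lemma is_derive_sqradius0 x : is_derive x (e_ ord0) (@sqradius R n) 0.
Proof.
have := is_derive_sqradius x ord0; rewrite big1// => j _.
by rewrite (negbTE (neq_lift _ _)) !mulr0 addr0.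
Qed.

Lemma classC_sqradius k U : open U -> classC k U (@sqradius R n).
Proof.
by move=> oU; apply: classC_sumr => // j; apply: classC_mul => //; exact: classC_coord.
Qed.

Lemma lift0_cases (i : 'I_n.+1) : i = ord0 \/ exists j, i = lift ord0 j.
Proof. by case: (unliftP ord0 i) => [j ->|->]; [right; exists j|left]. Qed.

(** A family indexed by the coordinates, given by its member for x_0 and its
    members for x_1, ..., x_n. *)
Definition ord_family (a : V -> R) (b : 'I_n -> V -> R) (i : 'I_n.+1) : V -> R :=
  if unlift ord0 i is Some j then b j else a.

Lemma ord_family0 a b : ord_family a b ord0 = a.
Proof. by rewrite /ord_family unlift_none. Qed.

Lemma ord_familyS a b j : ord_family a b (lift ord0 j) = b j.
Proof. by rewrite /ord_family liftK. Qed.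

Definition ord_familyE := (ord_family0, ord_familyS).

Variables (U : set V) (H K : nat -> V -> R).
Hypotheses (oU : open U) (HK : axial_tower U H K).

(** Each partial derivative of a member is a polynomial combination of members
    of the same tower, so that the order of differentiability can be raised by
    induction. *)
Lemma tower_classC m k : classC m U (H k) /\ classC m U (K k).
Proof.
elim: m k => [|m IH] k.
  by split; split=> // x /(HK k)[].
split.
  apply: (classC_succ (u' := ord_family (fun x => - K k.+1 x) (fun j x => x_ x j * H k.+1 x)) oU).
  - by move=> x /(HK k)[].
  - move=> i x /(HK k)[_ _ d0 _ dj].
    by case: (lift0_cases i) => [->|[j ->]]; rewrite ord_familyE//; have [] := dj j.
  - move=> i; case: (lift0_cases i) => [->|[j ->]]; rewrite ord_familyE.
      apply: (classC_eq oU) (classC_scale (-1) oU (IH k.+1).2) => x _.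
      by rewrite mulN1r.
    by apply: classC_mul => //; [exact: classC_coord|have [] := IH k.+1].
apply: (classC_succ (u' := ord_family (fun x => k.*2.+1%:R * H k x + sqradius x * H k.+1 x)
   (fun j x => x_ x j * K k.+1 x)) oU).
- by move=> x /(HK k)[].
- move=> i x /(HK k)[_ _ _ d0 dj].
  by case: (lift0_cases i) => [->|[j ->]]; rewrite ord_familyE//; have [] := dj j.
- move=> i; case: (lift0_cases i) => [->|[j ->]]; rewrite ord_familyE.
    apply: classC_add => //; first by apply: classC_scale => //; have [] := IH k.
    by apply: classC_mul => //; [exact: classC_sqradius|have [] := IH k.+1].
  by apply: classC_mul => //; [exact: classC_coord|have [] := IH k.+1].
Qed.

Lemma tower_classC_H m k : classC m U (H k). Proof. by have [] := tower_classC m k. Qed.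
Lemma tower_classC_K m k : classC m U (K k). Proof. by have [] := tower_classC m k. Qed.

Lemma is_derive_H0 k x : U x -> is_derive x (e_ ord0) (H k) (- K k.+1 x).
Proof. by move=> /(HK k)[]. Qed.
Lemma is_derive_K0 k x : U x ->
  is_derive x (e_ ord0) (K k) (k.*2.+1%:R * H k x + sqradius x * H k.+1 x).
Proof. by move=> /(HK k)[]. Qed.
Lemma is_derive_HS k j x : U x -> is_derive x (e_ (lift ord0 j)) (H k) (x_ x j * H k.+1 x).
Proof. by move=> /(HK k)[_ _ _ _ /(_ j)[]]. Qed.
Lemma is_derive_KS k j x : U x -> is_derive x (e_ (lift ord0 j)) (K k) (x_ x j * K k.+1 x).
Proof. by move=> /(HK k)[_ _ _ _ /(_ j)[]]. Qed.

(** The second derivative in x_0 gives - (2k+3) h_(k+1) - r^2 h_(k+2), and the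
    others give n h_(k+1) + r^2 h_(k+2). *)
Lemma laplacian_towerH k x : U x ->
  laplacian (H k) x = (n%:R - 3 - 2 * k%:R) * H k.+1 x.
Proof.
move=> Ux.
apply: (laplacianE (u1 := ord_family (fun x => -1 * K k.+1 x) (fun j x => x_ x j * H k.+1 x))
  (u2 := ord_family (fun x => -1 * (k.+1.*2.+1%:R * H k.+1 x + sqradius x * H k.+2 x))
    (fun j x => x_ x j * (x_ x j * H k.+2 x) + H k.+1 x * 1)) oU Ux).
- rewrite big_ord_recl ord_familyE; under eq_bigr => j _ do rewrite ord_familyE.
  rewrite big_split /= sumr_const card_ord -mulr_natl mulr1.
  under eq_bigr do rewrite mulrA; rewrite -mulr_suml -/(vecdot x x) -/(sqradius x).
  by rewrite doubleS -mul2n -!(natr1, natrM); ring.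
- move=> i y Uy; case: (lift0_cases i) => [->|[j ->]]; rewrite ord_familyE.
    by rewrite mulN1r; exact: is_derive_H0.
  exact: is_derive_HS.
- move=> i y Uy; case: (lift0_cases i) => [->|[j ->]]; rewrite !ord_familyE.
    by apply: is_derive_scale; exact: is_derive_K0.
  apply: is_derive_mul; last exact: is_derive_HS.
  by have := is_derive_coord y (lift ord0 j) (lift ord0 j); rewrite eqxx.
Qed.

Lemma laplacian_towerK k x : U x ->
  laplacian (K k) x = (n%:R - 1 - 2 * k%:R) * K k.+1 x.
Proof.
move=> Ux.
apply: (laplacianE (u1 := ord_family (fun x => k.*2.+1%:R * H k x + sqradius x * H k.+1 x)
    (fun j x => x_ x j * K k.+1 x))
  (u2 := ord_family (fun x => k.*2.+1%:R * (- K k.+1 x) +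
      (sqradius x * (- K k.+2 x) + H k.+1 x * 0))
    (fun j x => x_ x j * (x_ x j * K k.+2 x) + K k.+1 x * 1)) oU Ux).
- rewrite big_ord_recl ord_familyE; under eq_bigr => j _ do rewrite ord_familyE.
  rewrite big_split /= sumr_const card_ord -mulr_natl mulr1.
  under eq_bigr do rewrite mulrA; rewrite -mulr_suml -/(vecdot x x) -/(sqradius x).
  by rewrite -mul2n -!(natr1, natrM); ring.
- move=> i y Uy; case: (lift0_cases i) => [->|[j ->]]; rewrite ord_familyE.
    exact: is_derive_K0.
  exact: is_derive_KS.
- move=> i y Uy; case: (lift0_cases i) => [->|[j ->]]; rewrite !ord_familyE.
    apply: is_derive_add; first by apply: is_derive_scale; exact: is_derive_H0.
    by apply: is_derive_mul; [exact: is_derive_sqradius0|exact: is_derive_H0].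
  apply: is_derive_mul; last exact: is_derive_KS.
  by have := is_derive_coord y (lift ord0 j) (lift ord0 j); rewrite eqxx.
Qed.

(** The mixed term of the product rule adds 2 x_l h_(k+1) to the Laplacian
    of h_k multiplied by x_l. *)
Lemma laplacian_coord_towerH k l x : U x ->
  laplacian (fun y => x_ y l * H k y) x = (n%:R - 1 - 2 * k%:R) * (x_ x l * H k.+1 x).
Proof.
move=> Ux; pose dl j : R := (j == l)%:R.
apply: (laplacianE (u1 := ord_family (fun x => x_ x l * (- K k.+1 x))
    (fun j x => x_ x l * (x_ x j * H k.+1 x) + H k x * dl j))
  (u2 := ord_family (fun x => x_ x l * (-1 * (k.+1.*2.+1%:R * H k.+1 x + sqradius x * H k.+2 x)))
    (fun j x => (x_ x l * (x_ x j * (x_ x j * H k.+2 x) + H k.+1 x * 1) +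
        (x_ x j * H k.+1 x) * dl j)
      + dl j * (x_ x j * H k.+1 x))) oU Ux).
- rewrite big_ord_recl ord_familyE; under eq_bigr => j _ do rewrite ord_familyE.
  rewrite !big_split /= -mulr_sumr big_split /= sumr_const card_ord -mulr_natl mulr1.
  have E (F : 'I_n -> R) : \sum_j F j * dl j = F l.
    rewrite (bigD1 l)//= big1 ?addr0 /dl ?eqxx ?mulr1// => j /negbTE ->.
    by rewrite mulr0.
  rewrite (E (fun j => x_ x j * H k.+1 x)).
  under [\sum_i dl i * _]eq_bigr do rewrite mulrC.
  rewrite (E (fun j => x_ x j * H k.+1 x)).
  under eq_bigr do rewrite mulrA; rewrite -mulr_suml -/(vecdot x x) -/(sqradius x).
  by rewrite doubleS -mul2n -!(natr1, natrM); ring.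
- move=> i y Uy; case: (lift0_cases i) => [->|[j ->]]; rewrite ord_familyE.
    have := is_derive_mul (is_derive_coord y ord0 (lift ord0 l)) (is_derive_H0 k Uy).
    by rewrite (negbTE (neq_lift _ _)) mulr0 addr0.
  have := is_derive_mul (is_derive_coord y (lift ord0 j) (lift ord0 l)) (is_derive_HS k j Uy).
  by rewrite (inj_eq lift_inj).
- move=> i y Uy; case: (lift0_cases i) => [->|[j ->]]; rewrite !ord_familyE.
    have dN : is_derive y (e_ ord0) (fun x => - K k.+1 x)
        (-1 * (k.+1.*2.+1%:R * H k.+1 y + sqradius y * H k.+2 y)).
      have -> : (fun x => - K k.+1 x) = (fun x => -1 * K k.+1 x).
        by apply/funext => z; rewrite mulN1r.
      by apply: is_derive_scale; exact: is_derive_K0.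
    have := is_derive_mul (is_derive_coord y ord0 (lift ord0 l)) dN.
    by rewrite (negbTE (neq_lift _ _)) mulr0 addr0.
  have dxl := is_derive_coord y (lift ord0 j) (lift ord0 l).
  have dxj := is_derive_coord y (lift ord0 j) (lift ord0 j).
  rewrite (inj_eq lift_inj) -/(dl j) in dxl; rewrite eqxx in dxj.
  apply: is_derive_add.
    by apply: is_derive_mul => //; apply: is_derive_mul => //; exact: is_derive_HS.
  have -> : (fun x : V => H k x * dl j) = (fun x => dl j * H k x).
    by apply/funext => z; rewrite mulrC.
  by apply: is_derive_scale; exact: is_derive_HS.
Qed.

End TowerCalculus.

(** * Vectors and paravectors in the Clifford algebra *)

Section CliffordVectors.
Import ComplexField.Normc.
Variables (R : realType) (n : nat).
Notation V := 'rV[R]_n.+1.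
Notation e_ j := (delta_mx 0 j : V).
Notation x_ x j := (x 0 (lift ord0 j)).
Notation gen := (cliff_gen R).
Implicit Types (x : V) (A : {set 'I_n}) (j : 'I_n) (y : cliff R n).

(** The sign of the basis vector e_A in e_j e_B, for the only B such that
    e_j e_B is a multiple of e_A. *)
Definition gen_sign j A : R := csign R [set j]%SET (symdiff [set j]%SET A).

Lemma gen_mulE j y A : (gen j * y) A = gen_sign j A * y (symdiff [set j]%SET A).
Proof.
rewrite cliff_mulE (bigD1 [set j]%SET) //= big1 ?addr0 => [|B Bj].
  by rewrite ffunE eqxx mulr1.
by rewrite ffunE (negbTE Bj) mulr0 mul0r.
Qed.

Definition vec x : cliff R n := \sum_(j < n) x_ x j *: gen j.

Lemma paravecE x : paravec x = (x 0 ord0)%:A + vec x. Proof. by []. Qed.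

Lemma cliffDE (y z : cliff R n) A : (y + z) A = y A + z A. Proof. by rewrite ffunE. Qed.
Lemma cliffZE (a : R) y A : (a *: y) A = a * y A. Proof. by rewrite ffunE. Qed.

Lemma cliff_sumE (I : Type) (r : seq I) (F : I -> cliff R n) A :
  (\sum_(i <- r) F i) A = \sum_(i <- r) F i A.
Proof.
elim: r => [|i r IH]; first by rewrite !big_nil ffunE.
by rewrite !big_cons cliffDE IH.
Qed.

Lemma vec_mulE x y A :
  (vec x * y) A = \sum_(j < n) x_ x j * (gen_sign j A * y (symdiff [set j]%SET A)).
Proof.
rewrite /vec mulr_suml cliff_sumE; apply: eq_bigr => j _.
by rewrite -scalerAl cliffZE gen_mulE.
Qed.

Lemma addrr_inj (y z : cliff R n) : y + y = z + z -> y = z.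
Proof.
move=> /ffunP E; apply/ffunP => A; have := E A; rewrite !cliffDE; lra.
Qed.

Lemma gen_sqr j : gen j * gen j = -1.
Proof.
apply: addrr_inj; rewrite cliff_gen_anticomm eqxx mulr1
  -[in RHS](scaleN1r (1 : cliff R n)) -scalerDl.
by congr (_ *: _); lra.
Qed.

(** Symmetrising the double sum leaves the anticommutators of the generators. *)
Lemma vec_sqr x : vec x * vec x = - (sqradius x)%:A.
Proof.
have E : vec x * vec x = \sum_j \sum_k (x_ x j * x_ x k) *: (gen j * gen k).
  rewrite {1}/vec mulr_suml; apply: eq_bigr => j _; rewrite /vec mulr_sumr.
  by apply: eq_bigr => k _; rewrite -scalerAl -scalerAr scalerA.
apply: addrr_inj; rewrite [X in X + _ = _]E [X in _ + X = _]E.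
rewrite [X in _ + X = _]exchange_big -big_split /=.
have -> : - (sqradius x)%:A - (sqradius x)%:A = (- 2 * sqradius x)%:A :> cliff R n.
  by rewrite -opprD -scalerDl -scaleNr; congr (_ *: _); ring.
rewrite /sqradius /vecdot mulr_sumr scaler_suml; apply: eq_bigr => j _.
rewrite -big_split /= (bigD1 j) //= big1 ?addr0 => [|k kj].
  rewrite -scalerDr cliff_gen_anticomm eqxx mulr1 scalerA; congr (_ *: _); ring.
rewrite (mulrC (x_ x k)) -scalerDr cliff_gen_anticomm eq_sym (negbTE kj) mulr0.
by rewrite scale0r scaler0.
Qed.

Lemma cliff_conjD y z : cliff_conj (y + z) = cliff_conj y + cliff_conj z.
Proof. by have := cliff_conj_is_linear 1 y z; rewrite !scale1r. Qed.

Lemma cliff_conj0 : cliff_conj (0 : cliff R n) = 0.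
Proof. by apply/ffunP => A; rewrite !ffunE mulr0. Qed.

Lemma cliff_conjZ (a : R) y : cliff_conj (a *: y) = a *: cliff_conj y.
Proof. by have := cliff_conj_is_linear a y 0; rewrite cliff_conj0 !addr0. Qed.

Lemma cliff_conjN y : cliff_conj (- y) = - cliff_conj y.
Proof. by rewrite -scaleN1r cliff_conjZ scaleN1r. Qed.

Lemma cliff_conj1 : cliff_conj (1 : cliff R n) = 1.
Proof.
apply/ffunP => A; rewrite !ffunE; case: eqP => [->|_]; last by rewrite mulr0.
by rewrite csign0l mulr1.
Qed.

Lemma cliff_conj_vec x : cliff_conj (vec x) = - vec x.
Proof.
rewrite /vec (big_morph _ cliff_conjD cliff_conj0) -sumrN; apply: eq_bigr => j _.
by rewrite cliff_conjZ cliff_conj_gen scalerN.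
Qed.

Lemma cliff_conj_paravec x : cliff_conj (paravec x) = (x 0 ord0)%:A - vec x.
Proof. by rewrite paravecE cliff_conjD cliff_conjZ cliff_conj1 cliff_conj_vec. Qed.

Lemma scalar_inj (a b : R) : a%:A = b%:A :> cliff R n -> a = b.
Proof. by move=> /ffunP/(_ finset.set0); rewrite !cliffZE !ffunE eqxx !mulr1. Qed.

Lemma vec_eq0 x : sqradius x = 0 -> vec x = 0.
Proof.
move=> s0; rewrite /vec big1// => j _.
have : x_ x j * x_ x j = 0.
  apply: (psumr_eq0P _ s0) => // i _; by rewrite -expr2 sqr_ge0.
by move/eqP; rewrite mulf_eq0 orbb => /eqP ->; rewrite scale0r.
Qed.

Lemma cliff_realP x : cliff_real (paravec x) <-> sqradius x = 0.
Proof.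
split=> [[a aE]|s0]; last by exists (x 0 ord0); rewrite paravecE vec_eq0 ?addr0.
have : paravec x = cliff_conj (paravec x) by rewrite aE cliff_conjZ cliff_conj1.
rewrite cliff_conj_paravec paravecE => /addrI vN.
have v0 : vec x = 0 by apply: addrr_inj; rewrite addr0 {1}vN addNr.
have := vec_sqr x; rewrite v0 mul0r => /eqP.
by rewrite eq_sym oppr_eq0 -(scale0r (1 : cliff R n)) => /eqP/scalar_inj.
Qed.

(** At real points any J will do; a generator provides one. *)
Lemma slice_direction x : (0 < n)%N ->
  exists2 J, cliff_sphere J & vec x = Num.sqrt (sqradius x) *: J.
Proof.
move=> n0; have [s0|s0] := eqVneq (sqradius x) 0.
  exists (gen (Ordinal n0)); last by rewrite s0 sqrtr0 scale0r vec_eq0.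
  by split; rewrite cliff_conj_gen ?subrr// mulrN gen_sqr opprK.
have r0 : Num.sqrt (sqradius x) != 0.
  by rewrite sqrtr_eq0 -ltNge lt_neqAle eq_sym s0 sqradius_ge0.
exists ((Num.sqrt (sqradius x))^-1 *: vec x); last by rewrite scalerA mulfV// scale1r.
split; first by rewrite cliff_conjZ cliff_conj_vec scalerN subrr.
rewrite cliff_conjZ cliff_conj_vec -scalerAl -scalerAr scalerA mulrN vec_sqr opprK scalerA.
have -> : (Num.sqrt (sqradius x))^-1 * (Num.sqrt (sqradius x))^-1 * sqradius x = 1.
  by rewrite -{3}(sqr_sqrtr (sqradius_ge0 x)); field.
by rewrite scale1r.
Qed.

Lemma paravec_slice x J : vec x = Num.sqrt (sqradius x) *: J ->
  paravec x = slice_point (axial_point x) J.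
Proof. by move=> vJ; rewrite paravecE vJ. Qed.

Lemma cliff_sphere_conj (J : cliff R n) : cliff_sphere J -> cliff_conj J = - J.
Proof. by move=> [/eqP]; rewrite addrC addr_eq0 => /eqP. Qed.

Lemma cliff_sphereN (J : cliff R n) : cliff_sphere J -> cliff_sphere (- J).
Proof.
move=> JS; have JJ := cliff_sphere_conj JS; case: JS => J1 J2.
by split; rewrite cliff_conjN; [rewrite -opprD J1 oppr0|rewrite mulrNN].
Qed.

Lemma cliff_sphere_sqr (J : cliff R n) : cliff_sphere J -> J * J = -1.
Proof.
move=> JS; have := cliff_sphere_conj JS; case: JS => _ J2 JJ.
by rewrite -J2 JJ mulrN opprK.
Qed.

(** Taking the parts of x that are even and odd under conjugation shows that a
    representation x = a + J b determines a, and b up to sign; the sign is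
    absorbed by the invariance of D. *)
Lemma paravec_domainP (D : set R[i]) x : (0 < n)%N -> conj_invariant D ->
  paravec_domain D x <-> D (axial_point x).
Proof.
move=> n0 DJ; split=> [[z Dz [J JS xz]]|Dx]; last first.
  have [J JS vJ] := slice_direction x n0.
  by exists (axial_point x) => //; exists J => //; exact: paravec_slice.
have xzc : cliff_conj (paravec x) = (complex.Re z)%:A - complex.Im z *: J.
  by rewrite xz cliff_conjD !cliff_conjZ cliff_conj1 (cliff_sphere_conj JS) scalerN.
have Re0 : x 0 ord0 = complex.Re z.
  apply: scalar_inj; apply: addrr_inj.
  have -> : (x 0 ord0)%:A + (x 0 ord0)%:A = paravec x + cliff_conj (paravec x) :> cliff R n.
    by rewrite cliff_conj_paravec paravecE addrACA subrr addr0.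
  by rewrite xzc xz /slice_point addrACA subrr addr0.
have vE : vec x = complex.Im z *: J.
  by move: xz; rewrite paravecE /slice_point Re0 => /addrI.
have sE : sqradius x = complex.Im z ^+ 2.
  apply: scalar_inj; apply: oppr_inj; rewrite -vec_sqr vE -scalerAl -scalerAr scalerA.
  by rewrite (cliff_sphere_sqr JS) scalerN expr2.
have zE : axial_point x = Complex (complex.Re z) `|complex.Im z|.
  by rewrite /axial_point Re0 sE sqrtr_sqr.
rewrite zE; case: (ger0P (complex.Im z)) => _; first by case: z Dz {xz xzc Re0 vE sE zE}.
by have := DJ z Dz; case: z {Dz xz xzc Re0 vE sE zE}.
Qed.

End CliffordVectors.

(** * Slice functions and spherical derivatives as axial towers *)

Section LocalRepresentation.
Import ComplexField.Normc.
Variables (R : realType) (n : nat).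
Hypothesis n0 : (0 < n)%N.
Notation V := 'rV[R]_n.+1.
Notation e_ j := (delta_mx 0 j : V).
Notation x_ x j := (x 0 (lift ord0 j)).
Implicit Types (x : V) (A : {set 'I_n}) (j : 'I_n) (U : set V) (D : set R[i]).

(** The copy of the complex plane in the space of paravectors that is spanned
    by 1 and the first generator. *)
Definition plane_point (w : R[i]) : V := \row_i
  (if i == ord0 then complex.Re w
   else if i == lift ord0 (Ordinal n0) then complex.Im w else 0).

Lemma plane_point_axial (w : R[i]) :
  axial_point (plane_point w) = Complex (complex.Re w) `|complex.Im w|.
Proof.
rewrite /axial_point mxE eqxx -sqrtr_sqr; congr (Complex _ (Num.sqrt _)).
rewrite /sqradius /vecdot (bigD1 (Ordinal n0)) //= big1 ?addr0 => [|j jn].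
  by rewrite mxE eq_sym (negbTE (neq_lift _ _)) eqxx expr2.
by rewrite mxE eq_sym (negbTE (neq_lift _ _)) (inj_eq lift_inj) (negbTE jn) mulr0.
Qed.

Lemma plane_point_dist (w z : R[i]) : `|plane_point w - plane_point z| <= normc (w - z).
Proof.
rewrite [leLHS]/Num.Def.normr /= mx_normrE; apply: bigmax_le; first exact: normc_ge0.
move=> [i k] _ /=; rewrite !mxE; case: ifP => _.
  by rewrite -raddfB; exact: normc_Re.
case: ifP => _; first by rewrite -raddfB; exact: normc_Im.
by rewrite subrr normr0 normc_ge0.
Qed.

Lemma conj_invariant_abs D (a b : R) : conj_invariant D ->
  D (Complex a `|b|) -> D (Complex a b).
Proof. by move=> DJ; case: (ger0P b) => // _ /DJ /=; rewrite opprK. Qed.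

(** [plane_point] is continuous, and the preimage of the open domain under it
    is D. *)
Lemma profile_open D x : conj_invariant D ->
  open (paravec_domain D : set V) -> paravec_domain D x ->
  exists2 rho, 0 < rho & forall w, normc (w - axial_point x) < rho -> D w.
Proof.
move=> DJ oD; rewrite (paravec_domainP _ n0 DJ) => Dz.
have sz : axial_point (plane_point (axial_point x)) = axial_point x.
  by rewrite plane_point_axial /axial_point /= ger0_norm ?sqrtr_ge0.
have Oz : paravec_domain D (plane_point (axial_point x)).
  by rewrite (paravec_domainP _ n0 DJ) sz.
have /(@nbhs_normP R V (plane_point (axial_point x)))[d /= d0 dD] :
    nbhs (plane_point (axial_point x)) (paravec_domain D : set V).
  exact: open_nbhs_nbhs.
exists d => // w wz; have : (paravec_domain D : set V) (plane_point w).
  apply: dD; rewrite /= distrC; apply: le_lt_trans (plane_point_dist _ _) wz.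
rewrite (paravec_domainP _ n0 DJ) plane_point_axial => /(conj_invariant_abs DJ).
by case: w {wz}.
Qed.

(** A real point is left by an arbitrarily small step along the first
    generator. Properness makes the limit that defines the spherical derivative
    unique. *)
Lemma nonreal_near x : ProperFilter (within [set y : V | ~ cliff_real (paravec y)] (nbhs x)).
Proof.
apply: Build_ProperFilter_ex => P; rewrite /within /=.
move=> /(@nbhs_normP R V x)[d /= d0 dP].
have [xr|xr] := pselect (cliff_real (paravec x)); last first.
  by exists x; apply: dP => //=; rewrite subrr normr0.
pose y := x + (d / 2) *: e_ (lift ord0 (Ordinal n0)).
have d20 : 0 < d / 2 by rewrite divr_gt0.
exists y; apply: dP.
  rewrite /= /y opprD addrA subrr sub0r normrN normrZ gtr0_norm//.
  apply: (@le_lt_trans _ _ (d / 2)); last by lra.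
  rewrite -[leRHS]mulr1 ler_wpM2l ?(ltW d20)//.
  rewrite [leLHS]/Num.Def.normr /= mx_normrE; apply: bigmax_le => // -[i i'] _ /=.
  by rewrite mxE; case: (_ && _); rewrite ?normr1 ?normr0.
rewrite /= cliff_realP /y sqradiusD vecdot_delta /sqradius vecdot_delta.
move: xr; rewrite cliff_realP => xs; rewrite -/(sqradius x) xs.
have -> : x_ x (Ordinal n0) = 0.
  have : x_ x (Ordinal n0) * x_ x (Ordinal n0) = 0.
    by apply: (psumr_eq0P _ xs) => // i _; rewrite -expr2 sqr_ge0.
  by move=> /eqP; rewrite mulf_eq0 orbb => /eqP.
rewrite !mulr0 !add0r !mxE !eqxx mulr1 => /eqP.
by rewrite mulf_eq0 orbb gt_eqF.
Qed.

(** With v = r J, the relation F_2 = r h_0 turns F_1 + J F_2 into k_0 + v h_0,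
    which makes sense also when r = 0. The spherical derivative agrees with h_0
    at the nonreal points, hence also at the real ones, h_0 being continuous. *)
Theorem local_representation D (f : cliff R n -> cliff R n) (x0 : V) :
  conj_invariant D -> open (paravec_domain D : set V) -> slice_regular D f ->
  paravec_domain D x0 ->
  exists U (H K : nat -> V -> cliff R n), [/\ open U, U x0,
    forall A, axial_tower U (fun k x => H k x A) (fun k x => K k x A) &
    forall x, U x -> f (paravec x) = K 0%N x + vec x * H 0%N x /\
                     spherical_derivative f x = H 0%N x].
Proof.
move=> DJ oD [F1 [F2 [stem hF fE]]] Ox0.
have [rho rho0 Drho] := profile_open DJ oD Ox0.
have [U [oU Ux0 UD tow]] := local_axial_tower rho0 DJ Drho.
have /choice[HK HKP] : forall A, exists HK : (nat -> V -> R) * (nat -> V -> R),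
    axial_tower U HK.1 HK.2 /\ forall x, U x -> HK.2 0%N x = F1 (axial_point x) A /\
      Num.sqrt (sqradius x) * HK.1 0%N x = F2 (axial_point x) A.
  move=> A; have [||H [K [t e]]] := tow (fun z => F1 z A) (fun z => F2 z A).
  - by move=> z /stem[-> ->]; rewrite ffunE.
  - by move=> z Dz; exact: (hF z Dz A).
  by exists (H, K).
pose H k x : cliff R n := [ffun A => (HK A).1 k x].
pose K k x : cliff R n := [ffun A => (HK A).2 k x].
have HKt A : axial_tower U (fun k x => H k x A) (fun k x => K k x A).
  have [+ _] := HKP A; rewrite (_ : (fun k x => H k x A) = (HK A).1); last first.
    by apply/funext => k; apply/funext => x; rewrite /H ffunE.
  rewrite (_ : (fun k x => K k x A) = (HK A).2)//.
  by apply/funext => k; apply/funext => x; rewrite /K ffunE.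
exists U, H, K; split=> //.
have KE x : U x -> F1 (axial_point x) = K 0%N x.
  by move=> Ux; apply/ffunP => A; rewrite /K ffunE; have [_ /(_ x Ux)[-> _]] := HKP A.
have HE x : U x -> F2 (axial_point x) = Num.sqrt (sqradius x) *: H 0%N x.
  move=> Ux; apply/ffunP => A; rewrite cliffZE /H ffunE.
  by have [_ /(_ x Ux)[_ ->]] := HKP A.
have fpE x : U x -> f (paravec x) = K 0%N x + vec x * H 0%N x.
  move=> Ux; have [J JS vJ] := slice_direction x n0.
  rewrite (paravec_slice vJ) (fE _ _ (UD x Ux) JS) (KE x Ux) (HE x Ux) vJ.
  by rewrite -scalerAl -scalerAr.
have fcE x : U x -> f (cliff_conj (paravec x)) = K 0%N x - vec x * H 0%N x.
  move=> Ux; have [J JS vJ] := slice_direction x n0.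
  have -> : cliff_conj (paravec x) = slice_point (axial_point x) (- J).
    by rewrite cliff_conj_paravec vJ /slice_point scalerN.
  rewrite (fE _ _ (UD x Ux) (cliff_sphereN JS)) (KE x Ux) (HE x Ux) vJ.
  by rewrite -scalerAl mulNr -scalerAr.
have qE x : U x -> ~ cliff_real (paravec x) -> spherical_quotient f (paravec x) = H 0%N x.
  move=> Ux; rewrite cliff_realP => /eqP s0.
  have vu : vec x \is a GRing.unit.
    apply/unitrP; exists ((sqradius x)^-1 *: - vec x).
    by rewrite -scalerAl -scalerAr mulNr mulrN vec_sqr opprK scalerA mulVf// scale1r.
  have ImE : cliff_Im (paravec x) = vec x.
    rewrite /cliff_Im cliff_conj_paravec paravecE opprB addrC addrA subrK.
    by apply/ffunP => A; rewrite cliffZE cliffDE; field.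
  rewrite /spherical_quotient ImE (fpE x Ux) (fcE x Ux).
  have -> : K 0%N x + vec x * H 0%N x - (K 0%N x - vec x * H 0%N x) =
      vec x * (H 0%N x + H 0%N x).
    by rewrite opprB addrC addrA subrK mulrDr.
  by rewrite mulKr//; apply/ffunP => A; rewrite cliffZE cliffDE; field.
move=> x Ux; split; first exact: fpE.
rewrite /spherical_derivative; case: pselect => [xr|xr]; last exact: qE.
apply/ffunP => A; rewrite ffunE; have FF := nonreal_near x.
apply: cvg_lim => //.
have cH : {for x, continuous (fun y => H 0%N y A)} by have [] := HKt A 0%N x Ux.
have E : \forall y \near within [set y : V | ~ cliff_real (paravec y)] (nbhs x),
    H 0%N y A = spherical_quotient f (paravec y) A.
  rewrite /prop_near1 /within /=.
  by apply: (open_near oU Ux) => y Uy yr; rewrite qE.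
have cW : H 0%N y A @[y --> within [set y : V | ~ cliff_real (paravec y)] (nbhs x)] --> H 0%N x A.
  apply: cvg_trans cH; apply: cvg_app; exact: cvg_within.
exact: (cvg_trans (near_eq_cvg E) cW).
Qed.

End LocalRepresentation.

(** * Laplacian and Cauchy-Riemann operator on axial maps *)

Section AxialCalculus.
Variables (R : realType) (n : nat).
Notation V := 'rV[R]_n.+1.
Notation e_ j := (delta_mx 0 j : V).
Notation x_ x j := (x 0 (lift ord0 j)).
Notation gen := (cliff_gen R).
Implicit Types (x : V) (A : {set 'I_n}) (g u : V -> cliff R n).

Lemma cliffNE (y : cliff R n) A : (- y) A = - y A.
Proof. by rewrite ffunE. Qed.

Lemma cliff_laplacianE u x A : cliff_laplacian u x A = laplacian (component u A) x.
Proof. exact: ffunE. Qed.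

Lemma cliff_partialE i u x A : cliff_partial i u x A = partial i (component u A) x.
Proof. exact: ffunE. Qed.

Lemma cliff_laplacian_eq_on (U : set V) u g : open U -> (forall x, U x -> u x = g x) ->
  forall x, U x -> cliff_laplacian u x = cliff_laplacian g x.
Proof.
move=> oU ug x Ux; apply/ffunP => A.
apply: etrans (cliff_laplacianE u x A) (etrans _ (esym (cliff_laplacianE g x A))).
by apply: (laplacian_eq_on oU) Ux => y Uy; rewrite /component ug.
Qed.

Lemma cliff_classC_eq_on k (U : set V) u g : open U -> (forall x, U x -> u x = g x) ->
  cliff_classC k U u -> cliff_classC k U g.
Proof.
move=> oU ug Cu A; apply: (classC_eq oU) (Cu A) => x Ux.
by rewrite /component ug.
Qed.

Lemma cliff_classCZ k (U : set V) (c : R) g : open U -> cliff_classC k U g ->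
  cliff_classC k U (fun x => c *: g x).
Proof.
move=> oU Cg A; rewrite (_ : component _ A = (fun x => c * component g A x)).
  exact: classC_scale.
by apply/funext => x; rewrite /component cliffZE.
Qed.

Lemma cliff_laplacianZ (U : set V) (c : R) g x : open U -> cliff_classC 2 U g -> U x ->
  cliff_laplacian (fun y => c *: g y) x = c *: cliff_laplacian g x.
Proof.
move=> oU Cg Ux; apply/ffunP => A; rewrite cliffZE.
apply: etrans (cliff_laplacianE _ x A) _.
apply: (etrans _ (congr1 ( *%R c) (esym (cliff_laplacianE g x A)))).
rewrite (_ : component _ A = (fun x => c * component g A x)).
  exact: (laplacianZ c oU (Cg A) Ux).
by apply/funext => y; rewrite /component cliffZE.
Qed.

Lemma iter_cliff_laplacian (U : set V) (G : nat -> V -> cliff R n) (c : nat -> R) (a : R) u m :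
  open U -> (forall k, cliff_classC 2 U (G k)) ->
  (forall k x, U x -> cliff_laplacian (G k) x = c k *: G k.+1 x) ->
  (forall x, U x -> u x = a *: G 0%N x) ->
  forall x, U x -> iter m (@cliff_laplacian R n) u x = (a * \prod_(k < m) c k) *: G m x.
Proof.
move=> oU CG LG u0; elim: m => [|m IH] x Ux; first by rewrite big_ord0 mulr1; exact: u0.
rewrite iterS (cliff_laplacian_eq_on oU IH Ux) (cliff_laplacianZ _ oU (CG m) Ux).
by rewrite LG// scalerA big_ord_recr /= mulrA.
Qed.

Variables (U : set V) (H K : nat -> V -> cliff R n).
Hypothesis oU : open U.
Hypothesis tow : forall A, axial_tower U (fun k x => H k x A) (fun k x => K k x A).

Definition axial_map k x : cliff R n := K k x + vec x * H k x.

Lemma axial_map_component k A : component (axial_map k) A =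
  (fun x => K k x A + \sum_(j < n) gen_sign R j A *
                        (x_ x j * H k x (symdiff [set j]%SET A))).
Proof.
apply/funext => x; rewrite /component /axial_map cliffDE vec_mulE; congr (_ + _).
by apply: eq_bigr => j _; rewrite mulrCA.
Qed.

Lemma axial_H_classC m k : cliff_classC m U (H k).
Proof. by move=> A; exact: (tower_classC_H oU (tow A)). Qed.

Lemma classC_term m k j A :
  classC m U (fun x => gen_sign R j A * (x_ x j * H k x (symdiff [set j]%SET A))).
Proof.
apply: classC_scale => //; apply: classC_mul => //; first exact: classC_coord.
exact: axial_H_classC.
Qed.

Lemma axial_map_classC m k : cliff_classC m U (axial_map k).
Proof.
move=> A; rewrite axial_map_component; apply: classC_add => //.
  exact: (tower_classC_K oU (tow A)).
by apply: classC_sumr => // j; exact: classC_term.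
Qed.

Lemma laplacian_H k x : U x ->
  cliff_laplacian (H k) x = (n%:R - 3 - 2 * k%:R) *: H k.+1 x.
Proof.
move=> Ux; apply/ffunP => A; rewrite cliffZE cliff_laplacianE.
exact: (laplacian_towerH oU (tow A)).
Qed.

Lemma iter_laplacian_H m (a : R) u x : (forall y, U y -> u y = a *: H 0%N y) -> U x ->
  iter m (@cliff_laplacian R n) u x = (a * \prod_(k < m) (n%:R - 3 - 2 * k%:R)) *: H m x.
Proof.
move=> uE Ux; pose c k : R := n%:R - 3 - 2 * k%:R.
apply: (iter_cliff_laplacian (c := c) m oU _ _ uE Ux); first exact: axial_H_classC.
exact: laplacian_H.
Qed.

Lemma laplacian_axial_map k x : U x ->
  cliff_laplacian (axial_map k) x = (n%:R - 1 - 2 * k%:R) *: axial_map k.+1 x.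
Proof.
move=> Ux; apply/ffunP => A; rewrite cliffZE cliff_laplacianE axial_map_component.
rewrite (laplacianD oU _ _ Ux); last first.
- by apply: classC_sumr => // j; exact: classC_term.
- exact: (tower_classC_K oU (tow A)).
rewrite (laplacian_towerK oU (tow A) k Ux) (laplacian_sumr _ oU _ Ux); last first.
  by move=> j; exact: classC_term.
rewrite -[RHS]/(_ * component (axial_map k.+1) A x) axial_map_component mulrDr.
congr (_ + _); rewrite mulr_sumr; apply: eq_bigr => j _.
rewrite (laplacianZ _ oU _ Ux); last first.
  by apply: classC_mul => //; [exact: classC_coord|exact: axial_H_classC].
rewrite (laplacian_coord_towerH oU (tow _) k j Ux); ring.
Qed.

Lemma iter_laplacian_axial_map m (a : R) u x :
  (forall y, U y -> u y = a *: axial_map 0 y) -> U x ->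
  iter m (@cliff_laplacian R n) u x =
  (a * \prod_(k < m) (n%:R - 1 - 2 * k%:R)) *: axial_map m x.
Proof.
move=> uE Ux; pose c k : R := n%:R - 1 - 2 * k%:R.
apply: (iter_cliff_laplacian (c := c) m oU _ _ uE Ux); first exact: axial_map_classC.
exact: laplacian_axial_map.
Qed.

Lemma cliff_partial_eq_on u g i x : (forall y, U y -> u y = g y) -> U x ->
  cliff_partial i u x = cliff_partial i g x.
Proof.
move=> ug Ux; apply/ffunP => A; rewrite (cliff_partialE i u) (cliff_partialE i g).
by apply: (partial_eq_on _ oU) Ux => y Uy; rewrite /component ug.
Qed.

Lemma partialE i (v : V -> R) x (a : R) : is_derive x (e_ i) v a -> partial i v x = a.
Proof. by case. Qed.

Lemma cliff_partial0_axial c k x : U x ->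
  cliff_partial ord0 (fun y => c *: axial_map k y) x =
  c *: (k.*2.+1%:R *: H k x + sqradius x *: H k.+1 x - vec x * K k.+1 x).
Proof.
move=> Ux; apply/ffunP => A; rewrite cliff_partialE.
rewrite (_ : component _ A = (fun y => c * component (axial_map k) A y)); last first.
  by apply/funext => y; rewrite /component cliffZE.
rewrite axial_map_component.
apply: etrans.
  apply: partialE; apply: is_derive_scale; apply: is_derive_add.
    exact: (is_derive_K0 (tow A) k Ux).
  apply: is_derive_sumr => j; apply: is_derive_scale; apply: is_derive_mul.
    exact: is_derive_coord.
  exact: (is_derive_H0 (tow _) k Ux).
rewrite /= !cliffZE !cliffDE !cliffZE cliffNE vec_mulE; congr (_ * (_ + _)).
rewrite -sumrN; apply: eq_bigr => j _.
by ring.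
Qed.

Lemma cliff_partialS_axial c k i x : U x ->
  cliff_partial (lift ord0 i) (fun y => c *: axial_map k y) x =
  c *: (x_ x i *: K k.+1 x + x_ x i *: (vec x * H k.+1 x) + gen i * H k x).
Proof.
move=> Ux; apply/ffunP => A; rewrite cliff_partialE.
rewrite (_ : component _ A = (fun y => c * component (axial_map k) A y)); last first.
  by apply/funext => y; rewrite /component cliffZE.
rewrite axial_map_component.
apply: etrans.
  apply: partialE; apply: is_derive_scale; apply: is_derive_add.
    exact: (is_derive_KS (tow A) k i Ux).
  apply: is_derive_sumr => j; apply: is_derive_scale; apply: is_derive_mul.
    exact: is_derive_coord.
  exact: (is_derive_HS (tow _) k i Ux).
rewrite /= !cliffZE !cliffDE !cliffZE gen_mulE vec_mulE -addrA; congr (_ * (_ + _)).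
rewrite mulr_sumr.
under eq_bigr => j _ do rewrite mulrDr (inj_eq lift_inj).
rewrite big_split /=; congr (_ + _).
  by apply: eq_bigr => j _; ring.
rewrite (bigD1 i)//= big1 ?addr0 => [|j ji]; first by rewrite eqxx mulr1.
by rewrite eq_sym (negbTE ji) !mulr0.
Qed.

(** Multiplying the derivatives in x_j by e_j and summing gives
    v k_(m+1) - n h_m - r^2 h_(m+1), since e_j^2 = -1 and v^2 = - r^2; the
    derivative in x_0 cancels all terms but a multiple of h_m. *)
Lemma dbar_axial u c k x : (forall y, U y -> u y = c *: axial_map k y) -> U x ->
  dbar u x = (c * (k.*2.+1%:R - n%:R)) *: H k x.
Proof.
move=> uE Ux; rewrite /dbar (cliff_partial_eq_on _ uE Ux) cliff_partial0_axial//.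
under eq_bigr => i _ do
  rewrite (cliff_partial_eq_on _ uE Ux) cliff_partialS_axial// -scalerAr.
rewrite -scaler_sumr -scalerDr -scalerA; congr (_ *: _).
under eq_bigr => i _ do rewrite !mulrDr -!scalerAr
  (mulrA (gen i) (gen i)) gen_sqr mulN1r !scalerAl.
rewrite !big_split /= -!mulr_suml -/(vec x) mulrA vec_sqr sumr_const card_ord.
rewrite mulNr -scalerAl mul1r scalerBl scaler_nat mulNrn [n%:R *: _]scaler_nat.
by rewrite -!addrA; congr (_ + _); rewrite addKr addrA subrr add0r.
Qed.

End AxialCalculus.

(** * Harmonicity and polyharmonicity of slice-regular functions *)

(* The classC conditions (the first one below and those contained in
   cliff_harmonic and cliff_polyharmonic) say that all the iterated derivatives
   in the equations exist. *)
Theorem corollary4p4 (R : realType) (n : nat) (n_gt3 : (3 < n)%N) (n_odd : odd n)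
    (D : set R[i]) (f : cliff R n -> cliff R n)
    (D_conj : conj_invariant D)
    (Omega_open : open (paravec_domain D : set 'rV[R]_n.+1))
    (f_regular : slice_regular D f) :
  let Omega : set 'rV[R]_n.+1 := paravec_domain D in
  let f0 : 'rV[R]_n.+1 -> cliff R n := fun x => f (paravec x) in
  let fs : 'rV[R]_n.+1 -> cliff R n := spherical_derivative f in
  let Delta (k : nat) (g : 'rV[R]_n.+1 -> cliff R n) :=
    iter k (@cliff_laplacian R n) g in
  [/\ cliff_classC n.-1 Omega fs /\
      cliff_harmonic Omega (Delta ((n - 3)./2) fs),
      forall x, Omega x ->
        [/\ dbar (Delta ((n - 1)./2) f0) x = Delta ((n - 1)./2) (dbar f0) x,
            Delta ((n - 1)./2) (dbar f0) x = (1 - n%:R) *: Delta ((n - 1)./2) fs x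
          & (1 - n%:R) *: Delta ((n - 1)./2) fs x = 0]
    & cliff_polyharmonic ((n + 1)./2) Omega f0].
Proof.
move=> Omega f0 fs Delta; rewrite /Delta {Delta}; set L := @cliff_laplacian R n.
pose p := n./2; have nE : n = p.*2.+1 by rewrite -[LHS]odd_double_half n_odd.
have p2 : (1 < p)%N by move: n_gt3; rewrite nE; case: (p) => [|[]].
have -> : ((n - 3)./2 = p.-1)%N.
  by rewrite nE; case: (p) p2 => [|q] //= _; rewrite doubleS !subSS subn0 doubleK.
have -> : ((n - 1)./2 = p)%N by rewrite nE subn1 /= doubleK.
have -> : ((n + 1)./2 = p.+1)%N by rewrite nE addn1 /= doubleK.
have nR : n%:R = 2 * p%:R + 1 :> R by rewrite nE -mul2n -natr1 natrM.
have n0 : (0 < n)%N by exact: leq_trans n_gt3.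
have loc x : Omega x -> exists U (H K : nat -> 'rV[R]_n.+1 -> cliff R n),
  [/\ open U, U x, forall A, axial_tower U (fun k x => H k x A) (fun k x => K k x A),
      forall y, U y -> f0 y = 1 *: axial_map H K 0 y & forall y, U y -> fs y = 1 *: H 0%N y].
  move=> Ox.
  have [U [H [K [oU Ux tow E]]]] := local_representation n0 D_conj Omega_open f_regular Ox.
  by exists U, H, K; split=> // y Uy; rewrite scale1r; have [] := E y Uy.
(* The vanishing factors: index p - 1 for h_m, and index p for k_m + v h_m. *)
have prod_fs : \prod_(k < p) (n%:R - 3 - 2 * k%:R) = 0 :> R.
  apply/eqP/prodf_eq0; have lt : (p.-1 < p)%N by rewrite prednK// ltnW.
  by exists (Ordinal lt) => //=; rewrite nR -{1}(prednK (ltnW p2)) -natr1; apply/eqP; ring.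
have prod_f0 : \prod_(k < p.+1) (n%:R - 1 - 2 * k%:R) = 0 :> R.
  by apply/eqP/prodf_eq0; exists ord_max => //=; rewrite nR; apply/eqP; ring.
have Lfs0 x : Omega x -> iter p L fs x = 0.
  move=> /loc[U [H [K [oU Ux tow _ E]]]].
  by rewrite (iter_laplacian_H oU tow _ E Ux) prod_fs mulr0 scale0r.
split; first split.
- move=> A; apply: classC_local => x /loc[U [H [K [oU Ux tow _ E]]]].
  exists U; split=> //.
  by apply: (cliff_classC_eq_on oU) (axial_H_classC oU tow _ 0) A => y /E ->; rewrite scale1r.
- move=> A; split.
    apply: classC_local => x /loc[U [H [K [oU Ux tow _ E]]]]; exists U; split=> //.
    have CH := axial_H_classC oU tow 2 p.-1.
    apply: (cliff_classC_eq_on oU) (cliff_classCZ _ oU CH) A => y Uy.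
    by rewrite (iter_laplacian_H oU tow _ E Uy).
  move=> x /Lfs0; rewrite -{1}(prednK (ltnW p2)) iterS => /ffunP/(_ A).
  by rewrite /L cliff_laplacianE ffunE.
- move=> x Ox; have [U [H [K [oU Ux tow E Es]]]] := loc x Ox.
  have -> : dbar (iter p L f0) x = 0.
    have iE y : U y -> iter p L f0 y =
        (1 * \prod_(k < p) (n%:R - 1 - 2 * k%:R)) *: axial_map H K p y.
      exact: iter_laplacian_axial_map.
    by rewrite (dbar_axial oU tow iE Ux) -nE subrr mulr0 scale0r.
  have dbarf y : U y -> dbar f0 y = (1 - n%:R) *: H 0%N y.
    by move=> Uy; rewrite (dbar_axial oU tow E Uy) mul1r.
  have -> : iter p L (dbar f0) x = 0.
    by rewrite (iter_laplacian_H oU tow _ dbarf Ux) prod_fs mulr0 scale0r.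
  by rewrite Lfs0// scaler0.
split.
  move=> A; apply: classC_local => x /loc[U [H [K [oU Ux tow E _]]]]; exists U; split=> //.
  by apply: (cliff_classC_eq_on oU) (axial_map_classC oU tow _ 0) A => y /E ->; rewrite scale1r.
move=> x /loc[U [H [K [oU Ux tow E _]]]].
by rewrite (iter_laplacian_axial_map oU tow _ E Ux) prod_f0 mulr0 scale0r.
Qed.
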